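(* Suppose that: (a) $U\in C^2(\mathbb R)$, $e^{-U}\in L^1(\mathbb R)$, and there are $\delta\in(0,1)$, $a\in\mathbb R$, $A>0$ with $a\le U''(x)\le \delta|U'(x)|^2+A$ for all $x\in\mathbb R$; (b) $\lim_{x\to\infty}U'(x)=+\infty$ and $\lim_{x\to-\infty}U'(x)=-\infty$; (c) $U(0)=0$, $U'(x)\le 0$ for $x\le 0$ and $U'(x)\ge 0$ for $x\ge 0$; (d) $U(x)=U(-x)$ for all $x\in\mathbb R$; (e) $\lambda_{\mathrm{refr}}(x)=0$ for all $x$. In what follows every statement involving $\pm$ is to be read as two statements, one for $+$ and one for $-$. With $L^\pm$, $Z^\pm$ and $\Sigma^\pm=\{\gamma\in\mathbb C:Z^\pm(\gamma)=0\}$ as in the context, $\sigma_p(L^\pm)=\sigma(L^\pm)=\Sigma^\pm$. If $\gamma\in\rho(L^\pm)$ then, for $h\in L^2(\nu)$, $f^\pm=(\gamma-L^\pm)^{-1}h\in W^{1,2}(\nu)$ admits the expression $$f^\pm(x)=\begin{cases}e^{\gamma x}\left(\frac{m_\gamma^\pm(h)}{Z^\pm(\gamma)}+\int_x^0e^{-\gamma\xi}h(\xi)\,d\xi\right),&x\le0,\\ e^{\gamma x+U(x)}\int_x^\infty e^{-\gamma\xi-U(\xi)}\left[h(\xi)\pm U'(\xi)e^{-\gamma\xi}\left(\frac{m_\gamma^\pm(h)}{Z^\pm(\gamma)}+\int_{-\xi}^0e^{-\gamma\eta}h(\eta)\,d\eta\right)\right]d\xi,&x>0,\end{cases}$$ where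 $$m_\gamma^\pm(h)=\int_0^\infty e^{-\gamma\xi-U(\xi)}\left[h(\xi)\pm U'(\xi)e^{-\gamma\xi}\int_0^\xi e^{\gamma\eta}h(-\eta)\,d\eta\right]d\xi.$$ For every $\gamma\in\sigma(L^\pm)$ the associated space of eigenfunctions is one-dimensional and spanned by $f_\gamma^\pm\in W^{1,2}(\nu)$ given by $$f_\gamma^\pm(x)=\begin{cases}e^{\gamma x},&x\le0,\\ \pm e^{\gamma x+U(x)}\int_x^\infty U'(\xi)e^{-2\gamma\xi-U(\xi)}\,d\xi,&x\ge0.\end{cases}$$
   Context: $U:\mathbb R\to\mathbb R$ is the potential, $\lambda_{\mathrm{refr}}:\mathbb R\to[0,\infty)$ a continuous function, $\lambda^+(x)=\max(U'(x),0)+\lambda_{\mathrm{refr}}(x)$. $\nu$ is the measure on $\mathbb R$ with $\nu(dx)=e^{-U(x)}dx$, and $W^{1,2}(\nu)$ is the Sobolev space of functions in $L^2(\nu)$ (complex Hilbert space) with a weak derivative in $L^2(\nu)$. The operators $L^\pm$ on $L^2(\nu)$ have domain $W^{1,2}(\nu)$ and are given by $$L^\pm f(x)=f'(x)+\lambda^+(x)\,(\pm f(-x)-f(x)).$$ For $\gamma\in\mathbb C$, $Z^\pm(\gamma)=1\mp\int_0^\infty U'(\eta)e^{-2\gamma\eta-U(\eta)}\,d\eta$. $\rho$, $\sigma$, $\sigma_p$ denote resolvent set, spectrum and point spectrum (set of $\gamma$ with $\gamma-L^\pm$ not injective). *)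

(* Defs.v *)
From HB Require Import structures.
From mathcomp Require Import all_boot all_order all_algebra.
From mathcomp Require Import all_classical all_reals all_analysis.
From mathcomp Require Import measurable_realfun.
From mathcomp Require Import complex.

Set Implicit Arguments.
Unset Strict Implicit.
Unset Printing Implicit Defensive.
Import Order.TTheory GRing.Theory Num.Theory.
Import numFieldNormedType.Exports.

Local Open Scope ring_scope.
Local Open Scope classical_set_scope.
Local Open Scope complex_scope.

Section complex_calculus.
Context {R : realType}.
Implicit Types (f g : R -> R[i]) (z : R[i]).

Definition cexp z : R[i] :=
  (expR (complex.Re z))%:C * (cos (complex.Im z) +i* sin (complex.Im z)).

(* As for [Rintegral], meaningful only when the real and imaginary parts of f
   are integrable on D. *)
Definition cintegral (D : set R) f : R[i] :=
  (\int[lebesgue_measure]_(x in D) complex.Re (f x)) +i*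
  (\int[lebesgue_measure]_(x in D) complex.Im (f x)).

Definition clocally_integrable f :=
  locally_integrable setT (@complex.Re R \o f) /\
  locally_integrable setT (@complex.Im R \o f).

(* C_c^oo(R); real-valued test functions suffice, by linearity. *)
Definition test_function (phi : R -> R) :=
  (forall n x, derivable (derive1n n phi) x 1) /\
  compact (closure [set x | phi x != 0]).

Definition is_weak_derivative f g :=
  [/\ clocally_integrable f, clocally_integrable g &
    forall phi, test_function phi ->
      cintegral setT (fun x => f x * (derive1 phi x)%:C) =
      - cintegral setT (fun x => g x * (phi x)%:C)].

(* A representative of the weak derivative, which is unique almost
   everywhere; the value is 0 if there is none. *)
Definition weak_derivative f : R -> R[i] :=
  xget (fun=> 0) [set g : R -> R[i] | is_weak_derivative f g].

End complex_calculus.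

Notation "'\intC_' ( x 'in' D ) F" := (cintegral D (fun x => F))
  (at level 36, F at level 36, x, D at level 50) : ring_scope.

(* Elements of L^2(nu) are represented by functions; equality in L^2(nu) is
   equality nu-almost everywhere. *)
Section hilbert_space.
Context {R : realType}.
Variable nu : {measure set (measurableTypeR R) -> \bar R}.
Implicit Types (f g h : R -> R[i]) (gamma : R[i]).

Definition L2norm f : \bar R := 'N[nu]_(2%:E)[EFin \o (@Normc.normc R \o f)]%E.

Definition L2 : set (R -> R[i]) :=
  [set f : R -> R[i] | [/\ measurable_fun setT (@complex.Re R \o f),
               measurable_fun setT (@complex.Im R \o f) & (L2norm f < +oo)%E]].

Definition W12 : set (R -> R[i]) :=
  [set f : R -> R[i] | L2 f /\ exists2 g, is_weak_derivative f g & L2 g].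

(* An unbounded operator on L^2(nu) is given by its domain D and its values
   T f for f in D. *)
Variables (D : set (R -> R[i])) (T : (R -> R[i]) -> (R -> R[i])).

Definition spectral_shift gamma f : R -> R[i] := fun x => gamma * f x - T f x.

Definition shift_injective gamma :=
  forall f g, D f -> D g ->
    spectral_shift gamma f = spectral_shift gamma g %[ae nu] -> f = g %[ae nu].

Definition shift_surjective gamma :=
  forall h, L2 h -> exists2 f, D f & spectral_shift gamma f = h %[ae nu].

Definition shift_inverse_bounded gamma :=
  exists C : R, forall f h, D f -> L2 h -> spectral_shift gamma f = h %[ae nu] ->
    (L2norm f <= C%:E * L2norm h)%E.

Definition resolvent_set : set R[i] :=
  [set gamma : R[i] | [/\ shift_injective gamma, shift_surjective gamma &
                   shift_inverse_bounded gamma]].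

Definition spectrum : set R[i] := ~` resolvent_set.

Definition point_spectrum : set R[i] := [set gamma : R[i] | ~ shift_injective gamma].

Definition eigenfunctions gamma : set (R -> R[i]) :=
  [set f : R -> R[i] | D f /\ T f = (fun x => gamma * f x) %[ae nu]].

End hilbert_space.

(* The sign +/- is encoded by s : bool, as (-1) ^+ s (false is +). *)
Section zigzag.
Context {R : realType}.
Variables (U lrefr : R -> R) (s : bool).
Implicit Types (f h : R -> R[i]) (gamma : R[i]).

Local Notation U' := (derive1 U).

Definition switching_rate (x : R) : R := Num.max (U' x) 0 + lrefr x.

Definition Lop f : R -> R[i] := fun x =>
  weak_derivative f x + (switching_rate x)%:C * ((-1) ^+ s * f (- x) - f x).

Definition Zfun gamma : R[i] :=
  1 - (-1) ^+ s *
    \intC_(eta in `[0, +oo[)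
      ((U' eta)%:C * cexp (- 2 * gamma * eta%:C - (U eta)%:C)).

Definition Sigma : set R[i] := [set gamma : R[i] | Zfun gamma = 0].

Definition mfun_gamma gamma h : R[i] :=
  \intC_(xi in `[0, +oo[)
    (cexp (- gamma * xi%:C - (U xi)%:C) *
     (h xi + (-1) ^+ s * (U' xi)%:C * cexp (- gamma * xi%:C) *
       \intC_(eta in `[0, xi]) (cexp (gamma * eta%:C) * h (- eta)))).

Definition resolvent_formula gamma h (x : R) : R[i] :=
  if x <= 0 then
    cexp (gamma * x%:C) *
    (mfun_gamma gamma h / Zfun gamma +
     \intC_(xi in `[x, 0]) (cexp (- gamma * xi%:C) * h xi))
  else
    cexp (gamma * x%:C + (U x)%:C) *
    \intC_(xi in `[x, +oo[)
      (cexp (- gamma * xi%:C - (U xi)%:C) *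
       (h xi + (-1) ^+ s * (U' xi)%:C * cexp (- gamma * xi%:C) *
         (mfun_gamma gamma h / Zfun gamma +
          \intC_(eta in `[- xi, 0]) (cexp (- gamma * eta%:C) * h eta)))).

(* The two cases overlap at x = 0, so this is a predicate. *)
Definition is_eigenfunction_formula gamma f :=
  (forall x : R, x <= 0 -> f x = cexp (gamma * x%:C)) /\
  (forall x : R, 0 <= x ->
    f x = (-1) ^+ s * cexp (gamma * x%:C + (U x)%:C) *
      \intC_(xi in `[x, +oo[)
        ((U' xi)%:C * cexp (- 2 * gamma * xi%:C - (U xi)%:C))).

End zigzag.

Definition C2 {R : realType} (U : R -> R) :=
  [/\ forall x : R, derivable U x 1, forall x : R, derivable (derive1 U) x 1 &
      continuous (derive1 (derive1 U))].

(* nu(dx) = e^{-U(x)} dx; such a measure exists as soon as U is measurable,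
   see [gibbs_measure_exists]. *)
Definition is_gibbs_measure {R : realType} (U : R -> R)
    (nu : {measure set (measurableTypeR R) -> \bar R}) :=
  forall B, measurable B ->
    nu B = (\int[lebesgue_measure]_(x in B) (expR (- U x))%:E)%E.

Section gibbs_measure_exists.
Context {R : realType} (U : R -> R) (mU : measurable_fun setT U).

Definition gibbs of measurable_fun setT U : set (measurableTypeR R) -> \bar R :=
  fun B => (\int[lebesgue_measure]_(x in B) (expR (- U x))%:E)%E.

Let gibbs0 : gibbs mU set0 = 0%E.
Proof. exact: integral_set0. Qed.

Let gibbs_ge0 B : (0 <= gibbs mU B)%E.
Proof. by apply: integral_ge0 => x _; rewrite lee_fin expR_ge0. Qed.

Let gibbs_sigma_additive : semi_sigma_additive (gibbs mU).
Proof.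
move=> /= F mF tF mUF; rewrite /gibbs ge0_integral_bigcup//=.
- by apply: is_cvg_ereal_nneg_natsum_cond => n _ _; exact: gibbs_ge0.
- apply/measurable_EFinP; apply: measurableT_comp => //.
  by apply: measurableT_comp => //; exact: measurable_funTS.
Qed.

HB.instance Definition _ := isMeasure.Build _ _ _
  (gibbs mU) gibbs0 gibbs_ge0 gibbs_sigma_additive.

Lemma gibbs_measure_exists :
  exists nu : {measure set (measurableTypeR R) -> \bar R},
    is_gibbs_measure U nu.
Proof. by exists (gibbs mU). Qed.

End gibbs_measure_exists.

(* Main.v *)
(* Functions in W^{1,2} are the locally absolutely continuous ones (du
   Bois-Reymond), so (gamma - L) f = h is an ordinary differential equation:
   f' = gamma f - h on x < 0, solved from c = f 0, and, with f(-x) then known,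
   f' = (gamma + U') f - h -/+ U' f(-x) on x > 0. Multiplying by
   e^{-gamma x - U} and integrating from x to infinity gives the only solution
   in L^2(nu) on the right, and continuity at 0 becomes the scalar equation
   Z(gamma) c = m_gamma(h). If Z(gamma) <> 0 this determines f; if
   Z(gamma) = 0 the choice h = 0, c = 1 gives an eigenfunction.
   Existence and bounds: on x > 0 the difference r = f -/+ f(-x) solves
   r' = (gamma + U') r - K where K = h +/- h(-x) -/+ 2 gamma f(-x) no longer
   contains the unbounded factor U'. Since U' tends to infinity, both
   half-line solution operators, and U' times the right-hand one, are bounded
   on L^2(nu) by Schur's test. *)

Require Import Defs.
From HB Require Import structures.
From mathcomp Require Import all_boot all_order all_algebra.
From mathcomp Require Import all_classical all_reals all_analysis.
From mathcomp Require Import measurable_realfun complex.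
From mathcomp Require Import ring lra.

Set Implicit Arguments.
Unset Strict Implicit.
Unset Printing Implicit Defensive.
Import Order.TTheory GRing.Theory Num.Theory.
Import numFieldNormedType.Exports.

Local Open Scope ring_scope.
Local Open Scope classical_set_scope.
Local Open Scope complex_scope.

(** Multiplication by e^{-U/2} maps L^2(nu) isometrically onto L^2(dx). It gives both half-line
    kernels, the left one after reflection, moduli governed by one weight W = U/2 + Re gamma x: e^{W
    t - W x} for t <= x and e^{W x - W t} for t >= x. Schur's test then asks that the integrals of
    e^W from 0 to y and of e^{-W} from y to infinity be O(e^{W y}) and O(e^{-W y}). This follows
    from W' -> +oo; a decrease of W near 0 costs only a constant. For U' times the right-hand
    operator, U' must also be almost increasing, and there U'' >= a enters. Existence and uniqueness
    use different forms of the equation. Existence uses K, because f' has to be shown to lie in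
    L^2(nu). Uniqueness keeps U' inside the integrals, as in the stated formulas, and asks only for
    integrability against e^{-gamma x - U}, which Tonelli's theorem provides. The two forms meet in
    one integration by parts, which trades U' e^{-2 gamma x - U} for a boundary term and 2 gamma
    e^{-2 gamma x - U}. The resolvent bound is proved for the constructed solution and passes to
    every solution by uniqueness. *)

Section real_integrability.
Context {R : realType}.
Local Notation mu := (@lebesgue_measure R).
Implicit Types (f g k : R -> R) (D : set (measurableTypeR R)) (a b : R).

Lemma measurable_integrable_EFin D f :
  mu.-integrable D (EFin \o f) -> measurable_fun D f.
Proof. by move=> /measurable_int/measurable_EFinP. Qed.

Lemma integrable_EFinD D f g : measurable D ->
  mu.-integrable D (EFin \o f) -> mu.-integrable D (EFin \o g) ->
  mu.-integrable D (EFin \o (fun x => f x + g x)).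
Proof. by move=> mD If Ig; exact: (integrableD mD If Ig). Qed.

Lemma integrable_EFinB D f g : measurable D ->
  mu.-integrable D (EFin \o f) -> mu.-integrable D (EFin \o g) ->
  mu.-integrable D (EFin \o (fun x => f x - g x)).
Proof. by move=> mD If Ig; exact: (integrableB mD If Ig). Qed.

Lemma integrable_EFinZ D c f : measurable D ->
  mu.-integrable D (EFin \o f) -> mu.-integrable D (EFin \o (fun x => c * f x)).
Proof. by move=> mD If; exact: (integrableZl mD c If). Qed.

Lemma le_integrable_EFin D f g : measurable D -> measurable_fun D f ->
  (forall x, D x -> `|f x| <= g x) ->
  mu.-integrable D (EFin \o g) -> mu.-integrable D (EFin \o f).
Proof.
move=> mD mf fg; apply: le_integrable => //; first exact/measurable_EFinP.
by move=> x Dx; rewrite lee_fin (le_trans (fg x Dx))// ler_norm.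
Qed.

Lemma integrable_continuous_itv f a b : continuous f ->
  mu.-integrable `[a, b] (EFin \o f).
Proof.
move=> cf; apply: continuous_compact_integrable; first exact: segment_compact.
exact: continuous_subspaceT.
Qed.

Lemma locally_integrable_itv g a b : locally_integrable setT g ->
  mu.-integrable `[a, b] (EFin \o g).
Proof.
move=> [mg _ ig]; apply/integrableP; split.
  by apply/measurable_EFinP; exact: measurable_funTS.
by apply: ig => //; exact: segment_compact.
Qed.

Lemma compact_subset_itv (K : set R) : compact K ->
  exists2 M, 0 <= M & K `<=` `[- M, M].
Proof.
move=> /compact_bounded[M [Mr KM]]; exists (`|M| + 1); first by rewrite addr_ge0.
move=> x Kx; have := KM (`|M| + 1).
rewrite (le_lt_trans (real_ler_norm Mr)) ?ltrDl// => /(_ isT x Kx).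
by rewrite /= in_itv/= ler_norml.
Qed.

Lemma locally_integrableP g : measurable_fun setT g ->
  (forall M, 0 <= M -> mu.-integrable `[- M, M] (EFin \o g)) ->
  locally_integrable setT g.
Proof.
move=> mg ig; split; [by []|exact: openT|move=> K _ cK].
have [M M0 KM] := compact_subset_itv cK.
suff : mu.-integrable K (EFin \o g) by case/integrableP.
by apply: integrableS (ig M M0) => //; exact: compact_measurable.
Qed.

Lemma continuous_locally_integrable g : continuous g ->
  locally_integrable setT g.
Proof.
move=> cg; apply: locally_integrableP => [|M _].
  exact: continuous_measurable_fun.
exact: integrable_continuous_itv.
Qed.

Lemma continuous_bounded_itv k a b : continuous k ->
  exists2 M, 0 <= M & forall x, a <= x <= b -> `|k x| <= M.
Proof.
move=> ck; have ckab : compact (k @` `[a, b]).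
  by apply: continuous_compact; [exact: continuous_subspaceT|exact: segment_compact].
have [M M0 kM] := compact_subset_itv ckab; exists M => // x xab.
have : (k @` `[a, b]) (k x) by exists x; rewrite /= ?in_itv.
by move=> /kM; rewrite /= in_itv/= ler_norml.
Qed.

Lemma integrable_continuousM k f a b : continuous k ->
  mu.-integrable `[a, b] (EFin \o f) ->
  mu.-integrable `[a, b] (EFin \o (fun x => k x * f x)).
Proof.
move=> ck If; have [M M0 kM] := continuous_bounded_itv a b ck.
apply: (@integrableMr _ _ _ mu _ _ k (EFin \o f)) => //.
  by apply: measurable_funTS; exact: continuous_measurable_fun.
exists M; split; [exact: num_real|move=> y My x /=; rewrite in_itv/= => xab].
by rewrite (le_trans (kM x _)) ?(ltW My).
Qed.

Lemma locally_integrableM k f : continuous k -> locally_integrable setT f ->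
  locally_integrable setT (fun x => k x * f x).
Proof.
move=> ck lf; apply: locally_integrableP => [|M _].
  apply: measurable_funM; first exact: continuous_measurable_fun.
  by case: lf.
by apply: integrable_continuousM => //; exact: locally_integrable_itv.
Qed.

Lemma Rintegral_itv_split f a b c : a <= b -> b <= c ->
  mu.-integrable `[a, c] (EFin \o f) ->
  \int[mu]_(x in `[a, c]) f x =
  \int[mu]_(x in `[a, b]) f x + \int[mu]_(x in `[b, c]) f x.
Proof.
move=> ab bc If; have := @Rintegral_itvB _ f (BLeft a) (BRight c) b If.
rewrite !bnd_simp => /(_ ab bc); rewrite Rintegral_itv_obnd_cbnd.
  by move=> <-; rewrite addrC subrK.
apply: integrableS If => //; apply: subset_itvr; rewrite bnd_simp//.
Qed.

Lemma ae_eq_Rintegral D f g : measurable D -> measurable_fun D f ->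
  measurable_fun D g -> {ae mu, forall x, D x -> f x = g x} ->
  \int[mu]_(x in D) f x = \int[mu]_(x in D) g x.
Proof.
move=> mD mf mg fg; rewrite /Rintegral; congr fine.
apply: ae_eq_integral => //; [exact/measurable_EFinP|exact/measurable_EFinP|].
by apply: filterS fg => x /= h Dx; rewrite h.
Qed.

Lemma ae_imp (P Q : R -> Prop) : (forall x, P x -> Q x) ->
  {ae mu, forall x, P x} -> {ae mu, forall x, Q x}.
Proof. by move=> PQ; apply: filterS; first exact: (ae_filter_ringOfSetsType mu). Qed.

Lemma ae_imp2 (P Q S : R -> Prop) : (forall x, P x -> Q x -> S x) ->
  {ae mu, forall x, P x} -> {ae mu, forall x, Q x} -> {ae mu, forall x, S x}.
Proof. by move=> PQ; apply: filterS2; first exact: (ae_filter_ringOfSetsType mu). Qed.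

End real_integrability.

(** * Iterated integrals over triangles *)

Section triangle_fubini.
Context {R : realType}.
Local Notation mu := (@lebesgue_measure R).
Implicit Types (f g u v : R -> R) (a b : R).

Let T2 := (measurableTypeR R * measurableTypeR R)%type.

Lemma measurable_triangle (F : T2 -> \bar R) (f g : T2 -> R) :
  measurable_fun setT F -> measurable_fun setT f -> measurable_fun setT g ->
  measurable_fun setT (fun z => if f z <= g z then F z else 0%E).
Proof.
move=> mF mf mg; apply: measurable_fun_ifT => //.
exact: measurable_fun_ler.
Qed.

Lemma ge0_integralZ_EFin (D : set (measurableTypeR R)) c g : measurable D ->
  measurable_fun D g -> (forall x, D x -> 0 <= g x) -> 0 <= c ->
  (c%:E * \int[mu]_(x in D) (g x)%:E = \int[mu]_(x in D) (c * g x)%:E)%E.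
Proof.
move=> mD mg g0 c0; under [RHS]eq_integral do rewrite EFinM.
by rewrite ge0_integralZl//; exact/measurable_EFinP.
Qed.

Lemma ge0_le_integral_EFin (D : set (measurableTypeR R)) f (g : R -> \bar R) :
  measurable D -> measurable_fun D f -> measurable_fun D g ->
  (forall x, D x -> 0 <= f x) -> (forall x, D x -> ((f x)%:E <= g x)%E) ->
  (\int[mu]_(x in D) (f x)%:E <= \int[mu]_(x in D) g x)%E.
Proof.
move=> mD mf mg f0 fg; apply: ge0_le_integral => //.
exact/measurable_EFinP.
Qed.

(** The primitive is a marginal of the integrand cut off to a triangle, a nonnegative function of
    two variables, so Tonelli's theorem gives its measurability even where it is infinite. *)
Lemma measurable_integral_le f : measurable_fun setT f -> (forall x, 0 <= f x) ->
  measurable_fun (setT : set (measurableTypeR R))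
    (fun x => (\int[mu]_(t in `[0%R, x]) (f t)%:E)%E).
Proof.
move=> mf f0.
have mfst : measurable_fun setT (fst : T2 -> R) by exact: measurable_fst.
have msnd : measurable_fun setT (snd : T2 -> R) by exact: measurable_snd.
pose F (z : T2) := if 0 <= z.2 then if z.2 <= z.1 then (f z.2)%:E else 0%E else 0%E.
have mF : measurable_fun setT F.
  do 2 (apply: measurable_triangle => //).
  by apply/measurable_EFinP; exact: (measurableT_comp mf msnd).
have F0 z : (0 <= F z)%E.
  by rewrite /F; case: ifP => // _; case: ifP => // _; rewrite lee_fin.
have := @measurable_fun_fubini_tonelli_F _ _ _ _ _ mu F mF F0.
congr measurable_fun; apply/funext => x; rewrite [RHS]integral_mkcond.
apply: eq_integral => t _; rewrite patchE /F/=; have [t0|t0] := leP 0 t; last first.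
  by rewrite memNset//= in_itv/= [0 <= t]leNgt t0.
have [tx|tx] := leP t x; first by rewrite mem_set//= in_itv/= t0.
by rewrite memNset//= in_itv/= t0/= leNgt tx.
Qed.

Lemma measurable_integral_ge f : measurable_fun setT f -> (forall x, 0 <= f x) ->
  measurable_fun (setT : set (measurableTypeR R))
    (fun x => (\int[mu]_(t in `[x, +oo[) (f t)%:E)%E).
Proof.
move=> mf f0.
have mfst : measurable_fun setT (fst : T2 -> R) by exact: measurable_fst.
have msnd : measurable_fun setT (snd : T2 -> R) by exact: measurable_snd.
pose F (z : T2) := if z.1 <= z.2 then (f z.2)%:E else 0%E.
have mF : measurable_fun setT F.
  apply: measurable_triangle => //.
  by apply/measurable_EFinP; exact: (measurableT_comp mf msnd).
have F0 z : (0 <= F z)%E by rewrite /F; case: ifP => // _; rewrite lee_fin.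
have := @measurable_fun_fubini_tonelli_F _ _ _ _ _ mu F mF F0.
congr measurable_fun; apply/funext => x; rewrite [RHS]integral_mkcond.
apply: eq_integral => t _; rewrite patchE /F/=.
have [xt|xt] := leP x t; first by rewrite mem_set//= in_itv/= xt.
by rewrite memNset//= in_itv/= andbT leNgt xt.
Qed.

(** Both sides integrate [f x * g t] over the region 0 <= x <= t. The values stay in the extended
    reals because Schur's test applies this before anything is known to be finite. *)
Lemma tonelli_triangle f g : measurable_fun setT f -> measurable_fun setT g ->
  (forall x, 0 <= f x) -> (forall x, 0 <= g x) ->
  (\int[mu]_(x in `[0%R, +oo[) ((f x)%:E * \int[mu]_(t in `[x, +oo[) (g t)%:E) =
   \int[mu]_(t in `[0%R, +oo[) ((g t)%:E * \int[mu]_(x in `[0%R, t]) (f x)%:E))%E.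
Proof.
move=> mf mg f0 g0.
pose F (z : T2) := if 0 <= z.1 then if z.1 <= z.2 then (f z.1 * g z.2)%:E else 0%E else 0%E.
have mfst : measurable_fun setT (fst : T2 -> R) by exact: measurable_fst.
have msnd : measurable_fun setT (snd : T2 -> R) by exact: measurable_snd.
have mF : measurable_fun setT F.
  do 2 (apply: measurable_triangle => //).
  apply/measurable_EFinP; apply: measurable_funM.
    exact: (measurableT_comp mf mfst).
  exact: (measurableT_comp mg msnd).
have F0 z : (0 <= F z)%E.
  rewrite /F; case: ifP => // _; case: ifP => // _.
  by rewrite lee_fin mulr_ge0.
have := @fubini_tonelli _ _ _ _ _ mu mu F mF F0.
congr (_ = _).
- rewrite [RHS]integral_mkcond; apply: eq_integral => x _ /=.
  rewrite patchE; case: ifPn; rewrite ?in_itv/= ?andbT; last first.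
    rewrite notin_setE/= in_itv/= andbT => /negP x0.
    by rewrite /F/= (negbTE x0) integral0.
  rewrite inE/= in_itv/= andbT => x0.
  rewrite ge0_integralZ_EFin//; last exact: measurable_funTS.
  rewrite [RHS]integral_mkcond; apply: eq_integral => t _ /=.
  rewrite /F/= x0 patchE; have [xt|xt] := leP x t.
    by rewrite mem_set/= ?in_itv/= ?xt.
  by rewrite memNset/= ?in_itv/= ?andbT ?leNgt ?xt.
- rewrite [RHS]integral_mkcond; apply: eq_integral => t _ /=.
  rewrite patchE; case: ifPn; rewrite ?in_itv/= ?andbT; last first.
    rewrite notin_setE/= in_itv/= andbT => /negP t0.
    rewrite integral0_eq// => x _; rewrite /F/=; case: ifP => // x0.
    by case: ifP => // xt; move: t0; rewrite (le_trans x0 xt).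
  rewrite inE/= in_itv/= andbT => t0.
  rewrite ge0_integralZ_EFin//; last exact: measurable_funTS.
  rewrite [RHS]integral_mkcond; apply: eq_integral => x _ /=.
  rewrite /F/= patchE; have [x0|x0] := leP 0 x; last first.
    by rewrite memNset/= ?in_itv/= ?leNgt ?x0.
  have [xt|xt] := leP x t.
    by rewrite mem_set/= ?in_itv/= ?xt ?x0// mulrC.
  by rewrite memNset/= ?in_itv/= ?x0/= ?leNgt ?xt.
Qed.

(** Cutting [u] and [v] off outside [a, b] lets Fubini's theorem run over the whole plane; this
    lemma and the next recover the inner integrals over the triangle. *)
Lemma restrict_triangle1 u v a b x : a <= x <= b ->
  mu.-integrable `[a, b] (EFin \o v) ->
  (\int[mu]_y (if (y <= x)%R then ((u \_ `[a, b]) x * (v \_ `[a, b]) y)%:E else 0) =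
  (u x * \int[mu]_(t in `[a, x]) v t)%:E)%E.
Proof.
move=> axb Iv; have /andP[ax xb] := axb.
have Ivx : mu.-integrable `[a, x] (EFin \o v).
  by apply: integrableS Iv => //; apply: subset_itvl; rewrite bnd_simp.
rewrite EFinM /Rintegral fineK; last exact: integrable_fin_num.
rewrite -integralZl// [RHS]integral_mkcond; apply: eq_integral => y _.
have xin : x \in `[a, b]%classic by rewrite inE/= in_itv.
rewrite patchE !patchE xin; have [yx|yx] := leP y x; last first.
  by rewrite memNset//= in_itv/= [y <= x]leNgt yx andbF.
have [ay|ay] := leP a y.
  by rewrite !mem_set//= in_itv/= ay ?yx// (le_trans yx).
by rewrite !memNset/= ?in_itv/= ?[a <= y]leNgt ?ay// mulr0.
Qed.

Lemma restrict_triangle2 u v a b y : a <= y <= b ->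
  mu.-integrable `[a, b] (EFin \o u) ->
  (\int[mu]_x (if (y <= x)%R then ((u \_ `[a, b]) x * (v \_ `[a, b]) y)%:E else 0) =
  (v y * \int[mu]_(t in `[y, b]) u t)%:E)%E.
Proof.
move=> ayb Iu; have /andP[ay yb] := ayb.
have Iuy : mu.-integrable `[y, b] (EFin \o u).
  by apply: integrableS Iu => //; apply: subset_itvr; rewrite bnd_simp.
rewrite EFinM /Rintegral fineK; last exact: integrable_fin_num.
rewrite -integralZl// [RHS]integral_mkcond; apply: eq_integral => x _.
have yin : y \in `[a, b]%classic by rewrite inE/= in_itv.
rewrite patchE !patchE yin; have [yx|yx] := leP y x; last first.
  by rewrite memNset//= in_itv/= [y <= x]leNgt yx.
have [xb|xb] := leP x b.
  by rewrite !mem_set//= ?in_itv/= ?xb ?yx ?(le_trans ay)// mulrC.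
by rewrite !memNset/= ?in_itv/= ?[x <= b]leNgt ?xb ?andbF// mul0r.
Qed.

(** The signed version, made for the product rule [acM], where the two factors produce the same
    double integral. *)
Lemma fubini_triangle u v a b :
  mu.-integrable `[a, b] (EFin \o u) -> mu.-integrable `[a, b] (EFin \o v) ->
  \int[mu]_(x in `[a, b]) (u x * \int[mu]_(t in `[a, x]) v t) =
  \int[mu]_(t in `[a, b]) (v t * \int[mu]_(x in `[t, b]) u x).
Proof.
move=> Iu Iv.
pose u' := u \_ `[a, b]; pose v' := v \_ `[a, b].
have Iu' : mu.-integrable setT (EFin \o u').
  by rewrite /u' -restrict_EFin -integrable_mkcond.
have Iv' : mu.-integrable setT (EFin \o v').
  by rewrite /v' -restrict_EFin -integrable_mkcond.
have mu' : measurable_fun (setT : set (measurableTypeR R)) u' by apply: measurable_integrable_EFin Iu'.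
have mv' : measurable_fun (setT : set (measurableTypeR R)) v' by apply: measurable_integrable_EFin Iv'.
have mfst : measurable_fun setT (fst : T2 -> R) by exact: measurable_fst.
have msnd : measurable_fun setT (snd : T2 -> R) by exact: measurable_snd.
pose F (z : T2) := if z.2 <= z.1 then (u' z.1 * v' z.2)%:E else 0%E.
have mF : measurable_fun setT F.
  apply: measurable_triangle => //.
  apply/measurable_EFinP; apply: measurable_funM.
    exact: (measurableT_comp mu' mfst).
  exact: (measurableT_comp mv' msnd).
(* |F| is at most |u' x| |v' y|, whose double integral is a product of two finite integrals. *)
have IF : (mu \x mu)%E.-integrable setT F.
  apply/integrable12ltyP => //.
  have mnu : measurable_fun (setT : set (measurableTypeR R)) (fun x => `|u' x|).
    exact: measurableT_comp.
  have mnv : measurable_fun (setT : set (measurableTypeR R)) (fun x => `|v' x|).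
    exact: measurableT_comp.
  have mnuv : measurable_fun (setT : set (measurableTypeR R))
      (fun x => `|u' x|%:E * \int[mu]_y (`|v' y|%:E))%E.
    by apply: emeasurable_funM => //; exact/measurable_EFinP.
  have /integrableP[_ Iu'oo] := Iu'.
  have /integrableP[_ Iv'oo] := Iv'.
  apply: (@le_lt_trans _ _ (\int[mu]_x (`|u' x|%:E * \int[mu]_y (`|v' y|%:E)))%E).
    apply: ge0_le_integral => //.
    - by move=> x _; apply: integral_ge0.
    - apply: (measurable_fun_fubini_tonelli_F (abse \o F)).
        exact: measurableT_comp.
      by move=> z; exact: abse_ge0.
    move=> x _; rewrite -ge0_integralZl//; last exact/measurable_EFinP.
    apply: ge0_le_integral => //.
    - apply: measurableT_comp => //.
      exact: (measurableT_comp mF (measurable_pair1 _)).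
    - by apply: emeasurable_funM => //; exact/measurable_EFinP.
    move=> y _; rewrite /F/=; case: ifP => _; last by rewrite abse0.
    by rewrite lee_fin normrM.
  rewrite ge0_integralZr//; last 2 first.
  - exact/measurable_EFinP.
  - exact: integral_ge0.
  by rewrite lte_mul_pinfty// ?ge0_fin_numE//; exact: integral_ge0.
have := @Fubini _ _ _ _ _ mu mu F IF.
clear -Iu Iv; rewrite /Rintegral => H; congr fine.
rewrite [LHS]integral_mkcond [RHS]integral_mkcond; move: H; congr (_ = _); apply: eq_integral => x _.
- rewrite patchE; case: ifPn => [|xab].
    by rewrite inE/= in_itv/= => xab; exact: restrict_triangle1.
  by rewrite integral0_eq// => y _; rewrite /F/u'/= patchE (negbTE xab) mul0r if_same.
- rewrite patchE; case: ifPn => [|xab].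
    by rewrite inE/= in_itv/= => xab; exact: restrict_triangle2.
  by rewrite integral0_eq// => y _; rewrite /F/v'/= [X in _ * X]patchE (negbTE xab) mulr0 if_same.
Qed.

End triangle_fubini.

(** * Locally absolutely continuous functions *)

Section absolutely_continuous.
Context {R : realType}.
Local Notation mu := (@lebesgue_measure R).
Implicit Types (f g : R -> R) (a b : R).

(** Local absolute continuity, with the derivative as a second argument that matters only almost
    everywhere. Sums, products, reflection and gluing become statements about integrals over compact
    intervals. *)
Definition ac f g := locally_integrable setT g /\
  forall a b, a <= b -> f b - f a = \int[mu]_(x in `[a, b]) g x.

Lemma ac_itv f g a b : ac f g -> mu.-integrable `[a, b] (EFin \o g).
Proof. by move=> [lg _]; exact: locally_integrable_itv. Qed.

Lemma acE f g a x : ac f g -> a <= x -> f x = f a + \int[mu]_(t in `[a, x]) g t.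
Proof. by move=> [_ fg] ax; rewrite -fg// addrC subrK. Qed.

Lemma ac_continuous f g : ac f g -> continuous f.
Proof.
move=> fg x.
have x1x1 : x - 1 < x + 1 by rewrite ltrD2l; lra.
have := @parameterized_integral_continuous R (x - 1) (x + 1) g (ltW x1x1) (ac_itv _ _ fg).
move=> /(continuous_within_itvP _ x1x1)[+ _ _] => /(_ x).
have xx : x \in `]x - 1, x + 1[%R by rewrite in_itv/=; apply/andP; split; lra.
move=> /(_ xx) cx.
have : {for x, continuous (fun y => f (x - 1) + parameterized_integral mu (x - 1) y g)}.
  by apply: continuousD cx; exact: cst_continuous.
have near_f : \forall y \near x, f (x - 1) + parameterized_integral mu (x - 1) y g = f y.
  near=> y; rewrite -(acE fg)//; near: y.
  by apply: filterS (lt_nbhsr (_ : x - 1 < x)) => [z /ltW//|]; lra.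
have fx : f (x - 1) + parameterized_integral mu (x - 1) x g = f x.
  by rewrite -(acE fg)//; lra.
move=> H; rewrite /continuous_at -fx; apply: cvg_trans H.
exact: near_eq_cvg.
Unshelve. all: by end_near. Qed.

Lemma ac_C1 f g : (forall x : R, is_derive x (1 : R) f (g x)) -> continuous g -> ac f g.
Proof.
move=> df cg; split; first exact: continuous_locally_integrable.
move=> a b; rewrite le_eqVlt => /predU1P[<-|ab].
  by rewrite subrr set_itv1 Rintegral_set1.
have dfx x : derivable f x 1 by have [] := df x.
have cf x : {for x, continuous f} by apply/differentiable_continuous/derivable1_diffP.
rewrite /Rintegral (continuous_FTC2 ab (F := f))//.
- exact: continuous_subspaceT.
- split; first by [].
  + by apply: cvg_at_right_filter; exact: cf.
  + by apply: cvg_at_left_filter; exact: cf.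
- by move=> x _; rewrite derive1E; have [] := df x.
Qed.

Lemma acD f1 g1 f2 g2 : ac f1 g1 -> ac f2 g2 ->
  ac (fun x => f1 x + f2 x) (fun x => g1 x + g2 x).
Proof.
move=> h1 h2; split; first by case: h1 h2 => + _ [+ _]; exact: locally_integrableD.
move=> a b ab; rewrite RintegralD//; [|exact: ac_itv h1|exact: ac_itv h2].
by case: h1 h2 => _ <-// [_ <-//]; ring.
Qed.

Lemma acN f g : ac f g -> ac (fun x => - f x) (fun x => - g x).
Proof.
move=> h; split; first by case: h => + _; exact: locally_integrableN.
move=> a b ab; under eq_Rintegral do rewrite -mulN1r.
rewrite RintegralZl//; last exact: ac_itv h.
by case: h => _ <-//; ring.
Qed.

Lemma acB f1 g1 f2 g2 : ac f1 g1 -> ac f2 g2 ->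
  ac (fun x => f1 x - f2 x) (fun x => g1 x - g2 x).
Proof. by move=> h1 h2; apply: acD h1 (acN h2). Qed.

Lemma ac_cst c : ac (fun=> c) (fun=> 0).
Proof.
by apply: ac_C1 => x; exact: cst_continuous.
Qed.

(** In each term of the derivative the undifferentiated factor is replaced by its integral, counted
    from [b] in one term and from [a] in the other. The two double integrals over the triangle then
    agree by [fubini_triangle] and cancel. *)
Lemma acM f1 g1 f2 g2 : ac f1 g1 -> ac f2 g2 ->
  ac (fun x => f1 x * f2 x) (fun x => f1 x * g2 x + f2 x * g1 x).
Proof.
move=> h1 h2.
have c1 := ac_continuous h1; have c2 := ac_continuous h2.
have [l1 _] := h1; have [l2 _] := h2.
split.
  by apply: locally_integrableD; exact: locally_integrableM.
move=> a b ab.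
have I1 := ac_itv a b h1; have I2 := ac_itv a b h2.
rewrite RintegralD//; last 2 first.
- exact: integrable_continuousM.
- exact: integrable_continuousM.
have E1 : \int[mu]_(x in `[a, b]) (f1 x * g2 x) =
    f1 b * (f2 b - f2 a) - \int[mu]_(x in `[a, b]) (g2 x * \int[mu]_(t in `[x, b]) g1 t).
  case: h2 => _ ->//; rewrite -RintegralZl// -RintegralB//; last 2 first.
  - exact: integrable_EFinZ.
  - apply: (@eq_integrable _ _ _ mu _ _ (EFin \o (fun x => (f1 b - f1 x) * g2 x))) => //.
      move=> x; rewrite inE/= in_itv/= => /andP[_ xb].
      by case: h1 => _ ->//; rewrite mulrC.
    apply: integrable_continuousM => // x.
    by apply: continuousB; [exact: cst_continuous|exact: c1].
  apply: eq_Rintegral => x; rewrite inE/= in_itv/= => /andP[_ xb].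
  by case: h1 => _ <-//; ring.
have E2 : \int[mu]_(x in `[a, b]) (f2 x * g1 x) =
    f2 a * (f1 b - f1 a) + \int[mu]_(x in `[a, b]) (g1 x * \int[mu]_(t in `[a, x]) g2 t).
  case: (h1) => _ ->//; rewrite -RintegralZl// -RintegralD//; last 2 first.
  - exact: integrable_EFinZ.
  - apply: (@eq_integrable _ _ _ mu _ _ (EFin \o (fun x => (f2 x - f2 a) * g1 x))) => //.
      move=> x; rewrite inE/= in_itv/= => /andP[ax _].
      by case: h2 => _ ->//; rewrite mulrC.
    apply: integrable_continuousM => // x.
    by apply: continuousB; [exact: c2|exact: cst_continuous].
  apply: eq_Rintegral => x; rewrite inE/= in_itv/= => /andP[ax _].
  by case: h2 => _ <-//; ring.
by rewrite E1 E2 (fubini_triangle I1 I2); ring.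
Qed.

(** The oriented integral from 0 to x: for x other than 0, one of the two intervals is empty and
    contributes 0. *)
Definition prim g (x : R) :=
  \int[mu]_(t in `[0, x]) g t - \int[mu]_(t in `[x, 0]) g t.

Lemma ac_prim g : locally_integrable setT g -> ac (prim g) g.
Proof.
move=> lg; split => // a b ab; rewrite /prim.
have I x y : mu.-integrable `[x, y] (EFin \o g) by exact: locally_integrable_itv.
have neg x y : x < y -> \int[mu]_(t in `[y, x]) g t = 0.
  by move=> xy; rewrite set_itv_ge ?Rintegral_set0// bnd_simp -ltNge.
have zz : \int[mu]_(t in `[0, 0]) g t = 0 by rewrite set_itv1 Rintegral_set1.
have [a0|a0] := leP 0 a.
  have z0 x : 0 <= x -> \int[mu]_(t in `[x, 0]) g t = 0.
    by rewrite le_eqVlt => /predU1P[<-//|/neg].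
  rewrite !z0//; last exact: le_trans ab.
  by rewrite (@Rintegral_itv_split _ g 0 a b)//; ring.
have [b0|b0] := leP 0 b.
  rewrite (neg a 0)//.
  have -> : \int[mu]_(t in `[b, 0]) g t = 0 by move: b0; rewrite le_eqVlt => /predU1P[<-//|/neg].
  by rewrite (@Rintegral_itv_split _ g a 0 b)// ?(ltW a0)//; ring.
rewrite (neg a 0)// (neg b 0)// (@Rintegral_itv_split _ g a b 0)// ?(ltW b0)//; ring.
Qed.

Lemma prim0 g : prim g 0 = 0.
Proof. by rewrite /prim subrr. Qed.

Lemma ac_eq f g f1 g1 : ac f g -> f =1 f1 -> g =1 g1 -> ac f1 g1.
Proof. by move=> h /funext <- /funext <-. Qed.

(** The values must agree at 0, but the derivatives need not. This joins the solutions on the two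
    half-lines. *)
Lemma ac_glue f1 g1 f2 g2 : ac f1 g1 -> ac f2 g2 -> f1 0 = f2 0 ->
  ac (fun x => if x <= 0 then f1 x else f2 x)
     (fun x => if x <= 0 then g1 x else g2 x).
Proof.
move=> h1 h2 f0.
have lg : locally_integrable setT (fun x => if x <= 0 then g1 x else g2 x).
  apply: locally_integrableP.
    apply: measurable_fun_ifT; last 2 first.
    - by case: h1 => -[].
    - by case: h2 => -[].
    - exact: measurable_fun_ler.
  move=> M _; have I := integrable_EFinD (measurable_itv `[- M, M]%R)
    (integrable_norm (ac_itv (- M) M h1)) (integrable_norm (ac_itv (- M) M h2)).
  apply: le_integrable_EFin I => //.
    apply: measurable_funTS; apply: measurable_fun_ifT; last 2 first.
    - by case: h1 => -[].
    - by case: h2 => -[].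
    - exact: measurable_fun_ler.
  by move=> x _ /=; case: ifP => _; rewrite ?lerDl ?lerDr.
set g := (fun x => if x <= 0 then g1 x else g2 x) in lg *.
have I a b : mu.-integrable `[a, b] (EFin \o g) by exact: locally_integrable_itv.
have neg a b : a <= b -> b <= 0 -> \int[mu]_(x in `[a, b]) g x = f1 b - f1 a.
  move=> ab b0; have [_ ->//] := h1; apply: eq_Rintegral => x.
  by rewrite inE/= in_itv/= /g => /andP[_ xb]; rewrite (le_trans xb).
have pos a b : a <= b -> 0 <= a -> \int[mu]_(x in `[a, b]) g x = f2 b - f2 a.
  move=> ab a0; have [_ ->//] := h2.
  (* The left endpoint is dropped because at 0 the glued derivative takes the value [g1 0]. *)
  rewrite -!Rintegral_itv_obnd_cbnd; last 2 first.
  - apply: integrableS (ac_itv a b h2) => //; apply: subset_itvr; rewrite bnd_simp//.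
  - apply: integrableS (I a b) => //; apply: subset_itvr; rewrite bnd_simp//.
  apply: eq_Rintegral => x.
  by rewrite inE/= in_itv/= /g => /andP[ax _]; rewrite leNgt (le_lt_trans a0).
split => // a b ab.
have [b0|b0] := leP b 0; first by rewrite (le_trans ab)// neg.
have [a0|a0] := leP a 0; last by rewrite pos// ltW.
rewrite (@Rintegral_itv_split _ g a 0 b)// ?(ltW b0)// neg// pos// ?(ltW b0)//.
by rewrite -f0; ring.
Qed.

End absolutely_continuous.

(** * Test functions and the du Bois-Reymond lemma *)

Section smooth_bumps.
Context {R : realType}.
Implicit Types (p : {poly R}) (f g : R -> R).

Lemma is_derive_cvg f (x l : R) :
  h^-1 * (f (h + x) - f x) @[h --> 0^'] --> l -> is_derive x (1 : R) f l.
Proof.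
move=> fl.
have E : (fun h : R => h^-1 *: (f (h *: (1 : R) + x) - f x)) =
    (fun h => h^-1 * (f (h + x) - f x)).
  by apply/funext => h; rewrite [h *: _]mulr1.
apply: DeriveDef; first by rewrite /derivable E; apply/cvg_ex; exists l.
by rewrite /derive E; exact/cvg_lim.
Qed.

Lemma exprn_le_expR n (y : R) : 0 <= y -> y ^+ n <= n%:R ^+ n * expR y.
Proof.
case: n => [|n] y0; first by rewrite !expr0 mul1r (le_trans _ (expR_ge1Dx _))// lerDl.
have E : expR y = expR (y / n.+1%:R) ^+ n.+1.
  by rewrite -expRM_natl -mulrC divfK// pnatr_eq0.
rewrite E -exprMn lerXn2r ?nnegrE// ?mulr_ge0 ?expR_ge0//.
rewrite -ler_pdivrMl ?ltr0n// mulrC.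
by rewrite (le_trans _ (expR_ge1Dx _))// lerDr.
Qed.

(** The extra power [y ^+ m] makes the induction close: peeling off a factor X of the polynomial
    raises [m] by one. *)
Lemma horner_le_expR p m :
  exists C : R, forall y, 0 <= y -> `|p.[y]| * y ^+ m <= C * expR y.
Proof.
elim/poly_ind: p m => [|p c IH] m.
  by exists 0 => y _; rewrite horner0 normr0 !mul0r.
have [C hC] := IH m.+1; exists (C + `|c| * m%:R ^+ m) => y y0.
rewrite hornerMXaddC (le_trans (ler_wpM2r _ (ler_normD _ _)))// ?exprn_ge0//.
rewrite mulrDl mulrDl lerD// ?normrM ?(ger0_norm y0) -?mulrA -?exprS ?hC//.
by rewrite ler_wpM2l// exprn_le_expR.
Qed.

(* The derivatives of e^{-1/t} 1_{t > 0} all have this form. *)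
Definition flat p (t : R) := if 0 < t then p.[t^-1] * expR (- t^-1) else 0.

(** With y = 1 / t this says that |p(y)| y is O(e^y). The linear rate in t is what differentiability
    at 0 uses. *)
Lemma flat_bound p : exists2 C : R, 0 <= C & forall t, `|flat p t| <= C * `|t|.
Proof.
have [C hC] := horner_le_expR p 1; exists `|C| => // t; rewrite /flat.
case: ifPn => [t0|_]; last by rewrite normr0 mulr_ge0.
have y0 : 0 <= t^-1 by rewrite invr_ge0 ltW.
rewrite normrM (gtr0_norm t0) (gtr0_norm (expR_gt0 _)) expRN.
rewrite ler_pdivrMr ?expR_gt0// mulrAC -ler_pdivrMr//.
by rewrite (le_trans (hC _ y0))// ler_wpM2r ?expR_ge0// ler_norm.
Qed.

(** For t > 0 this is the chain rule: the derivative -1 / t^2 of 1 / t yields the factor X^2 and the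
    minus sign in front of p'. *)
Lemma is_derive_flat p t :
  is_derive t (1 : R) (flat p) (flat ((p - p^`()) * 'X^2) t).
Proof.
have [t0|t0|t0] := ltrgtP t 0.
- rewrite {2}/flat ltNge (ltW t0)/=.
  apply: (@near_eq_is_derive _ _ _ (cst 0)).
    by near=> y; rewrite /flat/= ltNge ltW//; near: y; exact: lt_nbhsl.
- rewrite {2}/flat t0.
  have tn0 : t != 0 by rewrite gt_eqF.
  apply: (@near_eq_is_derive R R^o R^o (fun t : R => p.[t^-1] * expR (- t^-1))).
    by near=> y; rewrite /flat/= ifT//; near: y; exact: lt_nbhsr.
  have dV : is_derive t (1 : R) (fun y => y^-1) (- t ^- 2 *: 1) by exact: is_deriveV.
  have d1 := @is_derive1_comp _ _ _ t _ _ (is_derive_poly p t^-1) dV.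
  have d2 := @is_derive1_comp _ _ _ t _ _ (is_derive_expR (- t^-1)) (is_deriveN dV).
  apply: is_derive_eq (is_deriveM d1 d2) _.
  by rewrite !hornerE /= /GRing.scale/=; field.
- rewrite t0; have -> : flat ((p - p^`()) * 'X^2) 0 = 0 by rewrite /flat ltxx.
  apply: is_derive_cvg.
  have [C C0 hC] := flat_bound (p * 'X).
  apply/cvgr0Pnorm_le => e e0; near=> h.
  have hn0 : h != 0 by near: h; exact: nbhs_dnbhs_neq.
  (* At 0 the difference quotient of [flat p] is again of the form [flat], with p multiplied by X,
     and [flat_bound] sends it to 0. *)
  have -> : h^-1 * (flat p (h + 0) - flat p 0) = flat (p * 'X) h.
    rewrite addr0 /flat ltxx subr0; case: ifP => _; last by rewrite mulr0.
    by rewrite hornerMX mulrA [h^-1 * _]mulrC.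
  rewrite (le_trans (hC h))//.
  rewrite (@le_trans _ _ ((C + 1) * `|h|))// ?ler_wpM2r ?lerDl//.
  rewrite -ler_pdivlMl ?ltr_wpDl// ltW//; near: h.
  apply: dnbhs0_lt; rewrite mulr_gt0// invr_gt0 ltr_wpDl//.
Unshelve. all: by end_near. Qed.

(** A class closed under differentiation that contains all the bumps below, so their smoothness
    requires no formula for higher derivatives of products. *)
Inductive flat_algebra : (R -> R) -> Prop :=
| flat_affine p c d : flat_algebra (fun x => flat p (c * x + d))
| flat_scale c f : flat_algebra f -> flat_algebra (fun x => c * f x)
| flat_add f g : flat_algebra f -> flat_algebra g ->
    flat_algebra (fun x => f x + g x)
| flat_mul f g : flat_algebra f -> flat_algebra g ->
    flat_algebra (fun x => f x * g x).

Lemma flat_algebra_derive f : flat_algebra f ->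
  exists2 g, flat_algebra g & forall x : R, is_derive x (1 : R) f (g x).
Proof.
elim => {f} [p c d|c f _ [f' af df]|f g _ [f' af df] _ [g' ag dg]|
    f g hf [f' af df] hg [g' ag dg]].
- exists (fun x => c * flat ((p - p^`()) * 'X^2) (c * x + d)).
    by apply: flat_scale; exact: flat_affine.
  move=> x; rewrite mulrC.
  apply: (@is_derive1_comp _ (flat p) (fun x => c * x + d)).
    exact: is_derive_flat.
  have := @is_deriveD _ _ _ _ _ x (1 : R) _ _ (@is_deriveZ _ _ _ id c x 1 _ (is_derive_id x 1))
    (is_derive_cst d x 1).
  by move=> H; apply: is_derive_eq H _; rewrite addr0 /GRing.scale/= mulr1.
- by exists (fun x => c * f' x) => [|x]; [exact: flat_scale|exact: is_deriveZ].
- by exists (fun x => f' x + g' x) => [|x]; [exact: flat_add|exact: is_deriveD].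
- exists (fun x => f x * g' x + g x * f' x) => [|x].
    by apply: flat_add; exact: flat_mul.
  exact: is_deriveM.
Qed.

Lemma derivable_flat_algebra f : flat_algebra f ->
  forall n (x : R), derivable (derive1n n f) x 1.
Proof.
move=> af n; suff an : flat_algebra (derive1n n f).
  by move=> x; have [g _ dg] := flat_algebra_derive an; have [] := dg x.
elim: n => // n an; rewrite derive1nS.
have [g ag dg] := flat_algebra_derive an.
suff -> : derive1 (derive1n n f) = g by [].
by apply/funext => x; rewrite derive1E; have [] := dg x.
Qed.

Lemma flat_algebra_continuous f : flat_algebra f -> continuous f.
Proof.
move=> /flat_algebra_derive[g _ dg] x.
by apply/differentiable_continuous/derivable1_diffP; have [] := dg x.
Qed.

End smooth_bumps.

Section test_functions.
Context {R : realType}.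
Local Notation mu := (@lebesgue_measure R).
Implicit Types (f g phi : R -> R).

Lemma test_function_is_derive phi : test_function phi ->
  forall x, is_derive x (1 : R) phi (derive1 phi x).
Proof.
by move=> [+ _] x => /(_ 0%N x) d; apply: DeriveDef => //; rewrite derive1E.
Qed.

Lemma test_function_continuous phi : test_function phi -> continuous phi.
Proof.
move=> [+ _] x => /(_ 0%N x) d.
by apply/differentiable_continuous/derivable1_diffP.
Qed.

Lemma test_function_derive_continuous phi : test_function phi ->
  continuous (derive1 phi).
Proof.
move=> [+ _] x => /(_ 1%N x) d.
by apply/differentiable_continuous/derivable1_diffP.
Qed.

Lemma test_function_support phi : test_function phi ->
  exists2 M, 0 <= M & forall x, M < `|x| -> phi x = 0 /\ derive1 phi x = 0.
Proof.
move=> [_ /compact_subset_itv[M M0 sM]]; exists M => //.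
have phi0 x : M < `|x| -> phi x = 0.
  move=> Mx; apply: contrapT => /eqP px.
  have := sM x (@subset_closure _ [set x | phi x != 0] x px).
  by rewrite /= in_itv/= -ler_norml leNgt Mx.
move=> x Mx; split; first exact: phi0.
rewrite derive1E (@near_eq_derive _ R^o R^o _ (cst 0)) ?derive_cst//.
near=> y; rewrite phi0//; near: y.
exact: (cvgr_gt _ (@norm_continuous _ R^o x)).
Unshelve. all: by end_near. Qed.

Lemma Rintegral_supportE (f : R -> R) M :
  (forall x, M < `|x| -> f x = 0) ->
  \int[mu]_x f x = \int[mu]_(x in `[- M, M]) f x.
Proof.
move=> f0; rewrite [RHS]Rintegral_mkcond; apply: eq_Rintegral => x _.
rewrite patchE; case: ifPn => //; rewrite notin_setE/= in_itv/= -ler_norml => /negP.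
by rewrite -ltNge => /f0.
Qed.

(** Integration by parts: the derivative of [f * phi] is integrated over an interval at whose ends
    phi vanishes. *)
Lemma ac_weak_derivative f g phi : ac f g -> test_function phi ->
  \int[mu]_x (f x * derive1 phi x) = - \int[mu]_x (g x * phi x).
Proof.
move=> fg tphi; have [N N0 pN] := test_function_support tphi.
have acphi : ac phi (derive1 phi).
  apply: ac_C1; [exact: test_function_is_derive|exact: test_function_derive_continuous].
(* [test_function_support] says nothing at |x| = N; the larger interval has endpoints where phi
   vanishes. *)
pose M := N + 1.
have NM x : M < `|x| -> N < `|x| by apply: lt_trans; rewrite ltrDl.
have pM : phi M = 0 by apply: (pN _ _).1; rewrite ger0_norm ?ltrDl// addr_ge0.
have pNM : phi (- M) = 0.
  by apply: (pN _ _).1; rewrite normrN ger0_norm ?ltrDl// addr_ge0.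
rewrite !(@Rintegral_supportE _ M); last 2 first.
- by move=> x /NM/pN[-> _]; rewrite mulr0.
- by move=> x /NM/pN[_ ->]; rewrite mulr0.
apply/eqP; rewrite -addr_eq0; apply/eqP.
under [X in _ + X]eq_Rintegral do rewrite mulrC.
have [_ /(_ (- M) M)] := acM fg acphi.
rewrite pM pNM !mulr0 subrr => H; rewrite -RintegralD//.
- by rewrite -H// /M; lra.
- apply: (@eq_integrable _ _ _ mu _ _ (EFin \o (fun x => derive1 phi x * f x))) => //.
    by move=> x _; rewrite /= mulrC.
  apply: integrable_continuousM; first exact: test_function_derive_continuous.
  by apply: integrable_continuous_itv; exact: ac_continuous fg.
- apply: integrable_continuousM; first exact: test_function_continuous.
  exact: ac_itv fg.
Qed.

(** The scale n + 1 steepens both flanks while the support stays within [a, b], so the bumps tend to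
    the indicator of ]a, b[ and never exceed 1. *)
Definition smooth_bump n (a b : R) :=
  fun x => flat 1 (n.+1%:R * x + - (n.+1%:R * a)) * flat 1 (- n.+1%:R * x + n.+1%:R * b).

Lemma bumpE n a b x : smooth_bump n a b x =
  if a < x < b then expR (- (n.+1%:R * (x - a))^-1) * expR (- (n.+1%:R * (b - x))^-1)
  else 0.
Proof.
rewrite /smooth_bump /flat !hornerE mulNr [- _ + _]addrC -!mulrBr.
rewrite !pmulr_rgt0 ?ltr0n// !subr_gt0.
by case: ltP => ax; case: ltP => xb; rewrite ?mulr0 ?mul0r.
Qed.

Lemma bump_flat_algebra n a b : flat_algebra (smooth_bump n a b).
Proof. by apply: flat_mul; exact: flat_affine. Qed.

Lemma bump_ge0 n a b x : 0 <= smooth_bump n a b x.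
Proof. by rewrite bumpE; case: ifP => // _; rewrite mulr_ge0 ?expR_ge0. Qed.

Lemma bump_le1 n a b x : smooth_bump n a b x <= 1.
Proof.
rewrite bumpE; case: ifP => // /andP[ax xb].
by rewrite mulr_ile1 ?expR_ge0// -expR0 ler_expR oppr_le0 invr_ge0 mulr_ge0// subr_ge0 ltW.
Qed.

Lemma bump_out n a b x : ~~ (a < x < b) -> smooth_bump n a b x = 0.
Proof. by rewrite bumpE => /negbTE ->. Qed.

Lemma cvg_bump a b x : (smooth_bump n a b x @[n --> \oo] --> (\1_(`]a, b[%classic) x : R)).
Proof.
rewrite indicE; case: (boolP (a < x < b)) => axb; last first.
  rewrite memNset/= ?in_itv/=; last exact/negP.
  by apply: cvg_near_cst; near=> n; rewrite bump_out.
rewrite mem_set/= ?in_itv//=.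
have /andP[ax xb] := axb.
have H c : 0 < c -> (expR (- (n.+1%:R * c)^-1) @[n --> \oo] --> (1 : R)).
  move=> c0; have h1 : ((n.+1%:R * c)^-1 @[n --> \oo] --> (0 : R)).
    under eq_fun do rewrite invfM.
    by have := cvgMr_tmp (b := c^-1) (@cvg_harmonic R); rewrite mul0r; exact.
  have h2 : (- (n.+1%:R * c)^-1 @[n --> \oo] --> (0 : R)).
    by have := @cvgN _ _ _ _ _ _ _ h1; rewrite oppr0; exact.
  by have := continuous_cvg _ (@continuous_expR R 0) h2; rewrite expR0; exact.
under eq_fun do rewrite bumpE axb.
have xa0 : 0 < x - a by rewrite subr_gt0.
have bx0 : 0 < b - x by rewrite subr_gt0.
by have := cvgM (H _ xa0) (H _ bx0); rewrite mulr1; exact.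
Unshelve. all: by end_near. Qed.

End test_functions.

Section du_bois_reymond.
Context {R : realType}.
Local Notation mu := (@lebesgue_measure R).
Implicit Types (f g w phi : R -> R).

(** By Lebesgue differentiation, w x is at almost every x the derivative of the primitive that
    starts at x - 1, and this primitive vanishes near x. *)
Lemma ae_eq0_itv w : locally_integrable setT w ->
  (forall a b, a < b -> \int[mu]_(x in `[a, b]) w x = 0) ->
  {ae mu, forall x, w x = 0}.
Proof.
move=> lw w0; move: (lebesgue_differentiation lw); apply: ae_imp => x px.
have x1 : x < x + 1 by rewrite ltrDl.
have Iw : mu.-integrable [set` Interval (BLeft (x - 1)) (BRight (x + 1))] (EFin \o w).
  exact: locally_integrable_itv.
have [|//|_ <-] := FTC1_lebesgue_pt x1 Iw; first by rewrite lte_fin; lra.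
rewrite derive1E (@near_eq_derive _ R^o R^o _ (cst 0)) ?derive_cst//.
by near=> y; rewrite w0//; near: y; apply: lt_nbhsr; lra.
Unshelve. all: by end_near. Qed.

(** A primitive of a member of the class need not belong to it, but all its derivatives of positive
    order do. *)
Lemma test_function_flat_algebra_prim f phi M : flat_algebra f ->
  (forall x, is_derive x (1 : R) phi (f x)) -> (forall x, M < `|x| -> phi x = 0) ->
  test_function phi.
Proof.
move=> af dphi phi0; split=> [[|n] x|].
- by have [] := dphi x.
- have -> : derive1n n.+1 phi = derive1n n f.
    rewrite /derive1n iterSr; congr iter; apply/funext => y.
    by rewrite derive1E; have [] := dphi y.
  exact: derivable_flat_algebra.
- apply: (@subclosed_compact _ _ `[- M, M]); first exact: closed_closure.
    exact: segment_compact.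
  have cl : closed `[- M, M]%classic by exact: interval_closed.
  rewrite closureE => x; apply; split => // y /= /eqP py.
  rewrite in_itv/= -ler_norml leNgt; apply/negP => My; apply: py; exact: phi0.
Qed.

Lemma test_function_bump n (a b : R) : test_function (smooth_bump n a b).
Proof.
have ab := bump_flat_algebra n a b.
split=> [m x|]; first exact: derivable_flat_algebra.
apply: (@subclosed_compact _ _ `[a, b]); first exact: closed_closure.
  exact: segment_compact.
have cl : closed `[a, b]%classic by exact: interval_closed.
rewrite closureE => x; apply; split => // y /=.
by apply: contra_neqP; rewrite in_itv/= => /negP yab; apply: bump_out;
  apply: contra yab => /andP[/ltW -> /ltW ->].
Qed.

Lemma Rintegral_bumpE w n a b :
  \int[mu]_x (w x * smooth_bump n a b x) = \int[mu]_(x in `[a, b]) (w x * smooth_bump n a b x).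
Proof.
rewrite [RHS]Rintegral_mkcond; apply: eq_Rintegral => x _; rewrite patchE.
case: ifPn => //; rewrite notin_setE/= in_itv/= => /negP axb.
by rewrite bump_out ?mulr0//; apply: contra axb => /andP[/ltW -> /ltW ->].
Qed.

(** Dominated convergence passes from the bumps on ]a, b[ to the integral of w over the interval,
    and [ae_eq0_itv] concludes. *)
Lemma ae_eq0_test w : locally_integrable setT w ->
  (forall n a b, \int[mu]_x (w x * smooth_bump n a b x) = 0) ->
  {ae mu, forall x, w x = 0}.
Proof.
move=> lw w0; apply: ae_eq0_itv => // a b ab.
have Iw : mu.-integrable `[a, b] (EFin \o w) by exact: locally_integrable_itv.
have mw : measurable_fun `[a, b] w := measurable_integrable_EFin Iw.
pose f_ n := EFin \o (fun x => w x * smooth_bump n a b x).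
pose f := EFin \o (fun x => w x * \1_(`]a, b[%classic) x).
have mf_ n : measurable_fun `[a, b] (f_ n).
  apply/measurable_EFinP; apply: measurable_funM => //.
  apply: measurable_funTS; apply: continuous_measurable_fun.
  exact/flat_algebra_continuous/bump_flat_algebra.
have mf : measurable_fun `[a, b] f.
  by apply/measurable_EFinP; apply: measurable_funM => //; exact: measurable_indic.
have [] := @dominated_convergence _ _ _ mu _ (measurable_itv _) f_ f (abse \o (EFin \o w)) mf_ mf.
- apply: aeW => x _; apply: cvg_EFin; first exact: nearW.
  by apply: cvgMl_tmp; exact: cvg_bump.
- exact: integrable_abse.
- apply: aeW => x n _ /=; rewrite lee_fin normrM ler_piMr//.
  by rewrite ger0_norm ?bump_ge0// bump_le1.
move=> If _.
have -> : [sequence (\int[mu]_(x in `[a, b]) f_ n x)%E]_n = cst 0%E.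
  apply/funext => n /=; have := w0 n a b; rewrite Rintegral_bumpE /Rintegral.
  move=> /eqP; rewrite -eqe fineK; first by move/eqP.
  apply: integrable_fin_num => //.
  rewrite (_ : (fun x => _) = EFin \o (fun x => smooth_bump n a b x * w x)); last first.
    by apply/funext => x /=; rewrite mulrC.
  apply: integrable_continuousM => //.
  exact/flat_algebra_continuous/bump_flat_algebra.
move=> /cvg_lim => /(_ (@ereal_hausdorff _)); rewrite lim_cst// => If0.
rewrite /Rintegral (@integral_itv_bndoo _ _ _ _ true false); last first.
  by apply/measurable_EFinP; apply: measurable_funS mw => //; exact: subset_itv_oo_cc.
have -> : (\int[mu]_(x in `]a, b[) (w x)%:E = \int[mu]_(x in `]a, b[) f x)%E.
  by apply: eq_integral => x xab; rewrite /f/= indicE xab mulr1.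
rewrite -(@integral_itv_bndoo _ _ _ _ true false) -?If0//.
by apply: measurable_funS mf => //; exact: subset_itv_oo_cc.
Qed.

Lemma ac_is_derive f g : ac f g -> continuous g ->
  forall x, is_derive x (1 : R) f (g x).
Proof.
move=> fg cg x.
have x1 : x < x + 1 by rewrite ltrDl.
have x1' : x - 1 < x by lra.
have [d1 d2] := @continuous_FTC1_closed R g (x - 1) x (x + 1) x1 (ac_itv _ _ fg) x1' (cg x).
apply: (@near_eq_is_derive _ R^o R^o (fun y => f (x - 1) + \int[mu]_(t in `[x - 1, y]) g t)).
  near=> y; rewrite -(acE fg)//.
  by near: y; apply: filterS (lt_nbhsr x1') => y /ltW.
rewrite -[g x]add0r; apply: is_deriveD.
by apply: DeriveDef; [exact: d1|rewrite -derive1E; exact: d2].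
Unshelve. all: by end_near. Qed.

Lemma Rintegral_bump_gt0 : 0 < \int[mu]_x smooth_bump 0 0 1 x.
Proof.
have cb : continuous (smooth_bump 0 0 1 : R -> R).
  exact/flat_algebra_continuous/bump_flat_algebra.
have I a b : mu.-integrable `[a, b] (EFin \o (smooth_bump 0 0 1 : R -> R)).
  exact: integrable_continuous_itv.
under eq_Rintegral do rewrite -[smooth_bump _ _ _ _]mul1r.
rewrite Rintegral_bumpE; under eq_Rintegral do rewrite mul1r.
rewrite (@Rintegral_itv_split _ _ 0 (4^-1) 1) ?invr_ge0//; last by rewrite invf_le1// ler1n.
rewrite (@Rintegral_itv_split _ _ (4^-1) (2^-1) 1)//; last 2 first.
- by rewrite lef_pV2 ?posrE// ler_nat.
- by rewrite invf_le1// ler1n.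
rewrite ltr_wpDl//; first by apply: Rintegral_ge0 => x _; exact: bump_ge0.
rewrite ltr_pwDl//; last by apply: Rintegral_ge0 => x _; exact: bump_ge0.
(* On [1/4, 1/2] both x and 1 - x are at least 1/4, so each factor of the bump is at least
   e^{-4}. *)
apply: (@lt_le_trans _ _ (\int[mu]_(x in `[4^-1, 2^-1]) (expR (- 4) * expR (- 4) : R))).
  rewrite Rintegral_cst//= lebesgue_measure_itv/= lte_fin ltf_pV2 ?posrE// ltr_nat/=.
  by rewrite mulr_gt0 ?mulr_gt0 ?expR_gt0// subr_gt0 ltf_pV2 ?posrE// ltr_nat.
apply: le_Rintegral => //.
  by apply: integrable_continuous_itv => x; exact: cst_continuous.
move=> x /=; rewrite in_itv/= => /andP[x4 x2].
have x41 : 4%:R^-1 = 1/4 :> R by rewrite mul1r.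
have x21 : 2%:R^-1 = 1/2 :> R by rewrite mul1r.
rewrite bumpE ifT; last by apply/andP; split; lra.
rewrite !mul1r; apply: ler_pM; rewrite ?expR_ge0// ler_expR lerN2.
  by rewrite invf_ple ?posrE ?subr0; lra.
by rewrite invf_ple ?posrE; lra.
Qed.

(** A bump minus the multiple of a reference bump with the same integral is the derivative of a test
    function, hence orthogonal to w. With c the mean of w against the reference bump, w - c is then
    orthogonal to every bump. *)
Lemma du_bois_reymond w : locally_integrable setT w ->
  (forall phi, test_function phi -> \int[mu]_x (w x * derive1 phi x) = 0) ->
  exists c, {ae mu, forall x, w x = c}.
Proof.
move=> lw w0.
pose I0 := \int[mu]_x (smooth_bump 0 0 1) x.
have I00 : I0 != 0 by rewrite gt_eqF// Rintegral_bump_gt0.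
pose c := (\int[mu]_x (w x * smooth_bump 0 0 1 x)) / I0; exists c.
suff : {ae mu, forall x, w x - c = 0}.
  by apply: ae_imp => x /eqP; rewrite subr_eq0 => /eqP.
have lwc : locally_integrable setT (fun x => w x - c).
  apply: locally_integrableB => //; apply: continuous_locally_integrable => x.
  exact: cst_continuous.
apply: ae_eq0_test => // n a b.
have cb m u v : continuous (smooth_bump m u v : R -> R).
  exact/flat_algebra_continuous/bump_flat_algebra.
pose k := (\int[mu]_x smooth_bump n a b x) / I0.
pose th x := smooth_bump n a b x + (- k) * smooth_bump 0 0 1 x.
have ath : flat_algebra th.
  by apply: flat_add; [|apply: flat_scale]; exact: bump_flat_algebra.
have cth : continuous th by exact: flat_algebra_continuous.
pose M : R := `|a| + `|b| + 1.
have M0 : 0 <= M by rewrite /M !addr_ge0.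
have bump0 u v m x : `|u| + `|v| <= M -> M < `|x| -> smooth_bump m u v x = 0 :> R.
  move=> uvM Mx; apply: bump_out; apply/negP => /andP[ux xv].
  have := ler_norm v; have := ler_norm (- u); rewrite normrN.
  have := normr_ge0 u; have := normr_ge0 v.
  by move: Mx; rewrite ltr_normr => /orP[]; lra.
have abM : `|a| + `|b| <= M by rewrite /M lerDl.
have M1 : `|0 : R| + `|1 : R| <= M.
  by rewrite normr0 normr1 add0r /M lerDr addr_ge0.
have IM f : continuous f -> mu.-integrable `[- M, M] (EFin \o f).
  exact: integrable_continuous_itv.
have IwM f : continuous f -> mu.-integrable `[- M, M] (EFin \o (fun x => w x * f x)).
  move=> cf; apply: (@eq_integrable _ _ _ mu _ _ (EFin \o (fun x => f x * w x))) => //.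
    by move=> x _ /=; rewrite mulrC.
  by apply: integrable_continuousM => //; exact: locally_integrable_itv.
have lth := continuous_locally_integrable cth.
have acth := ac_prim lth.
(* Subtracting the value at -M makes [phi] vanish to the left of -M; to the right of M it vanishes
   because [th] has integral 0 over [-M, M]. *)
pose phi x := prim th x - prim th (- M).
have dphi x : is_derive x (1 : R) phi (th x).
  rewrite -[th x]subr0; apply: is_deriveB.
  exact: (ac_is_derive acth cth).
have sth : \int[mu]_(x in `[- M, M]) th x = 0.
  rewrite RintegralD//; last 2 first.
  - exact: IM.
  - by apply: integrable_EFinZ => //; exact: IM.
  rewrite RintegralZl//; last exact: IM.
  rewrite -!Rintegral_supportE; last 2 first.
  - by move=> x; exact: bump0.
  - by move=> x; exact: bump0.
  by rewrite -/I0 /k mulNr divfK// subrr.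
have phi0 x : M < `|x| -> phi x = 0.
  have [x0|x0] := leP 0 x.
    rewrite ger0_norm// => Mx; rewrite /phi.
    have [_ ->] := acth; last lra.
    rewrite (@Rintegral_itv_split _ _ (- M) M x) ?sth ?add0r; last 3 first.
    - lra.
    - lra.
    - exact: integrable_continuous_itv.
    rewrite -Rintegral_itv_obnd_cbnd; last first.
      apply: integrableS (integrable_continuous_itv M x cth) => //.
      by apply: subset_itvr; rewrite bnd_simp.
    rewrite (@eq_Rintegral _ _ _ mu _ (cst 0)) ?Rintegral_cst ?mul0r// => y.
    rewrite inE/= in_itv/= => /andP[My _].
    have yM : M < `|y| by rewrite (lt_le_trans My)// ler_norm.
    by rewrite /th !bump0// mulr0 addr0.
  rewrite ltr0_norm// => Mx; rewrite /phi -opprB.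
  have [_ ->] := acth; last lra.
  rewrite -Rintegral_itv_bndo_bndc; last first.
    apply: integrableS (integrable_continuous_itv x (- M) cth) => //.
    by apply: subset_itvl; rewrite bnd_simp.
  rewrite (@eq_Rintegral _ _ _ mu _ (cst 0)) ?Rintegral_cst ?mul0r ?oppr0// => y.
  rewrite inE/= in_itv/= => /andP[_ My].
  have yM : M < `|y| by rewrite -normrN (lt_le_trans _ (ler_norm _))//; lra.
  by rewrite /th !bump0// mulr0 addr0.
have tphi := test_function_flat_algebra_prim ath dphi phi0.
have := w0 _ tphi.
have -> : derive1 phi = th.
  by apply/funext => y; rewrite derive1E; have [] := dphi y.
rewrite (@Rintegral_supportE _ _ M); last first.
  by move=> x Mx; rewrite /th !bump0// !mulr0 addr0 mulr0.
under eq_Rintegral do rewrite /th mulrDr [w _ * (- k * _)]mulrCA.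
rewrite RintegralD//; last 2 first.
- exact: (IwM _ (cb n a b)).
- by apply: integrable_EFinZ => //; exact: (IwM _ (cb 0%N 0 1)).
rewrite RintegralZl//; last exact: (IwM _ (cb 0%N 0 1)).
rewrite -!Rintegral_supportE; last 2 first.
- by move=> x Mx; rewrite bump0 ?mulr0.
- by move=> x Mx; rewrite bump0 ?mulr0.
move=> H.
rewrite (@Rintegral_supportE _ _ M); last first.
  by move=> x Mx; rewrite bump0 ?mulr0.
under eq_Rintegral do rewrite mulrBl.
rewrite RintegralB//; last 2 first.
- exact: (IwM _ (cb n a b)).
- by apply: integrable_EFinZ => //; exact: (IM _ (cb n a b)).
rewrite RintegralZl//; last exact: (IM _ (cb n a b)).
rewrite -!Rintegral_supportE; last 2 first.
- by move=> x Mx; rewrite bump0 ?mulr0.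
- by move=> x Mx; rewrite bump0 ?mulr0.
rewrite -H /c /k; field.
exact: I00.
Qed.

(** The primitive of g has weak derivative g, so its difference from f has weak derivative 0 and is
    almost everywhere constant. *)
Lemma weak_derivative_ac f g : locally_integrable setT f ->
  locally_integrable setT g ->
  (forall phi, test_function phi ->
    \int[mu]_x (f x * derive1 phi x) = - \int[mu]_x (g x * phi x)) ->
  exists2 f', ac f' g & {ae mu, forall x, f x = f' x}.
Proof.
move=> lf lg fg; have ag := ac_prim lg; have cp := ac_continuous ag.
have lp := continuous_locally_integrable cp.
have lw : locally_integrable setT (fun x => f x - prim g x) by exact: locally_integrableB.
have [|c hc] := du_bois_reymond lw.
  move=> phi tphi; have := fg _ tphi; rewrite -(ac_weak_derivative ag tphi).
  have [M M0 phi0] := test_function_support tphi.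
  have s (u : R -> R) x : M < `|x| -> u x * derive1 phi x = 0.
    by move=> /phi0[_ ->]; rewrite mulr0.
  have I u : locally_integrable setT u ->
      mu.-integrable `[- M, M] (EFin \o (fun x => u x * derive1 phi x)).
    move=> lu; apply: (@eq_integrable _ _ _ mu _ _ (EFin \o (fun x => derive1 phi x * u x))) => //.
      by move=> x _ /=; rewrite mulrC.
    apply: integrable_continuousM; last exact: locally_integrable_itv.
    exact: test_function_derive_continuous.
  rewrite !(@Rintegral_supportE _ _ M)//; [|exact: s..].
  move=> H; under eq_Rintegral do rewrite mulrBl.
  by rewrite RintegralB ?H ?subrr//; exact: I.
exists (fun x => prim g x + c).
  by apply: ac_eq (acD ag (ac_cst c)) _ _ => x //; rewrite addr0.
by apply: ae_imp hc => x <-; rewrite addrC subrK.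
Qed.

End du_bois_reymond.

(** * Complex-valued functions and weak derivatives *)

Section complex_absolutely_continuous.
Context {R : realType}.
Local Notation mu := (@lebesgue_measure R).
Local Notation Re := (@complex.Re R).
Local Notation Im := (@complex.Im R).
Implicit Types (f g h : R -> R[i]) (z w : R[i]) (D : set (measurableTypeR R)).

Lemma complexP z w : Re z = Re w -> Im z = Im w -> z = w.
Proof. by case: z w => [a b] [c d] /= -> ->. Qed.

Lemma cReD z w : Re (z + w) = Re z + Re w. Proof. by case: z w => ? ? []. Qed.
Lemma cImD z w : Im (z + w) = Im z + Im w. Proof. by case: z w => ? ? []. Qed.
Lemma cReN z : Re (- z) = - Re z. Proof. by case: z. Qed.
Lemma cImN z : Im (- z) = - Im z. Proof. by case: z. Qed.
Lemma cReM z w : Re (z * w) = Re z * Re w - Im z * Im w.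
Proof. by case: z w => ? ? []. Qed.
Lemma cImM z w : Im (z * w) = Re z * Im w + Im z * Re w.
Proof. by case: z w => ? ? []. Qed.

Definition cac f g := ac (Re \o f) (Re \o g) /\ ac (Im \o f) (Im \o g).

Lemma cac_eq f g f1 g1 : cac f g -> f =1 f1 -> g =1 g1 -> cac f1 g1.
Proof. by move=> h /funext <- /funext <-. Qed.

Lemma cacD f1 g1 f2 g2 : cac f1 g1 -> cac f2 g2 ->
  cac (fun x => f1 x + f2 x) (fun x => g1 x + g2 x).
Proof.
by move=> [r1 i1] [r2 i2]; split;
  [apply: ac_eq (acD r1 r2) _ _ => x /=|apply: ac_eq (acD i1 i2) _ _ => x /=];
  rewrite ?cReD ?cImD.
Qed.

Lemma cacB f1 g1 f2 g2 : cac f1 g1 -> cac f2 g2 ->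
  cac (fun x => f1 x - f2 x) (fun x => g1 x - g2 x).
Proof.
by move=> [r1 i1] [r2 i2]; split;
  [apply: ac_eq (acB r1 r2) _ _ => x /=|apply: ac_eq (acB i1 i2) _ _ => x /=];
  rewrite ?cReD ?cImD ?cReN ?cImN.
Qed.

Lemma cac_cst z : cac (fun=> z) (fun=> 0).
Proof. by split; exact: ac_cst. Qed.

Lemma cacM f1 g1 f2 g2 : cac f1 g1 -> cac f2 g2 ->
  cac (fun x => f1 x * f2 x) (fun x => f1 x * g2 x + g1 x * f2 x).
Proof.
move=> [r1 i1] [r2 i2]; split.
  by apply: ac_eq (acB (acM r1 r2) (acM i1 i2)) _ _ => x /=;
    rewrite ?cReD !cReM //; ring.
by apply: ac_eq (acD (acM r1 i2) (acM i1 r2)) _ _ => x /=;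
  rewrite ?cImD !cImM //; ring.
Qed.

Lemma cacZ z f g : cac f g -> cac (fun x => z * f x) (fun x => z * g x).
Proof.
move=> fg; apply: cac_eq (cacM (cac_cst z) fg) _ _ => x //.
by rewrite mul0r addr0.
Qed.

Lemma cac_glue f1 g1 f2 g2 : cac f1 g1 -> cac f2 g2 -> f1 0 = f2 0 ->
  cac (fun x => if x <= 0 then f1 x else f2 x)
      (fun x => if x <= 0 then g1 x else g2 x).
Proof.
move=> [r1 i1] [r2 i2] e; split.
  apply: ac_eq (ac_glue r1 r2 _) _ _ => [|x|x] /=; last 2 first.
  - by case: ifP.
  - by case: ifP.
  by rewrite e.
apply: ac_eq (ac_glue i1 i2 _) _ _ => [|x|x] /=; last 2 first.
- by case: ifP.
- by case: ifP.
by rewrite e.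
Qed.

Definition cintegrable D f :=
  mu.-integrable D (EFin \o (Re \o f)) /\ mu.-integrable D (EFin \o (Im \o f)).

Lemma cintegralD D f g : measurable D -> cintegrable D f -> cintegrable D g ->
  cintegral D (fun x => f x + g x) = cintegral D f + cintegral D g.
Proof.
move=> mD [rf im_f] [rg im_g]; apply: complexP; rewrite ?cReD ?cImD /=.
- by under eq_Rintegral do rewrite cReD; rewrite RintegralD.
- by under eq_Rintegral do rewrite cImD; rewrite RintegralD.
Qed.

Lemma cintegrableD D f g : measurable D -> cintegrable D f -> cintegrable D g ->
  cintegrable D (fun x => f x + g x).
Proof.
move=> mD [rf im_f] [rg im_g]; split.
  rewrite (_ : _ \o _ = (fun x => (Re \o f) x + (Re \o g) x)).
    exact: integrable_EFinD.
  by apply/funext => x /=; rewrite cReD.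
rewrite (_ : _ \o _ = (fun x => (Im \o f) x + (Im \o g) x)).
  exact: integrable_EFinD.
by apply/funext => x /=; rewrite cImD.
Qed.

Lemma cintegrableZ D z f : measurable D -> cintegrable D f ->
  cintegrable D (fun x => z * f x).
Proof.
move=> mD [rf im_f]; split.
  rewrite (_ : _ \o _ = (fun x => Re z * (Re \o f) x - Im z * (Im \o f) x)).
    by apply: integrable_EFinB => //; exact: integrable_EFinZ.
  by apply/funext => x /=; rewrite cReM.
rewrite (_ : _ \o _ = (fun x => Re z * (Im \o f) x + Im z * (Re \o f) x)).
  by apply: integrable_EFinD => //; exact: integrable_EFinZ.
by apply/funext => x /=; rewrite cImM.
Qed.

Lemma cintegralZ D z f : measurable D -> cintegrable D f ->
  cintegral D (fun x => z * f x) = z * cintegral D f.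
Proof.
move=> mD [rf im_f]; apply: complexP; rewrite ?cReM ?cImM /=.
- under eq_Rintegral do rewrite cReM.
  by rewrite RintegralB// ?RintegralZl//; exact: integrable_EFinZ.
- under eq_Rintegral do rewrite cImM.
  by rewrite RintegralD// ?RintegralZl//; exact: integrable_EFinZ.
Qed.

Lemma eq_cintegral D f g : (forall x, D x -> f x = g x) ->
  cintegral D f = cintegral D g.
Proof.
by move=> fg; apply: complexP => /=; apply: eq_Rintegral => x; rewrite inE => /fg ->.
Qed.

Lemma cintegralM0 D f : cintegral D (fun x => f x * 0) = 0.
Proof.
rewrite (@eq_cintegral _ _ (fun=> 0)) => [|x _]; last by rewrite mulr0.
by apply: complexP; rewrite /= /Rintegral integral0.
Qed.

Lemma eq_cintegrable D f g : measurable D -> (forall x, D x -> f x = g x) ->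
  cintegrable D f -> cintegrable D g.
Proof.
by move=> mD fg [r i]; split; [apply: eq_integrable r|apply: eq_integrable i] => //;
  move=> x; rewrite inE => /fg /= ->.
Qed.

Lemma cintegrableS D E f : measurable D -> measurable E -> E `<=` D ->
  cintegrable D f -> cintegrable E f.
Proof.
by move=> mD mE ED [r i]; split; [apply: integrableS r|apply: integrableS i].
Qed.

Lemma ae_eq_cintegral D f g : measurable D ->
  measurable_fun D (Re \o f) -> measurable_fun D (Im \o f) ->
  measurable_fun D (Re \o g) -> measurable_fun D (Im \o g) ->
  {ae mu, forall x, D x -> f x = g x} -> cintegral D f = cintegral D g.
Proof.
move=> mD rf i_f rg i_g fg; apply: complexP => /=;
  by apply: ae_eq_Rintegral => //; apply: ae_imp fg => x /= h /h ->.
Qed.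

Lemma cacE f g a b : cac f g -> a <= b ->
  f b - f a = cintegral `[a, b] g.
Proof.
move=> [[_ r] [_ i]] ab; apply: complexP; rewrite ?cReD ?cImD ?cReN ?cImN /=.
  exact: r.
exact: i.
Qed.

Lemma cac_itv f g a b : cac f g -> cintegrable `[a, b] g.
Proof. by move=> [r i]; split; [exact: ac_itv r|exact: ac_itv i]. Qed.

Lemma cac_clocal f g : cac f g -> clocally_integrable g.
Proof. by move=> [[r _] [i _]]. Qed.

Lemma cac_clocal_l f g : cac f g -> clocally_integrable f.
Proof.
by move=> [r i]; split; apply: continuous_locally_integrable;
  [exact: ac_continuous r|exact: ac_continuous i].
Qed.

Lemma clocalD f g : clocally_integrable f -> clocally_integrable g ->
  clocally_integrable (fun x => f x + g x).
Proof.
move=> [rf i_f] [rg i_g]; split.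
  rewrite (_ : _ \o _ = (Re \o f) \+ (Re \o g)); first exact: locally_integrableD.
  by apply/funext => x /=; rewrite cReD.
rewrite (_ : _ \o _ = (Im \o f) \+ (Im \o g)); first exact: locally_integrableD.
by apply/funext => x /=; rewrite cImD.
Qed.

Lemma clocalM f g h : cac f g -> clocally_integrable h -> clocally_integrable (fun x => f x * h x).
Proof.
move=> [r i] [rh ih]; have cr := ac_continuous r; have ci := ac_continuous i.
split.
  rewrite (_ : _ \o _ = (fun x => (Re \o f) x * (Re \o h) x) \- (fun x => (Im \o f) x * (Im \o h) x)).
    by apply: locally_integrableB; exact: locally_integrableM.
  by apply/funext => x /=; rewrite cReM.
rewrite (_ : _ \o _ = (fun x => (Re \o f) x * (Im \o h) x) \+ (fun x => (Im \o f) x * (Re \o h) x)).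
  by apply: locally_integrableD; exact: locally_integrableM.
by apply/funext => x /=; rewrite cImM.
Qed.

Lemma clocalZ z h : clocally_integrable h -> clocally_integrable (fun x => z * h x).
Proof. exact: clocalM (cac_cst z). Qed.

Lemma cac_prim g : clocally_integrable g -> exists2 f, cac f g & f 0 = 0.
Proof.
move=> [r i]; exists (fun x => prim (Re \o g) x +i* prim (Im \o g) x).
  split.
    by apply: ac_eq (ac_prim r) _ _.
  by apply: ac_eq (ac_prim i) _ _.
by rewrite !prim0.
Qed.

Lemma cexpD z w : cexp (z + w) = cexp z * cexp w.
Proof.
apply: complexP; rewrite /cexp !(cReM, cImM, cReD, cImD)/= !(mul0r, subr0, addr0);
  rewrite expRD ?cosD ?sinD; ring.
Qed.

Lemma cexp0 : cexp 0 = 1 :> R[i].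
Proof.
by apply: complexP; rewrite /cexp !(cReM, cImM)/= expR0 cos0 sin0; ring.
Qed.

Lemma cexp_neq0 z : cexp z != 0.
Proof.
apply/eqP => z0; have := cexpD z (- z); rewrite subrr cexp0 z0 mul0r.
by move=> /eqP; rewrite oner_eq0.
Qed.

Lemma normc_cexp z : Normc.normc (cexp z) = expR (Re z).
Proof.
rewrite /cexp Normc.normcM /= [X in Num.sqrt X * _](_ : _ = expR (Re z) ^+ 2).
  rewrite [X in _ * Num.sqrt X](_ : _ = 1); last by rewrite cos2Dsin2.
  by rewrite sqrtr1 mulr1 sqrtr_sqr ger0_norm// expR_ge0.
by rewrite expr0n addr0.
Qed.

(** With [t] equal to 0, U or -U this differentiates all the exponentials that serve as solutions
    and integrating factors. *)
Lemma cac_cexp z (t t' : R -> R) : (forall x, is_derive x (1 : R) t (t' x)) ->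
  continuous t' ->
  cac (fun x => cexp (z * x%:C + (t x)%:C))
      (fun x => (z + (t' x)%:C) * cexp (z * x%:C + (t x)%:C)).
Proof.
move=> dt ct'; set a := Re z; set b := Im z.
pose A x := expR (a * x + t x).
have dlin c x : is_derive x (1 : R) (fun x => c * x) c.
  have := @is_deriveZ _ _ _ id c x (1 : R) _ (is_derive_id x 1).
  by move=> H; apply: is_derive_eq H _; rewrite /GRing.scale/= mulr1.
have dA : forall x, is_derive x (1 : R) A (A x * (a + t' x)).
  move=> x; have := is_deriveD (dlin a x) (dt x).
  exact: (@is_derive1_comp _ expR (fun x => a * x + t x)).
have cA : continuous A.
  by move=> x; apply/differentiable_continuous/derivable1_diffP; have [] := dA x.
have cs k c d : (forall x, is_derive x (1 : R) k (d x)) -> continuous d ->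
    ac (fun x => k (c * x)) (fun x => d (c * x) * c).
  move=> dk cd; apply: ac_C1 => x.
  apply: cvgM; last exact: cvg_cst.
  apply: (@continuous_comp _ _ _ (fun x => c * x) d); last exact: cd.
  by apply: mulrl_continuous.
have acA : ac A (fun x => A x * (a + t' x)).
  apply: ac_C1 => // x; apply: cvgM; first exact: cA.
  by apply: cvgD; [exact: cvg_cst|exact: ct'].
have accos : ac (fun x => cos (b * x)) (fun x => - sin (b * x) * b).
  by apply: cs => x; apply: continuousN; exact: continuous_sin.
have acsin : ac (fun x => sin (b * x)) (fun x => cos (b * x) * b).
  by apply: cs => x; exact: continuous_cos.
have E x : cexp (z * x%:C + (t x)%:C) = (A x * cos (b * x)) +i* (A x * sin (b * x)).
  apply: complexP; rewrite /cexp !(cReM, cImM, cReD, cImD)/= -/a -/b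
    !(mulr0, mul0r, subr0, addr0, add0r);
  by rewrite /A.
apply: cac_eq (_ : cac (fun x => (A x * cos (b * x)) +i* (A x * sin (b * x)))
   (fun x => (A x * (a + t' x) * cos (b * x) - A x * sin (b * x) * b) +i*
    (A x * (a + t' x) * sin (b * x) + A x * cos (b * x) * b))) _ _.
- split.
    by apply: ac_eq (acM acA accos) _ _ => x //=; ring.
  by apply: ac_eq (acM acA acsin) _ _ => x //=; ring.
- by move=> x; rewrite E.
- move=> x; rewrite E; apply: complexP; rewrite !(cReM, cImM, cReD, cImD)/= -/a -/b; ring.
Qed.

End complex_absolutely_continuous.

(** * Integrals, null sets and norms for the Gibbs measure *)

Section gibbs_measure.
Context {R : realType} (U : R -> R)
  (nu : {measure set (measurableTypeR R) -> \bar R}).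
Local Notation mu := (@lebesgue_measure R).
Local Notation Re := (@complex.Re R).
Local Notation Im := (@complex.Im R).
Hypothesis nuE : is_gibbs_measure U nu.
Hypothesis cU : continuous U.
Implicit Types (f g h : R -> R[i]).

Let mw : measurable_fun (setT : set (measurableTypeR R)) (fun x => (expR (- U x))%:E).
Proof.
apply/measurable_EFinP; apply: continuous_measurable_fun => x.
by apply: continuous_comp; [exact/continuousN/cU|exact: continuous_expR].
Qed.

Import HBNNSimple.

(** The density formula for simple functions, by linearity from indicators; [ge0_integral_gibbs]
    extends it by monotone convergence. *)
Let integral_gibbs_nnsfun (h : {nnsfun (measurableTypeR R) >-> R}) :
  (\int[nu]_x (h x)%:E = \int[mu]_x ((h x)%:E * (expR (- U x))%:E))%E.
Proof.
have hw0 r x : (0 <= (r * \1_(h @^-1` [set r]) x)%:E)%E by rewrite EFinM nnfun_muleindic_ge0.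
have mhr r : measurable_fun (setT : set (measurableTypeR R))
    (fun x => (r * \1_(h @^-1` [set r]) x)%:E).
  by apply/measurable_EFinP/measurableT_comp.
under [LHS]eq_integral do rewrite fimfunE -fsumEFin//.
rewrite [LHS]ge0_integral_fsum//.
under [RHS]eq_integral.
  move=> x xD; rewrite fimfunE -fsumEFin// muleC ge0_mule_fsumr; last by [].
  over.
rewrite [RHS]ge0_integral_fsum//; last 2 first.
  - by move=> r; apply: emeasurable_funM.
  - by move=> r x _; rewrite mule_ge0// lee_fin expR_ge0.
apply: eq_fsbigr => r rh; rewrite integralZl_indic_nnsfun//.
under [RHS]eq_integral do rewrite EFinM muleCA.
rewrite integral_indic// setIT nuE//.
have r0 : 0 <= r by move: rh; rewrite inE => -[x _ <-].
have mG : measurable_fun (setT : set (measurableTypeR R))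
    (fun x => ((expR (- U x))%:E * (\1_(h @^-1` [set r]) x)%:E)%E).
  by apply: emeasurable_funM => //; exact/measurable_EFinP/measurable_indic.
have G0 x : (0 <= (expR (- U x))%:E * (\1_(h @^-1` [set r]) x)%:E)%E.
  by rewrite mule_ge0// lee_fin ?expR_ge0.
rewrite (ge0_integralZl mu measurableT mG)//.
congr (_ * _)%E; rewrite [LHS]integral_mkcond; apply: eq_integral => x _.
by rewrite patchE indicE; case: ifPn => _; rewrite ?mule1 ?mule0.
Qed.

Lemma ge0_integral_gibbs (f : measurableTypeR R -> \bar R) :
  measurable_fun setT f -> (forall x, (0 <= f x)%E) ->
  (\int[nu]_x f x = \int[mu]_x (f x * (expR (- U x))%:E))%E.
Proof.
move=> mf f0; pose f_ := nnsfun_approx measurableT mf.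
have w0 x : (0 <= (expR (- U x))%:E)%E by rewrite lee_fin expR_ge0.
transitivity (limn (fun n => \int[nu]_x (f_ n x)%:E))%E.
  rewrite -monotone_convergence//=.
  - apply: eq_integral => x _; apply/esym/cvg_lim => //=.
    exact: cvg_nnsfun_approx.
  - by move=> n; apply: measurableT_comp => //; exact: measurable_funTS.
  - by move=> n x _; rewrite lee_fin.
  - by move=> x _ a b ab; rewrite lee_fin//; exact/lefP/nd_nnsfun_approx.
transitivity (limn (fun n => \int[mu]_x ((f_ n x)%:E * (expR (- U x))%:E)))%E.
  by congr (limn _); apply/funext => n; exact: integral_gibbs_nnsfun.
rewrite -monotone_convergence//=.
- apply: eq_integral => x _; apply/cvg_lim => //=.
  have h : (EFin \o f_^~ x) @ \oo --> f x by exact: cvg_nnsfun_approx.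
  exact: (cvgeZr _ h).
- by move=> n; apply: emeasurable_funM => //; apply: measurableT_comp => //; exact: measurable_funTS.
- by move=> n x _; rewrite mule_ge0// lee_fin.
- move=> x _ a b ab; rewrite lee_wpmul2r// lee_fin.
  exact/lefP/nd_nnsfun_approx.
Qed.

(** The density e^{-U} is positive everywhere, so nu and Lebesgue measure have the same null
    sets. *)
Lemma ae_gibbsP (P : R -> Prop) :
  {ae nu, forall x, P x} <-> {ae mu, forall x, P x}.
Proof.
split=> -[A [mA A0 PA]]; exists A; split => //.
- have : (\int[mu]_(x in A) `|(expR (- U x))%:E| = 0)%E.
    rewrite -A0 nuE//; apply: eq_integral => x _.
    by rewrite gee0_abs// lee_fin expR_ge0.
  move/(ae_eq_integral_abs mu mA (measurable_funTS mw)).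
  move=> [B [mB B0 AB]].
  suff sub : A `<=` B.
    apply/eqP; rewrite -measure_le0 -B0; apply: le_measure => //; rewrite inE//.
  move=> x Ax; apply: AB => /= /(_ Ax) /eqP.
  by rewrite eqe gt_eqF// expR_gt0.
- by rewrite nuE//; apply: null_set_integral => //; exact: measurable_funTS.
Qed.

(** The squared modulus as a polynomial in the real and imaginary parts, within reach of [ring] and
    [nra]. *)
Definition sqnorm (z : R[i]) : R := Re z ^+ 2 + Im z ^+ 2.

Lemma sqnorm_ge0 z : 0 <= sqnorm z.
Proof. by rewrite addr_ge0// sqr_ge0. Qed.

Lemma normc_sqnorm z : Normc.normc z = Num.sqrt (sqnorm z).
Proof. by case: z. Qed.

Lemma sqr_normc_sqnorm z : Normc.normc z ^+ 2 = sqnorm z.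
Proof. by rewrite normc_sqnorm sqr_sqrtr// sqnorm_ge0. Qed.

Definition cmeasurable f := measurable_fun (setT : set (measurableTypeR R)) (Re \o f) /\
  measurable_fun (setT : set (measurableTypeR R)) (Im \o f).

(** The squared norm of L^2(nu), written over Lebesgue measure. Estimates are carried out on it, and
    [L2norm_le] takes the square root at the end. *)
Definition energy f : \bar R := (\int[mu]_x (sqnorm (f x) * expR (- U x))%:E)%E.

Lemma energy_ge0 f : (0 <= energy f)%E.
Proof.
by apply: integral_ge0 => x _; rewrite lee_fin mulr_ge0 ?sqnorm_ge0 ?expR_ge0.
Qed.

Lemma measurable_sqnorm f : cmeasurable f ->
  measurable_fun (setT : set (measurableTypeR R)) (fun x => sqnorm (f x)).
Proof. by move=> [mr mi]; apply: measurable_funD; exact: measurable_funX. Qed.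

Lemma L2normE f : cmeasurable f -> L2norm nu f = (energy f `^ 2^-1)%E.
Proof.
move=> mf; rewrite /L2norm unlock /=; congr poweR.
transitivity (\int[nu]_x (sqnorm (f x))%:E)%E.
  apply: eq_integral => x _ /=; rewrite ger0_norm normc_sqnorm ?sqrtr_ge0//.
  by rewrite powR_mulrn ?sqrtr_ge0// sqr_sqrtr ?sqnorm_ge0.
rewrite ge0_integral_gibbs//.
  by apply/measurable_EFinP; exact: measurable_sqnorm.
by move=> x; rewrite lee_fin sqnorm_ge0.
Qed.

Lemma L2E f : L2 nu f <-> cmeasurable f /\ (energy f < +oo)%E.
Proof.
split=> [[mr mi Lf]|[[mr mi] Ef]].
  have mf : cmeasurable f by split.
  split => //; move: Lf; rewrite L2normE// => /lty_poweRy; apply.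
  by rewrite invr_eq0.
split => //; rewrite L2normE//.
by rewrite poweR_lty.
Qed.

Lemma L2norm_le f h (C : R) : 0 <= C -> cmeasurable f -> cmeasurable h ->
  (energy f <= (C ^+ 2)%:E * energy h)%E ->
  (L2norm nu f <= C%:E * L2norm nu h)%E.
Proof.
move=> C0 mf mh fh; rewrite !L2normE//.
apply: le_trans (_ : (((C ^+ 2)%:E * energy h) `^ 2^-1 <= _)%E).
  by apply: gt0_ler_poweR; rewrite ?invr_ge0// ?in_itv/= ?leey ?energy_ge0 ?mule_ge0
    ?lee_fin ?sqr_ge0// ?andbT ?energy_ge0.
rewrite poweRM ?energy_ge0 ?lee_fin ?sqr_ge0//.
by rewrite poweR_EFin powR12_sqrt ?sqr_ge0// sqrtr_sqr ger0_norm.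
Qed.

End gibbs_measure.

(** * Weak derivatives and absolutely continuous representatives *)

Section weak_derivatives.
Context {R : realType}.
Local Notation mu := (@lebesgue_measure R).
Local Notation Re := (@complex.Re R).
Local Notation Im := (@complex.Im R).
Implicit Types (f g h : R -> R[i]).

Lemma cReMr z (r : R) : Re (z * r%:C) = Re z * r.
Proof. by rewrite cReM /=; ring. Qed.

Lemma cImMr z (r : R) : Im (z * r%:C) = Im z * r.
Proof. by rewrite cImM /=; ring. Qed.

Lemma is_weak_derivativeE f g : clocally_integrable f -> clocally_integrable g ->
  is_weak_derivative f g <-> forall phi, test_function phi ->
    (\int[mu]_x (Re (f x) * derive1 phi x) = - (\int[mu]_x (Re (g x) * phi x))) /\
    (\int[mu]_x (Im (f x) * derive1 phi x) = - (\int[mu]_x (Im (g x) * phi x))).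
Proof.
move=> lf lg; split=> [[_ _ fg] phi tphi|fg].
  have E := fg _ tphi.
  have rE := congr1 Re E; have iE := congr1 Im E.
  move: rE iE; rewrite cReN cImN /cintegral /=.
  under [LHS]eq_Rintegral do rewrite cReMr.
  under [X in - X]eq_Rintegral do rewrite cReMr.
  move=> rE; under [LHS]eq_Rintegral do rewrite cImMr.
  by under [X in - X]eq_Rintegral do rewrite cImMr.
split => // phi tphi; have [rE iE] := fg _ tphi.
apply: complexP; rewrite ?cReN ?cImN /cintegral /=.
  under eq_Rintegral do rewrite cReMr.
  by under [X in - X]eq_Rintegral do rewrite cReMr.
under eq_Rintegral do rewrite cImMr.
by under [X in - X]eq_Rintegral do rewrite cImMr.
Qed.

Lemma cac_is_weak_derivative f g : cac f g -> is_weak_derivative f g.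
Proof.
move=> fg; apply/is_weak_derivativeE; [exact: cac_clocal_l fg|exact: cac_clocal fg|].
by case: fg => r i phi tphi; split; exact: ac_weak_derivative.
Qed.

Lemma is_weak_derivative_cac f g : is_weak_derivative f g ->
  exists2 F, cac F g & {ae mu, forall x, f x = F x}.
Proof.
move=> fg; have [lf lg _] := fg; have [[lrf lif] [lrg lig]] := (lf, lg).
have fgE := (is_weak_derivativeE lf lg).1 fg.
have [F1 h1 e1] := weak_derivative_ac lrf lrg (fun phi t => (fgE phi t).1).
have [F2 h2 e2] := weak_derivative_ac lif lig (fun phi t => (fgE phi t).2).
exists (fun x => F1 x +i* F2 x); first by split; [apply: ac_eq h1 _ _|apply: ac_eq h2 _ _].
by apply: ae_imp2 e1 e2 => x /= e1 e2; apply: complexP.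
Qed.

Lemma is_weak_derivative_ae f f1 g : is_weak_derivative f g -> clocally_integrable f1 ->
  {ae mu, forall x, f x = f1 x} -> is_weak_derivative f1 g.
Proof.
move=> [lf lg fg] lf1 ff1; split => // phi tphi; rewrite -fg//.
have cphi := test_function_derive_continuous tphi.
have mphi : measurable_fun (setT : set (measurableTypeR R)) (derive1 phi).
  exact: continuous_measurable_fun.
have mM (k : R -> R) : measurable_fun (setT : set (measurableTypeR R)) k ->
    measurable_fun (setT : set (measurableTypeR R)) (fun x => k x * derive1 phi x).
  by move=> mk; exact: measurable_funM.
case: lf => -[mrf _ _] [mif _ _]; case: lf1 => -[mrf1 _ _] [mif1 _ _].
have ER (k : R -> R[i]) : Re \o (fun x => k x * (derive1 phi x)%:C) =
    (fun x => (Re \o k) x * derive1 phi x).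
  by apply/funext => x /=; rewrite cReMr.
have EI (k : R -> R[i]) : Im \o (fun x => k x * (derive1 phi x)%:C) =
    (fun x => (Im \o k) x * derive1 phi x).
  by apply/funext => x /=; rewrite cImMr.
apply: ae_eq_cintegral => //; rewrite ?ER ?EI; [exact: mM..|].
by apply: ae_imp ff1 => x ->.
Qed.

Lemma ae_eq_test (u v : R -> R) : locally_integrable setT u -> locally_integrable setT v ->
  (forall phi, test_function phi -> \int[mu]_x (u x * phi x) = \int[mu]_x (v x * phi x)) ->
  {ae mu, forall x, u x = v x}.
Proof.
move=> lu lv uv.
suff : {ae mu, forall x, u x - v x = 0}.
  by apply: ae_imp => x /eqP; rewrite subr_eq0 => /eqP.
apply: ae_eq0_test => [|n a b]; first exact: locally_integrableB.
have cb : continuous (smooth_bump n a b : R -> R).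
  exact/flat_algebra_continuous/bump_flat_algebra.
have I k : locally_integrable setT k ->
    mu.-integrable `[a, b] (EFin \o (fun x => k x * smooth_bump n a b x)).
  move=> lk; rewrite (_ : (fun x => _) = (fun x => smooth_bump n a b x * k x)).
    by apply: integrable_continuousM => //; exact: locally_integrable_itv.
  by apply/funext => x; rewrite mulrC.
rewrite Rintegral_bumpE; under eq_Rintegral do rewrite mulrBl.
rewrite RintegralB//; [|exact: I..].
by rewrite -!Rintegral_bumpE uv ?subrr//; exact: test_function_bump.
Qed.

Lemma is_weak_derivative_unique f g g1 : is_weak_derivative f g ->
  is_weak_derivative f g1 -> {ae mu, forall x, g x = g1 x}.
Proof.
move=> fg fg1; have [lf lg _] := fg; have [_ lg1 _] := fg1.
have e := (is_weak_derivativeE lf lg).1 fg.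
have e1 := (is_weak_derivativeE lf lg1).1 fg1.
have [[lrg lig] [lrg1 lig1]] := (lg, lg1).
have r : {ae mu, forall x, Re (g x) = Re (g1 x)}.
  apply: (ae_eq_test lrg lrg1) => phi t; apply: oppr_inj.
  by rewrite -(e phi t).1 -(e1 phi t).1.
have i : {ae mu, forall x, Im (g x) = Im (g1 x)}.
  apply: (ae_eq_test lig lig1) => phi t; apply: oppr_inj.
  by rewrite -(e phi t).2 -(e1 phi t).2.
by apply: ae_imp2 r i => x; exact: complexP.
Qed.

Lemma weak_derivativeP f g : is_weak_derivative f g ->
  is_weak_derivative f (weak_derivative f).
Proof. by move=> fg; apply: (@xgetPex _ (fun=> 0) [set g | is_weak_derivative f g]); exists g. Qed.

(** [weak_derivative] picks a representative by choice, so its values are known only almost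
    everywhere; this lemma compares it with an explicit derivative. *)
Lemma cac_weak_derivative f F g : clocally_integrable f -> cac F g ->
  {ae mu, forall x, f x = F x} ->
  is_weak_derivative f g /\ {ae mu, forall x, weak_derivative f x = g x}.
Proof.
move=> lf Fg fF.
have fg : is_weak_derivative f g.
  apply: is_weak_derivative_ae (cac_is_weak_derivative Fg) lf _.
  by apply: ae_imp fF.
split => //; exact: (is_weak_derivative_unique (weak_derivativeP fg) fg).
Qed.

End weak_derivatives.

(** * Sobolev functions for the Gibbs measure *)

Section W12_characterization.
Context {R : realType} (U : R -> R)
  (nu : {measure set (measurableTypeR R) -> \bar R}).
Local Notation mu := (@lebesgue_measure R).
Local Notation Re := (@complex.Re R).
Local Notation Im := (@complex.Im R).
Hypothesis nuE : is_gibbs_measure U nu.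
Hypothesis cU : continuous U.
Implicit Types (f g h : R -> R[i]).

Lemma continuous_expRU : continuous (fun x => expR (U x)).
Proof. by move=> x; apply: continuous_comp; [exact: cU|exact: continuous_expR]. Qed.

Lemma continuous_expRNU : continuous (fun x => expR (- U x)).
Proof.
by move=> x; apply: continuous_comp; [exact/continuousN/cU|exact: continuous_expR].
Qed.

Lemma measurable_energy f : cmeasurable f -> measurable_fun (setT : set (measurableTypeR R))
   (fun x => sqnorm (f x) * expR (- U x)).
Proof.
move=> mf; apply: measurable_funM; first exact: measurable_sqnorm.
by apply: continuous_measurable_fun; exact: continuous_expRNU.
Qed.

Lemma integrable_energy f : cmeasurable f -> (energy U f < +oo)%E ->
  mu.-integrable setT (EFin \o (fun x => sqnorm (f x) * expR (- U x))).
Proof.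
move=> mf Ef; apply/integrableP; split.
  by apply/measurable_EFinP; exact: measurable_energy.
under eq_integral => x _ do
  rewrite gee0_abs ?lee_fin ?mulr_ge0 ?sqnorm_ge0 ?expR_ge0//.
exact: Ef.
Qed.

Lemma norm_Re_sqnorm (z : R[i]) : `|Re z| <= 1 + sqnorm z.
Proof.
rewrite /sqnorm ler_norml; apply/andP; split; nra.
Qed.

Lemma norm_Im_sqnorm (z : R[i]) : `|Im z| <= 1 + sqnorm z.
Proof.
rewrite /sqnorm ler_norml; apply/andP; split; nra.
Qed.

(** On compact intervals e^U is bounded, so |f|^2 is Lebesgue integrable there, and the real and
    imaginary parts are at most 1 + |f|^2. *)
Lemma L2_clocal f : L2 nu f -> clocally_integrable f.
Proof.
move=> /(L2E nuE cU)[mf Ef]; have [mr mi] := mf.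
have IM M : mu.-integrable `[- M, M] (EFin \o (fun x => 1 + sqnorm (f x))).
  apply: integrable_EFinD => //.
    by apply: integrable_continuous_itv => x; exact: cst_continuous.
  rewrite (_ : (fun x => _) =
     (fun x => expR (U x) * (sqnorm (f x) * expR (- U x)))).
    apply: integrable_continuousM; first exact: continuous_expRU.
    by apply: integrableS (integrable_energy mf Ef).
  by apply/funext => x; rewrite mulrCA -expRD subrr expR0 mulr1.
split; apply: locally_integrableP => // M M0; apply: le_integrable_EFin (IM M) => //.
- exact: measurable_funTS.
- by move=> x _; exact: norm_Re_sqnorm.
- exact: measurable_funTS.
- by move=> x _; exact: norm_Im_sqnorm.
Qed.

Lemma W12_cac f : W12 nu f -> exists2 F, cac F (weak_derivative f) &
  {ae mu, forall x, f x = F x}.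
Proof.
move=> [_ [g fg _]].
exact: is_weak_derivative_cac (weak_derivativeP fg).
Qed.

Lemma cac_W12 f g : cac f g -> L2 nu f -> L2 nu g ->
  W12 nu f /\ {ae mu, forall x, weak_derivative f x = g x}.
Proof.
move=> fg Lf Lg; have lf := L2_clocal Lf.
have [fg' e] := cac_weak_derivative lf fg (aeW _ (fun x => erefl)).
by split => //; split => //; exists g.
Qed.

End W12_characterization.

(** * Hardy inequalities on the half-line *)

Section weights.
Context {R : realType} (U : R -> R) (kappa b : R).
Local Notation mu := (@lebesgue_measure R).
Local Notation U' := (derive1 U).
Hypothesis dU : forall x, is_derive x (1 : R) U (U' x).
Hypothesis cU' : continuous U'.
Hypothesis U'_ge0 : forall x : R, 0 <= x -> 0 <= U' x.
Hypothesis U'_pinfty : U' x @[x --> +oo] --> +oo.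
Hypothesis kappa_gt0 : 0 < kappa.

(** For [kappa] = 1/2 and [b] = Re gamma, e^W and e^{-W} are the moduli of e^{gamma x + U} and
    e^{-gamma x}, each times e^{-U/2}. For [kappa] = 1 and [b] = 2 Re gamma, e^{-W} is the modulus
    of e^{-2 gamma x - U}. *)
Definition weight (x : R) := kappa * U x + b * x.

Let cU : continuous U.
Proof.
by move=> x; apply/differentiable_continuous/derivable1_diffP; have [] := dU x.
Qed.

Lemma is_derive_weight x : is_derive x (1 : R) weight (kappa * U' x + b).
Proof.
have h1 := @is_deriveZ _ _ _ U kappa x (1 : R) _ (dU x).
have h2 := @is_deriveZ _ _ _ id b x (1 : R) _ (is_derive_id x (1 : R)).
by apply: is_derive_eq (is_deriveD h1 h2) _; rewrite /GRing.scale/= mulr1.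
Qed.

Lemma continuous_weight : continuous weight.
Proof.
move=> x; apply/differentiable_continuous/derivable1_diffP.
by have [] := is_derive_weight x.
Qed.

(** Beyond some [y1] the term [kappa * U'] is at least 1 + |b|. On [0, y1] it is known only to be
    nonnegative, and there M e^{-x} is at least 1 + |b|. *)
Lemma weight_slope : exists2 M : R, 0 <= M &
  forall x, 0 <= x -> 1 <= kappa * U' x + b + M * expR (- x).
Proof.
have [y0 [y0r hy0]] := (cvgryPge _).1 U'_pinfty (kappa^-1 * (1 + `|b|)).
pose y1 := `|y0| + 1.
have big x : y1 <= x -> 1 + `|b| <= kappa * U' x.
  move=> yx; rewrite -ler_pdivrMl//; apply: hy0.
  by rewrite (lt_le_trans _ yx)// /y1 (le_lt_trans (ler_norm y0))// ltrDl.
exists ((1 + `|b|) * expR y1); first by rewrite mulr_ge0 ?expR_ge0 ?addr_ge0.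
move=> x x0; have nb : - b <= `|b| by rewrite -normrN ler_norm.
have [yx|yx] := leP y1 x.
  have : 0 <= (1 + `|b|) * expR y1 * expR (- x).
    by rewrite !mulr_ge0 ?expR_ge0 ?addr_ge0.
  by have := big _ yx; lra.
have E1 : 1 <= expR y1 * expR (- x).
  by rewrite -expRD -[leLHS]expR0 ler_expR subr_ge0 ltW.
have kU : 0 <= kappa * U' x by rewrite mulr_ge0 ?U'_ge0// ltW.
have : 1 + `|b| <= (1 + `|b|) * (expR y1 * expR (- x)).
  by rewrite ler_peMr// addr_ge0.
by rewrite -mulrA; lra.
Qed.

(* The weight may decrease near 0; a bounded correction repairs this. *)
Lemma weight_majorant : exists2 C : R, 0 < C & exists V V' : R -> R,
  [/\ forall x, is_derive x (1 : R) V (V' x), continuous V',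
      forall x, 0 <= x -> 1 <= V' x,
      forall x, 0 <= x -> weight x <= V x /\ expR (V x) <= C * expR (weight x) &
      forall x, 0 <= x -> U' x <= C * V' x].
Proof.
have [M M0 hM] := weight_slope.
pose V x := weight x + M * (1 - expR (- x)).
pose V' x := kappa * U' x + b + M * expR (- x).
(* The first summand bounds e^{V - weight}, since V - weight <= M. The second comes from kappa U' <=
   V' + |b| <= (1 + |b|) V', as V' >= 1. *)
exists (expR M + kappa^-1 * (1 + `|b|)).
  by rewrite addr_gt0 ?expR_gt0// mulr_gt0 ?invr_gt0// ltr_pwDl.
have C0 : 0 < kappa^-1 * (1 + `|b|) by rewrite mulr_gt0 ?invr_gt0// ltr_pwDl.
exists V, V'; split.
- move=> x; apply: is_deriveD; first exact: is_derive_weight.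
  have dN := is_deriveN (is_derive_id x (1 : R)).
  have dE := is_derive1_comp (is_derive_expR (- x)) dN.
  have := @is_deriveZ _ _ _ _ M x (1 : R) _ (is_deriveB (is_derive_cst (1 : R) x (1 : R)) dE).
  move=> H; apply: is_derive_eq H _.
  by rewrite /GRing.scale/= mulrN1 sub0r opprK.
- move=> x; apply: cvgD.
    by apply: cvgD; [apply: cvgM; [exact: cvg_cst|exact: cU']|exact: cvg_cst].
  apply: cvgM; first exact: cvg_cst.
  by apply: continuous_comp; [exact: opp_continuous|exact: continuous_expR].
- exact: hM.
- move=> x x0; split.
    by rewrite /V lerDl mulr_ge0// subr_ge0 -expR0 ler_expR oppr_le0.
  rewrite /V expRD mulrC ler_wpM2r ?expR_ge0// (@le_trans _ _ (expR M))//.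
    by rewrite ler_expR ler_piMr// gerBl expR_ge0.
  by rewrite lerDl ltW.
- move=> x x0; have V1 := hM _ x0.
  have nb : - b <= `|b| by rewrite -normrN ler_norm.
  have ME : 0 <= M * expR (- x) by rewrite mulr_ge0 ?expR_ge0.
  rewrite mulrDl ler_wpDl ?mulr_ge0 ?expR_ge0 ?(le_trans ler01 V1)//.
  rewrite -mulrA ler_pdivlMl// mulrDl mul1r.
  have : `|b| <= `|b| * V' x by rewrite ler_peMr.
  by rewrite /V'; lra.
Qed.

Lemma Rintegral_exp_left (V V' : R -> R) (y : R) :
  (forall x, is_derive x (1 : R) V (V' x)) -> continuous V' -> 0 <= y ->
  (\int[mu]_(x in `[0%R, y]) (V' x * expR (V x))%:E = (expR (V y) - expR (V 0))%:E)%E.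
Proof.
move=> dV cV' y0.
have cV : continuous V.
  by move=> x; apply/differentiable_continuous/derivable1_diffP; have [] := dV x.
have cE : continuous (fun x => expR (V x)).
  by move=> x; apply: continuous_comp; [exact: cV|exact: continuous_expR].
have cg : continuous (fun x => V' x * expR (V x)).
  by move=> x; apply: cvgM; [exact: cV'|exact: cE].
have h : ac (fun x => expR (V x)) (fun x => V' x * expR (V x)).
  apply: ac_C1 => // x; rewrite mulrC.
  exact: (is_derive1_comp (is_derive_expR (V x)) (dV x)).
have [_ ->//] := h; rewrite /Rintegral fineK//.
exact/integrable_fin_num/integrable_continuous_itv.
Qed.

(** The integrand is the derivative of -e^{-V}, and V' >= 1 makes V grow at least linearly, so the
    boundary term at infinity vanishes. *)
Lemma integral_exp_right (V V' : R -> R) (y : R) :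
  (forall x, is_derive x (1 : R) V (V' x)) -> continuous V' -> 0 <= y ->
  (forall x, 0 <= x -> 1 <= V' x) ->
  (\int[mu]_(x in `[y, +oo[) (V' x * expR (- V x))%:E = (expR (- V y))%:E)%E.
Proof.
move=> dV cV' y0 V1.
have cV : continuous V.
  by move=> x; apply/differentiable_continuous/derivable1_diffP; have [] := dV x.
have cE : continuous (fun x => expR (- V x)).
  move=> x; apply: continuous_comp; last exact: continuous_expR.
  by apply: cvgN; exact: cV.
have cg : continuous (fun x => V' x * expR (- V x)).
  by move=> x; apply: cvgM; [exact: cV'|exact: cE].
have dF x : is_derive x (1 : R) (fun x => - expR (- V x)) (V' x * expR (- V x)).
  have := is_deriveN (@is_derive1_comp _ expR (- V) x _ _ (is_derive_expR (- V x)) (is_deriveN (dV x))).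
  by move=> H; apply: is_derive_eq H _; rewrite mulrN opprK mulrC.
have acV : ac V V' by exact: ac_C1.
have growth x : 0 <= x -> V 0 + x <= V x.
  move=> x0; rewrite (acE acV x0) lerD2l.
  apply: (@le_trans _ _ (\int[mu]_(t in `[0, x]) (1 : R))).
    rewrite Rintegral_cst//= lebesgue_measure_itv/= lte_fin mul1r.
    by move: x0; rewrite le_eqVlt => /predU1P[<-|->]/=; rewrite ?ltxx ?subr0.
  apply: le_Rintegral => //.
  - by apply: integrable_continuous_itv => z; exact: cst_continuous.
  - exact: integrable_continuous_itv.
  - by move=> z /=; rewrite in_itv/= => /andP[z0 _]; exact: V1.
rewrite (@ge0_continuous_FTC2y _ _ (fun x => - expR (- V x)) y 0).
- by rewrite sub0e -EFinN opprK.
- by move=> x yx; rewrite mulr_ge0 ?expR_ge0// (le_trans ler01)// V1// (le_trans y0).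
- exact: continuous_subspaceT.
- apply/cvgr0Pnorm_le => e e0; near=> x.
  have x0 : 0 <= x by near: x; exact: nbhs_pinfty_ge.
  rewrite normrN ger0_norm ?expR_ge0// (@le_trans _ _ (expR (- V 0) * expR (- x)))//.
    by rewrite -expRD ler_expR -opprD lerN2 growth.
  rewrite (@le_trans _ _ (expR (- V 0) * (1 + x)^-1))//.
    rewrite ler_wpM2l ?expR_ge0// expRN lef_pV2 ?posrE ?expR_gt0 ?expR_ge1Dx//.
    by rewrite ltr_pwDl.
  rewrite ler_pdivrMr ?ltr_pwDl// -ler_pdivrMl//.
  by rewrite -lerBlDl; near: x; apply: nbhs_pinfty_ge; exact: num_real.
- by move=> x _; have [] := dF x.
- apply: cvg_at_right_filter; apply: cvgN; exact: cE.
- by move=> x _; rewrite derive1E; have [] := dF x.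
Unshelve. all: by end_near. Qed.

End weights.

(** * Primitives and tails of exponentials of the weight *)

Section weight_integrals.
Context {R : realType} (U : R -> R).
Local Notation mu := (@lebesgue_measure R).
Local Notation U' := (derive1 U).
Hypothesis dU : forall x, is_derive x (1 : R) U (U' x).
Hypothesis cU' : continuous U'.
Hypothesis U'_ge0 : forall x : R, 0 <= x -> 0 <= U' x.
Hypothesis U'_pinfty : U' x @[x --> +oo] --> +oo.

Let mT (f : R -> R) (D : set (measurableTypeR R)) : continuous f -> measurable_fun D (EFin \o f).
Proof.
by move=> cf; apply/measurable_EFinP/measurable_funTS; exact: continuous_measurable_fun.
Qed.

Lemma continuous_expR_weight kappa b : continuous (fun x => expR (weight U kappa b x)).
Proof.
move=> x; apply: continuous_comp; last exact: continuous_expR.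
exact: continuous_weight.
Qed.

Lemma continuous_expRN_weight kappa b : continuous (fun x => expR (- weight U kappa b x)).
Proof.
move=> x; apply: continuous_comp; last exact: continuous_expR.
by apply: cvgN; exact: continuous_weight.
Qed.

Let ler_integral (D : set (measurableTypeR R)) (f g : R -> R) : measurable D ->
  continuous f -> continuous g -> (forall x, D x -> 0 <= f x <= g x) ->
  (\int[mu]_(x in D) (f x)%:E <= \int[mu]_(x in D) (g x)%:E)%E.
Proof.
move=> mD cf cg fg; apply: ge0_le_integral => //.
- by move=> x /fg/andP[f0 _]; rewrite lee_fin.
- exact: mT.
- exact: mT.
- by move=> x /fg/andP[_]; rewrite lee_fin.
Qed.

Let continuous_normU' : continuous (fun x => `|U' x|).
Proof. by move=> x; apply: cvg_norm; exact: cU'. Qed.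

(** With the majorant V in place of the weight, both integrands are at most a constant times the
    exact derivative V' e^V, and e^V is comparable to the exponential of the weight. *)
Lemma integral_weight_left kappa b : 0 < kappa -> exists2 C : R, 0 < C &
  forall y, 0 <= y ->
  (\int[mu]_(t in `[0%R, y]) (expR (weight U kappa b t))%:E
     <= (C * expR (weight U kappa b y))%:E)%E /\
  (\int[mu]_(t in `[0%R, y]) (`|U' t| * expR (weight U kappa b t))%:E
     <= (C * expR (weight U kappa b y))%:E)%E.
Proof.
move=> k0; have [C C0 [V [V' [dV cV' V'1 hV U'V]]]] :=
  weight_majorant b dU cU' U'_ge0 U'_pinfty k0.
have cVE : continuous (fun t => V' t * expR (V t)).
  move=> x; apply: cvgM; first exact: cV'.
  apply: continuous_comp; last exact: continuous_expR.
  by apply/differentiable_continuous/derivable1_diffP; have [] := dV x.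
exists (C + C * C); first by rewrite addr_gt0// mulr_gt0.
move=> y y0; have [WV VW] := hV _ y0.
have E : (\int[mu]_(t in `[0%R, y]) (V' t * expR (V t))%:E <= (C * expR (weight U kappa b y))%:E)%E.
  rewrite (Rintegral_exp_left dV cV' y0) lee_fin (le_trans _ VW)//.
  by rewrite gerBl expR_ge0.
have CE : (C * expR (weight U kappa b y))%:E = (C * expR (weight U kappa b y))%:E by [].
have C0' := ltW C0.
split.
  apply: (@le_trans _ _ (\int[mu]_(t in `[0%R, y]) (V' t * expR (V t))%:E)%E).
    apply: ler_integral => //; first exact: continuous_expR_weight.
    move=> x /=; rewrite in_itv/= => /andP[x0 _]; rewrite expR_ge0/=.
    have [h1 _] := hV _ x0; rewrite (@le_trans _ _ (expR (V x))) ?ler_expR//.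
    by rewrite ler_peMl ?expR_ge0// V'1.
  rewrite (le_trans E)// lee_fin ler_wpM2r ?expR_ge0// lerDl mulr_ge0//.
apply: (@le_trans _ _ (\int[mu]_(t in `[0%R, y]) (C * (V' t * expR (V t)))%:E)%E).
  apply: ler_integral => //.
  - by move=> x; apply: cvgM; [exact: continuous_normU'|exact: continuous_expR_weight].
  - by move=> x; apply: cvgM; [exact: cvg_cst|exact: cVE].
  move=> x /=; rewrite in_itv/= => /andP[x0 _]; rewrite mulr_ge0 ?expR_ge0//=.
  have [h1 _] := hV _ x0; rewrite mulrA ler_pM ?expR_ge0 ?ler_expR//.
  by rewrite ger0_norm ?U'V// U'_ge0.
under eq_integral do rewrite EFinM.
rewrite integralZl//; last exact: integrable_continuous_itv.
rewrite (@le_trans _ _ (C%:E * (C * expR (weight U kappa b y))%:E)%E)//.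
  by rewrite lee_wpmul2l// lee_fin.
by rewrite lee_fin mulrA ler_wpM2r ?expR_ge0// lerDr.
Qed.

Lemma integral_weight_right kappa b : 0 < kappa -> exists2 C : R, 0 < C &
  forall y, 0 <= y ->
  (\int[mu]_(t in `[y, +oo[) (expR (- weight U kappa b t))%:E
     <= (C * expR (- weight U kappa b y))%:E)%E /\
  (\int[mu]_(t in `[y, +oo[) (`|U' t| * expR (- weight U kappa b t))%:E
     <= (C * expR (- weight U kappa b y))%:E)%E.
Proof.
move=> k0; have [C C0 [V [V' [dV cV' V'1 hV U'V]]]] :=
  weight_majorant b dU cU' U'_ge0 U'_pinfty k0.
have C0' := ltW C0.
have cVE : continuous (fun t => V' t * expR (- V t)).
  move=> x; apply: cvgM; first exact: cV'.
  apply: continuous_comp; last exact: continuous_expR.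
  apply: cvgN.
  by apply/differentiable_continuous/derivable1_diffP; have [] := dV x.
(* V lies above the weight, so e^{-V} is the smaller exponential and the exchange costs the constant
   C. *)
have WE x : 0 <= x -> expR (- weight U kappa b x) <= C * expR (- V x).
  move=> x0; have [_ h] := hV _ x0.
  by rewrite !expRN ler_pdivlMr ?expR_gt0// mulrC ler_pdivrMr ?expR_gt0.
exists (C + C * C); first by rewrite addr_gt0// mulr_gt0.
move=> y y0; have [WV VW] := hV _ y0.
have E K : 0 <= K -> (\int[mu]_(t in `[y, +oo[) (K * (V' t * expR (- V t)))%:E <=
    (K * expR (- weight U kappa b y))%:E)%E.
  move=> K0; rewrite -ge0_integralZ_EFin//; last 2 first.
  - by apply: measurable_funTS; exact: continuous_measurable_fun.
  - move=> x; rewrite /= ?in_itv/= ?andbT => yx; rewrite mulr_ge0 ?expR_ge0//.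
    by rewrite (le_trans ler01)// V'1// (le_trans y0).
  rewrite (integral_exp_right dV cV' y0 V'1) -EFinM lee_fin ler_wpM2l//.
  by rewrite ler_expR lerN2.
split.
  apply: (@le_trans _ _ (\int[mu]_(t in `[y, +oo[) (C * (V' t * expR (- V t)))%:E)%E).
    apply: ler_integral => //; first exact: continuous_expRN_weight.
      by move=> x; apply: cvgM; [exact: cvg_cst|exact: cVE].
    move=> x /=; rewrite in_itv/= andbT => yx; rewrite expR_ge0/=.
    have x0 := le_trans y0 yx.
    rewrite (le_trans (WE _ x0))// ler_wpM2l// ler_peMl ?expR_ge0// V'1//.
  by rewrite (le_trans (E _ C0'))// lee_fin ler_wpM2r ?expR_ge0// lerDl mulr_ge0.
apply: (@le_trans _ _ (\int[mu]_(t in `[y, +oo[) ((C * C) * (V' t * expR (- V t)))%:E)%E).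
  apply: ler_integral => //.
  - by move=> x; apply: cvgM; [exact: continuous_normU'|exact: continuous_expRN_weight].
  - by move=> x; apply: cvgM; [exact: cvg_cst|exact: cVE].
  move=> x /=; rewrite in_itv/= andbT => yx; rewrite mulr_ge0 ?expR_ge0//=.
  have x0 := le_trans y0 yx; rewrite mulrACA ler_pM ?expR_ge0 ?WE//.
  by rewrite ger0_norm ?U'V// U'_ge0.
by rewrite (le_trans (E _ _))// ?mulr_ge0// lee_fin ler_wpM2r ?expR_ge0// lerDr.
Qed.

(* The lower bound on U'' makes U' almost monotone, which gives the tail
   estimate with U' y outside of the integral. *)
Lemma integral_weight_tail (a kappa b : R) : 0 < kappa ->
  (forall x y, 0 <= x -> x <= y -> U' x <= U' y + `|a| * (y - x)) ->
  exists2 C : R, 0 < C & forall y, 0 <= y ->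
  (\int[mu]_(t in `[y, +oo[) (`|U' y| * expR (- weight U kappa b t))%:E
     <= (C * expR (- weight U kappa b y))%:E)%E.
Proof.
move=> k0 hU'.
have [C1 C10 h1] := integral_weight_right b k0.
(* Lowering [b] by 1 multiplies the integrand by e^t, which absorbs the linear error |a| (t - y)
   through t - y <= e^{t - y}. *)
have [C2 C20 h2] := integral_weight_right (b - 1) k0.
exists (C1 + `|a| * C2); first by rewrite ltr_wpDr ?mulr_ge0// ltW.
move=> y y0; have [_ {}h1] := h1 _ y0; have [{}h2 _] := h2 _ y0.
have cW1 : continuous (fun t => `|U' t| * expR (- weight U kappa b t)).
  by move=> x; apply: cvgM; [exact: continuous_normU'|exact: continuous_expRN_weight].
have cW2 : continuous (fun t => (`|a| * expR (- y)) * expR (- weight U kappa (b - 1) t)).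
  by move=> x; apply: cvgM; [exact: cvg_cst|exact: continuous_expRN_weight].
have shift t : expR (- weight U kappa (b - 1) t) = expR t * expR (- weight U kappa b t).
  by rewrite -expRD /weight; congr expR; ring.
have K0 : 0 <= `|a| * expR (- y) by rewrite mulr_ge0 ?expR_ge0.
apply: (@le_trans _ _ (\int[mu]_(t in `[y, +oo[)
  (`|U' t| * expR (- weight U kappa b t) +
   (`|a| * expR (- y)) * expR (- weight U kappa (b - 1) t))%:E)%E).
  apply: ler_integral => //.
  - by move=> x; apply: cvgM; [exact: cvg_cst|exact: continuous_expRN_weight].
  - by move=> x; apply: cvgD; [exact: cW1|exact: cW2].
  move=> t /=; rewrite in_itv/= andbT => yt; rewrite mulr_ge0 ?expR_ge0//=.
  have t0 := le_trans y0 yt.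
  rewrite shift mulrA -mulrDl ler_wpM2r ?expR_ge0//.
  rewrite (ger0_norm (U'_ge0 y0)) (ger0_norm (U'_ge0 t0)) (le_trans (hU' _ _ y0 yt))// lerD2l.
  rewrite -mulrA ler_wpM2l// -expRD (le_trans _ (expR_ge1Dx _))//.
  by rewrite [- y + t]addrC lerDr.
under eq_integral do rewrite EFinD.
have P1 t : (0 <= (`|U' t| * expR (- weight U kappa b t))%:E)%E.
  by rewrite lee_fin mulr_ge0 ?expR_ge0.
have P2 t : (0 <= (`|a| * expR (- y) * expR (- weight U kappa (b - 1) t))%:E)%E.
  by rewrite lee_fin mulr_ge0 ?expR_ge0.
rewrite (ge0_integralD mu (measurable_itv _) (fun t _ => P1 t) (mT cW1)
  (fun t _ => P2 t) (mT cW2)).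
rewrite mulrDl EFinD leeD//.
have mE : measurable_fun (`[y, +oo[%classic : set (measurableTypeR R))
    (fun t => expR (- weight U kappa (b - 1) t)).
  by apply/measurable_EFinP; apply: mT; exact: continuous_expRN_weight.
rewrite -(ge0_integralZ_EFin (measurable_itv _) mE (fun t _ => expR_ge0 _) K0).
rewrite (le_trans (lee_wpmul2l _ h2))// -EFinM lee_fin shift.
rewrite le_eqVlt; apply/orP; left; apply/eqP.
transitivity (`|a| * C2 * (expR (- y) * expR y) * expR (- weight U kappa b y)).
  by ring.
by rewrite -expRD addNr expR0 mulr1.
Qed.

End weight_integrals.

(** * Cauchy-Schwarz and Schur's test for exponential kernels *)

Section hardy.
Context {R : realType}.
Local Notation mu := (@lebesgue_measure R).
Local Notation RT := (measurableTypeR R).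
Implicit Types (W k m P w : R -> R).

(** The real [p] stands for a quantity bounded by the integral of [w * k], which may itself be
    infinite; splitting the product into squares pointwise avoids any finiteness condition. The case
    p = 0 is separate because the splitting divides by p. *)
Lemma cauchy_schwarz_weight (D : set RT) w k (A p : R) : measurable D ->
  measurable_fun D w -> measurable_fun D k -> (forall x, 0 <= w x) ->
  (forall x, 0 <= k x) -> 0 < A -> 0 <= p ->
  (\int[mu]_(x in D) (w x)%:E <= A%:E)%E ->
  (p%:E <= \int[mu]_(x in D) (w x * k x)%:E)%E ->
  ((p ^+ 2)%:E <= A%:E * \int[mu]_(x in D) (w x * k x ^+ 2)%:E)%E.
Proof.
move=> mD mw mk w0 k0 A0; rewrite le_eqVlt => /predU1P[<- _ _|p0 wA pk].
  rewrite expr0n/= mule_ge0 ?lee_fin ?(ltW A0)//.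
  by apply: integral_ge0 => x _; rewrite lee_fin mulr_ge0// sqr_ge0.
have mwk : measurable_fun D (fun x => w x * k x ^+ 2).
  by apply: measurable_funM => //; exact: measurable_funX.
have mwk1 : measurable_fun D (fun x => w x * k x) by exact: measurable_funM.
set B := (\int[mu]_(x in D) (w x * k x ^+ 2)%:E)%E.
have B0 : (0 <= B)%E.
  by apply: integral_ge0 => x _; rewrite lee_fin mulr_ge0// sqr_ge0.
have t0 : 0 <= p / A / 2 by rewrite !divr_ge0// ltW.
have s0 : 0 <= A / p / 2 by rewrite !divr_ge0// ltW.
have P1 x : (0 <= (p / A / 2 * w x)%:E)%E by rewrite lee_fin mulr_ge0.
have P2 x : (0 <= (A / p / 2 * (w x * k x ^+ 2))%:E)%E.
  by rewrite lee_fin mulr_ge0// mulr_ge0// sqr_ge0.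
have M1 : measurable_fun D (fun x => (p / A / 2 * w x)%:E).
  by apply/measurable_EFinP; exact: measurable_funM.
have M2 : measurable_fun D (fun x => (A / p / 2 * (w x * k x ^+ 2))%:E).
  by apply/measurable_EFinP; exact: measurable_funM.
have pn0 : p != 0 by rewrite gt_eqF.
have An0 : A != 0 by rewrite gt_eqF.
have : (p%:E <= (p / 2)%:E + (A / p / 2)%:E * B)%E.
  apply: le_trans pk _.
  (* AM-GM with the optimal parameter p / A *)
  apply: (@le_trans _ _ (\int[mu]_(x in D) ((p / A / 2 * w x)%:E +
      (A / p / 2 * (w x * k x ^+ 2))%:E))%E).
    apply: (ge0_le_integral_EFin mD mwk1 (emeasurable_funD M1 M2)).
      by move=> x _; rewrite mulr_ge0.
    move=> x _; rewrite lee_fin -subr_ge0.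
    rewrite (_ : _ - _ = w x * (A / p / 2) * (k x - p / A) ^+ 2).
      by rewrite mulr_ge0 ?sqr_ge0// mulr_ge0.
    by field; rewrite ?An0 ?pn0.
  rewrite (ge0_integralD mu mD (fun x _ => P1 x) M1 (fun x _ => P2 x) M2).
  rewrite -(ge0_integralZ_EFin mD mw (fun x _ => w0 x) t0).
  rewrite -(ge0_integralZ_EFin mD mwk _ s0); last first.
    by move=> x _; rewrite mulr_ge0// sqr_ge0.
  rewrite leeD2r// (le_trans (lee_wpmul2l _ wA))// ?lee_fin//.
  by rewrite le_eqVlt; apply/orP; left; apply/eqP; field.
case: B B0 => [B| |] //; last first.
  by move=> _ _; rewrite mulry gtr0_sg// mul1e leey.
rewrite lee_fin => B0; rewrite -!EFinM -EFinD !lee_fin => h.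
have h2 : p / 2 <= A / p / 2 * B by lra.
have : p * (p / 2) <= p * (A / p / 2 * B) by rewrite ler_wpM2l// ltW.
have -> : p * (A / p / 2 * B) = A * B / 2 by field.
by rewrite expr2; lra.
Qed.

(* Schur's test: Cauchy-Schwarz in the measure e^{W t - W x} dt, then Tonelli. *)
Lemma hardy_left W (C : R) k P : continuous W -> 0 < C ->
  (forall y, 0 <= y -> (\int[mu]_(t in `[0%R, y]) (expR (W t))%:E <= (C * expR (W y))%:E)%E) ->
  (forall y, 0 <= y -> (\int[mu]_(t in `[y, +oo[) (expR (- W t))%:E <= (C * expR (- W y))%:E)%E) ->
  measurable_fun (setT : set RT) k -> (forall x, 0 <= k x) ->
  measurable_fun (setT : set RT) P -> (forall x, 0 <= P x) ->
  (forall x, 0 <= x ->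
    ((P x)%:E <= \int[mu]_(t in `[0%R, x]) (expR (W t - W x) * k t)%:E)%E) ->
  (\int[mu]_(x in `[0%R, +oo[) (P x ^+ 2)%:E <=
    (C ^+ 2)%:E * \int[mu]_(x in `[0%R, +oo[) (k x ^+ 2)%:E)%E.
Proof.
move=> cW C0 hl hr mk k0 mP P0 hP.
have cE : continuous (fun x => expR (W x)).
  by move=> x; apply: continuous_comp; [exact: cW|exact: continuous_expR].
have cEN : continuous (fun x => expR (- W x)).
  by move=> x; apply: continuous_comp; [exact/continuousN/cW|exact: continuous_expR].
have mE : measurable_fun (setT : set RT) (fun x => expR (W x)) by exact: continuous_measurable_fun.
have mEN : measurable_fun (setT : set RT) (fun x => expR (- W x)) by exact: continuous_measurable_fun.
have mk2 : measurable_fun (setT : set RT) (fun x => k x ^+ 2) by exact: measurable_funX.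
have mEk : measurable_fun (setT : set RT) (fun x => expR (W x) * k x ^+ 2).
  exact: measurable_funM.
have Ek0 x : 0 <= expR (W x) * k x ^+ 2 by rewrite mulr_ge0 ?expR_ge0 ?sqr_ge0.
have C0' := ltW C0.
pose J x := (\int[mu]_(t in `[0%R, x]) (expR (W t) * k t ^+ 2)%:E)%E.
have bound x : 0 <= x -> ((P x ^+ 2)%:E <= C%:E * ((expR (- W x))%:E * J x))%E.
  move=> x0.
  have mw : measurable_fun (`[0, x]%classic : set RT) (fun t => expR (- W x) * expR (W t)).
    by apply: measurable_funM => //; exact: measurable_funTS.
  have := @cauchy_schwarz_weight `[0, x]%classic (fun t => expR (- W x) * expR (W t)) k C (P x).
  move=> /(_ (measurable_itv _) mw (measurable_funTS mk)) H.
  apply: le_trans (H _ k0 C0 (P0 x) _ _) _.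
  - by move=> t; rewrite mulr_ge0 ?expR_ge0.
  - rewrite -ge0_integralZ_EFin ?expR_ge0//; last exact: measurable_funTS.
    rewrite (le_trans (lee_wpmul2l _ (hl _ x0))) ?lee_fin ?expR_ge0//.
    by rewrite mulrCA -expRD addNr expR0 mulr1.
  - rewrite (le_trans (hP _ x0))// le_eqVlt; apply/orP; left; apply/eqP.
    by apply: eq_integral => t _; rewrite expRD [expR (W t) * _]mulrC.
  rewrite lee_wpmul2l ?lee_fin// /J.
  rewrite (ge0_integralZ_EFin (measurable_itv _) (measurable_funTS mEk) (fun t _ => Ek0 t)
    (expR_ge0 _)).
  rewrite le_eqVlt; apply/orP; left; apply/eqP.
  by apply: eq_integral => t _; rewrite -mulrA.
have mJ : measurable_fun (`[0, +oo[%classic : set RT) (fun x => C%:E * ((expR (- W x))%:E * J x))%E.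
  apply: measurable_funeM; apply: emeasurable_funM.
    by apply/measurable_EFinP; exact: measurable_funTS.
  by apply: measurable_funTS; exact: measurable_integral_le.
have mP2 : measurable_fun (`[0, +oo[%classic : set RT) (fun x => P x ^+ 2).
  by apply: measurable_funTS; exact: measurable_funX.
have J0 x : (0 <= J x)%E by apply: integral_ge0 => t _; rewrite lee_fin.
apply: (@le_trans _ _ (\int[mu]_(x in `[0%R, +oo[) (C%:E * ((expR (- W x))%:E * J x)))%E).
  apply: (ge0_le_integral_EFin (measurable_itv _) mP2 mJ).
    by move=> x _; rewrite sqr_ge0.
  by move=> x /=; rewrite in_itv/= andbT => x0; exact: bound.
have mEJ : measurable_fun (`[0, +oo[%classic : set RT) (fun x => ((expR (- W x))%:E * J x)%E).
  apply: emeasurable_funM; first by apply/measurable_EFinP; exact: measurable_funTS.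
  by apply: measurable_funTS; exact: measurable_integral_le.
have EJ0 x : (0 <= (expR (- W x))%:E * J x)%E by rewrite mule_ge0// lee_fin expR_ge0.
have C0e : (0 <= C%:E)%E by rewrite lee_fin.
rewrite (ge0_integralZl mu (measurable_itv _) mEJ (fun x _ => EJ0 x) C0e).
rewrite expr2 EFinM -muleA lee_wpmul2l//.
(* The exchange of order leaves e^{-W} alone in the inner integral, a tail that [hr] bounds. *)
rewrite -(tonelli_triangle mEk mEN Ek0 (fun x => expR_ge0 _)).
rewrite (ge0_integralZ_EFin (measurable_itv _) (measurable_funTS mk2) (fun x _ => sqr_ge0 _) C0').
apply: ge0_le_integral => //.
- move=> x _; rewrite mule_ge0 ?lee_fin//; apply: integral_ge0 => t _.
  by rewrite lee_fin expR_ge0.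
- apply: emeasurable_funM; first by apply/measurable_EFinP; exact: measurable_funTS.
  by apply: measurable_funTS; apply: measurable_integral_ge => // t; exact: expR_ge0.
- by apply/measurable_EFinP; apply: measurable_funM => //; exact: measurable_funTS.
move=> x /=; rewrite in_itv/= andbT => x0.
rewrite (le_trans (lee_wpmul2l _ (hr _ x0))) ?lee_fin//.
rewrite le_eqVlt; apply/orP; left; apply/eqP.
transitivity (C * k x ^+ 2 * (expR (W x) * expR (- W x))); first by ring.
by rewrite -expRD subrr expR0 mulr1.
Qed.

(** The transposed kernel, with a multiplier at the outer variable: [m] stays outside the tail
    integral and comes inside the integral from 0 after Tonelli's exchange. It is 1 for the solution
    operator and |U'| for U' times that operator. *)
Lemma hardy_right W m (C : R) k P : continuous W -> 0 < C ->
  (forall x, 0 <= m x) -> measurable_fun (setT : set RT) m ->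
  (forall y, 0 <= y -> (\int[mu]_(t in `[0%R, y]) (m t * expR (W t))%:E <= (C * expR (W y))%:E)%E) ->
  (forall y, 0 <= y -> (\int[mu]_(t in `[y, +oo[) (m y * expR (- W t))%:E <= (C * expR (- W y))%:E)%E) ->
  measurable_fun (setT : set RT) k -> (forall x, 0 <= k x) ->
  measurable_fun (setT : set RT) P -> (forall x, 0 <= P x) ->
  (forall x, 0 <= x ->
    ((P x)%:E <= \int[mu]_(t in `[x, +oo[) (m x * expR (W x - W t) * k t)%:E)%E) ->
  (\int[mu]_(x in `[0%R, +oo[) (P x ^+ 2)%:E <=
    (C ^+ 2)%:E * \int[mu]_(x in `[0%R, +oo[) (k x ^+ 2)%:E)%E.
Proof.
move=> cW C0 m0 mm hl hr mk k0 mP P0 hP.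
have cE : continuous (fun x => expR (W x)).
  by move=> x; apply: continuous_comp; [exact: cW|exact: continuous_expR].
have cEN : continuous (fun x => expR (- W x)).
  by move=> x; apply: continuous_comp; [exact/continuousN/cW|exact: continuous_expR].
have mE : measurable_fun (setT : set RT) (fun x => expR (W x)) by exact: continuous_measurable_fun.
have mEN : measurable_fun (setT : set RT) (fun x => expR (- W x)) by exact: continuous_measurable_fun.
have mk2 : measurable_fun (setT : set RT) (fun x => k x ^+ 2) by exact: measurable_funX.
have mEk : measurable_fun (setT : set RT) (fun x => expR (- W x) * k x ^+ 2).
  exact: measurable_funM.
have mmE : measurable_fun (setT : set RT) (fun x => m x * expR (W x)).
  exact: measurable_funM.
have mE0 x : 0 <= m x * expR (W x) by rewrite mulr_ge0 ?expR_ge0.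
have Ek0 x : 0 <= expR (- W x) * k x ^+ 2 by rewrite mulr_ge0 ?expR_ge0 ?sqr_ge0.
have C0' := ltW C0.
pose J x := (\int[mu]_(t in `[x, +oo[) (expR (- W t) * k t ^+ 2)%:E)%E.
have bound x : 0 <= x -> ((P x ^+ 2)%:E <= C%:E * ((m x * expR (W x))%:E * J x))%E.
  move=> x0.
  have mw : measurable_fun (`[x, +oo[%classic : set RT) (fun t => m x * expR (W x) * expR (- W t)).
    by apply: measurable_funM => //; exact: measurable_funTS.
  have := @cauchy_schwarz_weight `[x, +oo[%classic (fun t => m x * expR (W x) * expR (- W t)) k C (P x).
  move=> /(_ (measurable_itv _) mw (measurable_funTS mk)) H.
  apply: le_trans (H _ k0 C0 (P0 x) _ _) _.
  - by move=> t; rewrite mulr_ge0 ?expR_ge0.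
  - under eq_integral do rewrite mulrAC [_ * expR (W x)]mulrC.
    rewrite -ge0_integralZ_EFin ?expR_ge0//.
      rewrite (le_trans (lee_wpmul2l _ (hr _ x0))) ?lee_fin ?expR_ge0//.
      by rewrite mulrCA -expRD subrr expR0 mulr1.
    by apply: measurable_funM => //; exact: measurable_funTS.
    by move=> t _; rewrite mulr_ge0 ?expR_ge0.
  - rewrite (le_trans (hP _ x0))// le_eqVlt; apply/orP; left; apply/eqP.
    by apply: eq_integral => t _; rewrite expRD !mulrA.
  rewrite lee_wpmul2l ?lee_fin// /J.
  rewrite (ge0_integralZ_EFin (measurable_itv _) (measurable_funTS mEk) (fun t _ => Ek0 t) (mE0 x)).
  rewrite le_eqVlt; apply/orP; left; apply/eqP.
  by apply: eq_integral => t _; rewrite -mulrA.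
have mEJ : measurable_fun (`[0, +oo[%classic : set RT) (fun x => ((m x * expR (W x))%:E * J x)%E).
  apply: emeasurable_funM; first by apply/measurable_EFinP; exact: measurable_funTS.
  by apply: measurable_funTS; exact: measurable_integral_ge.
have mJ : measurable_fun (`[0, +oo[%classic : set RT) (fun x => C%:E * ((m x * expR (W x))%:E * J x))%E.
  exact: measurable_funeM.
have mP2 : measurable_fun (`[0, +oo[%classic : set RT) (fun x => P x ^+ 2).
  by apply: measurable_funTS; exact: measurable_funX.
have J0 x : (0 <= J x)%E by apply: integral_ge0 => t _; rewrite lee_fin.
apply: (@le_trans _ _ (\int[mu]_(x in `[0%R, +oo[) (C%:E * ((m x * expR (W x))%:E * J x)))%E).
  apply: (ge0_le_integral_EFin (measurable_itv _) mP2 mJ).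
    by move=> x _; rewrite sqr_ge0.
  by move=> x /=; rewrite in_itv/= andbT => x0; exact: bound.
have EJ0 x : (0 <= (m x * expR (W x))%:E * J x)%E by rewrite mule_ge0// lee_fin.
have C0e : (0 <= C%:E)%E by rewrite lee_fin.
rewrite (ge0_integralZl mu (measurable_itv _) mEJ (fun x _ => EJ0 x) C0e).
rewrite expr2 EFinM -muleA lee_wpmul2l//.
rewrite (tonelli_triangle mmE mEk mE0 Ek0).
rewrite (ge0_integralZ_EFin (measurable_itv _) (measurable_funTS mk2) (fun x _ => sqr_ge0 _) C0').
apply: ge0_le_integral => //.
- move=> x _; rewrite mule_ge0 ?lee_fin//; apply: integral_ge0 => t _.
  by rewrite lee_fin.
- apply: emeasurable_funM; first by apply/measurable_EFinP; exact: measurable_funTS.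
  by apply: measurable_funTS; exact: measurable_integral_le.
- by apply/measurable_EFinP; apply: measurable_funM => //; exact: measurable_funTS.
move=> x /=; rewrite in_itv/= andbT => x0.
rewrite (le_trans (lee_wpmul2l _ (hl _ x0))) ?lee_fin//.
rewrite le_eqVlt; apply/orP; left; apply/eqP.
transitivity (C * k x ^+ 2 * (expR (W x) * expR (- W x))); first by ring.
by rewrite -expRD subrr expR0 mulr1.
Qed.

End hardy.

(** * Solution operators on the half-lines *)

Section reflection.
Context {R : realType}.
Local Notation mu := (@lebesgue_measure R).
Local Notation RT := (measurableTypeR R).
Local Notation Re := (@complex.Re R).
Local Notation Im := (@complex.Im R).

Lemma measurable_oppR : measurable_fun (setT : set RT) (-%R : RT -> RT).
Proof. by apply: continuous_measurable_fun; exact: opp_continuous. Qed.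

Lemma measurable_reflect (k : R -> R) : measurable_fun (setT : set RT) k ->
  measurable_fun (setT : set RT) (fun x => k (- x)).
Proof. by move=> mk; exact: (measurableT_comp mk measurable_oppR). Qed.

Lemma ge0_integral_reflect (D : set RT) (f : R -> R) : measurable D ->
  measurable_fun (setT : set RT) f -> (forall x, 0 <= f x) ->
  (\int[mu]_(x in (fun x : R => (- x)%R) @^-1` D) (f (- x)%R)%:E
    = \int[mu]_(x in D) (f x)%:E)%E.
Proof.
move=> mD mf f0.
rewrite -(@ge0_integral_pushforward _ _ RT RT R (-%R : RT -> RT) measurable_oppR mu D (EFin \o f))//.
- by apply: eq_measure_integral => //= A mA AS; exact: lebesgue_measureN.
- by apply/measurable_EFinP; exact: measurable_funTS.
- by move=> x _; rewrite /= lee_fin.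
Qed.

(** The nonnegative case is applied to the positive and negative parts. *)
Lemma Rintegral_reflect (f : R -> R) a b : measurable_fun (setT : set RT) f ->
  \int[mu]_(x in `[- b, - a]) f (- x) = \int[mu]_(x in `[a, b]) f x.
Proof.
move=> mf; rewrite /Rintegral; congr fine.
have E : `[- b, - a]%classic = (fun x : R => - x) @^-1` `[a, b]%classic.
  by apply/seteqP; split => x /=; rewrite !in_itv/= lerNl lerNr andbC.
have mr := measurable_reflect mf.
have mp (k : R -> R) : measurable_fun (setT : set RT) k ->
    measurable_fun (setT : set RT) (fun x => Num.max (k x) 0).
  by move=> mk; apply: measurable_maxr.
have mn (k : R -> R) : measurable_fun (setT : set RT) k ->
    measurable_fun (setT : set RT) (fun x => Num.max (- k x) 0).
  by move=> mk; apply: mp; exact: measurableT_comp.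
rewrite integralE [RHS]integralE; congr (_ - _)%E.
- transitivity (\int[mu]_(x in `[(- b)%R, (- a)%R]) ((fun x => Num.max (f x) 0) (- x))%R%:E)%E.
    by apply: eq_integral => x _; rewrite funeposE -EFin_max.
  rewrite E (@ge0_integral_reflect _ (fun x => Num.max (f x) 0))//;
    [|exact: mp|by move=> x; rewrite le_max lexx orbT].
  by apply: eq_integral => x _; rewrite funeposE -EFin_max.
- transitivity (\int[mu]_(x in `[(- b)%R, (- a)%R]) ((fun x => Num.max (- f x) 0) (- x))%R%:E)%E.
    by apply: eq_integral => x _; rewrite funenegE -EFinN -EFin_max.
  rewrite E (@ge0_integral_reflect _ (fun x => Num.max (- f x) 0))//;
    [|exact: mn|by move=> x; rewrite le_max lexx orbT].
  by apply: eq_integral => x _; rewrite funenegE -EFinN -EFin_max.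
Qed.

Lemma integrable_reflect (f : R -> R) a b : measurable_fun (setT : set RT) f ->
  mu.-integrable `[a, b] (EFin \o f) ->
  mu.-integrable `[- b, - a] (EFin \o (fun x => f (- x))).
Proof.
move=> mf /integrableP[_ fi]; apply/integrableP; split.
  by apply/measurable_EFinP; apply: measurable_funTS; exact: measurable_reflect.
have E : `[- b, - a]%classic = (fun x : R => - x) @^-1` `[a, b]%classic.
  by apply/seteqP; split => x /=; rewrite !in_itv/= lerNl lerNr andbC.
apply: le_lt_trans fi; rewrite E.
rewrite -(@ge0_integral_reflect _ (fun x => `|f x|))//.
exact: measurableT_comp.
Qed.

Lemma ac_reflect (f g : R -> R) : ac f g ->
  ac (fun x => f (- x)) (fun x => - g (- x)).
Proof.
move=> [lg fg]; have mg : measurable_fun (setT : set RT) g by case: lg.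
have lr : locally_integrable setT (fun x => g (- x)).
  apply: locally_integrableP => [|M M0]; first exact: measurable_reflect.
  rewrite -{2}(opprK M); apply: integrable_reflect => //.
  exact: locally_integrable_itv.
split; first exact: locally_integrableN.
move=> a b ab; under eq_Rintegral do rewrite -mulN1r.
rewrite RintegralZl//; last exact: locally_integrable_itv.
have := Rintegral_reflect (- b) (- a) mg; rewrite !opprK => ->.
by rewrite -fg ?lerN2//; ring.
Qed.

Lemma cac_reflect (f g : R -> R[i]) : cac f g ->
  cac (fun x => f (- x)) (fun x => - g (- x)).
Proof.
move=> [r i]; split.
  by apply: ac_eq (ac_reflect r) _ _ => x //=; rewrite cReN.
by apply: ac_eq (ac_reflect i) _ _ => x //=; rewrite cImN.
Qed.

Lemma cintegral_reflect (f : R -> R[i]) a b : cmeasurable f ->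
  cintegral `[- b, - a] (fun x => f (- x)) = cintegral `[a, b] f.
Proof.
move=> [mr mi]; apply: complexP => /=.
  exact: (Rintegral_reflect _ _ mr).
exact: (Rintegral_reflect _ _ mi).
Qed.

Lemma ae_reflect (P : R -> Prop) : {ae mu, forall x, P x} ->
  {ae mu, forall x, P (- x)}.
Proof.
move=> [A [mA A0 PA]]; exists ((fun x : RT => - x : RT) @^-1` A); split.
- by rewrite -[X in measurable X]setTI; exact: measurable_oppR.
- by have := lebesgue_measureN mA; rewrite /pushforward => ->.
- by move=> x /= Px; exact: PA.
Qed.

Lemma integrable_tail0 (g : R -> R) : mu.-integrable `[0, +oo[ (EFin \o g) ->
  forall e, 0 < e -> exists2 N, 0 <= N & \int[mu]_(x in `[N, +oo[) `|g x| <= e.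
Proof.
move=> Ig e e0.
have mg := measurable_integrable_EFin Ig.
pose f_ n := EFin \o (fun x => `|g x| * \1_(`[n%:R, +oo[%classic) x).
have mf_ n : measurable_fun (`[0, +oo[%classic : set RT) (f_ n).
  apply/measurable_EFinP; apply: measurable_funM; first exact: measurableT_comp.
  exact: measurable_indic.
have m0 : measurable_fun (`[0, +oo[%classic : set RT) (cst 0%E : RT -> \bar R) by [].
have [] := @dominated_convergence _ _ _ mu _ (measurable_itv _) f_ (cst 0%E) (abse \o (EFin \o g)) mf_ m0.
- apply: aeW => x _; apply: cvg_near_cst; near=> n.
  rewrite /f_/= indicE memNset ?mulr0//= in_itv/= andbT; apply/negP; rewrite -ltNge.
  by near: n; exact: nbhs_infty_gtr.
- exact: integrable_abse.
- apply: aeW => x n _ /=; rewrite lee_fin normrM normr_id ler_piMr// ger0_norm ?indicE//.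
  by case: (_ \in _); rewrite ?ler01.
move=> _ _; rewrite integral0_eq; last by [].
move=> /fine_cvgP[_] /cvgrPdist_le /(_ e e0) [N _ /(_ N (leqnn N))].
rewrite /= sub0r normrN => h; exists N%:R => //.
apply: le_trans h; rewrite le_eqVlt; apply/orP; left; apply/eqP.
rewrite ger0_norm; last first.
  by apply: fine_ge0; apply: integral_ge0 => x _; rewrite lee_fin mulr_ge0// indicE.
rewrite /Rintegral; congr fine; rewrite [LHS]integral_mkcond [RHS]integral_mkcond.
apply: eq_integral => x _; rewrite !patchE /f_/= indicE.
have [xN|xN] := boolP (x \in `[N%:R, +oo[%classic); last first.
  by case: ifP => // _; rewrite mulr0.
rewrite mem_set ?mulr1//.
by move: xN; rewrite inE/= !in_itv/= !andbT; apply: le_trans.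
Unshelve. all: by end_near. Qed.

Lemma Rintegral_itvy_split (g : R -> R) x y : x <= y ->
  mu.-integrable `[x, +oo[ (EFin \o g) ->
  \int[mu]_(t in `[x, +oo[) g t =
  \int[mu]_(t in `[x, y]) g t + \int[mu]_(t in `[y, +oo[) g t.
Proof.
move=> xy Ig; have := @Rintegral_itvB _ g (BLeft x) (BInfty _ false) y Ig.
rewrite !bnd_simp => /(_ xy isT); rewrite Rintegral_itv_obnd_cbnd.
  by move=> <-; rewrite addrC subrK.
by apply: integrableS Ig => //; apply: subset_itvr; rewrite bnd_simp.
Qed.

(** G y plus the tail of g from y is a constant l. If l were not 0, |G| would be at least |l| / 2
    near infinity, where the tail is small, and G would not be integrable. Square integrability
    selects the solution on the right in this way. *)
Lemma ac_tail (G g : R -> R) : ac G g -> mu.-integrable `[0, +oo[ (EFin \o G) ->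
  mu.-integrable `[0, +oo[ (EFin \o g) ->
  forall x, 0 <= x -> G x = - \int[mu]_(t in `[x, +oo[) g t.
Proof.
move=> Gg IG Ig x x0.
have Iy (k : R -> R) y : 0 <= y -> mu.-integrable `[0, +oo[ (EFin \o k) ->
    mu.-integrable `[y, +oo[ (EFin \o k).
  by move=> y0 Ik; apply: integrableS Ik => //; apply: subset_itvr; rewrite bnd_simp.
pose l := G x + \int[mu]_(t in `[x, +oo[) g t.
have lE y : x <= y -> l = G y + \int[mu]_(t in `[y, +oo[) g t.
  move=> xy; rewrite /l (Rintegral_itvy_split xy) ?(acE Gg xy) ?addrA//.
  exact: Iy.
suff l0 : l = 0 by apply/eqP; rewrite -addr_eq0; exact/eqP.
apply/eqP/negPn/negP => ln0.
have lp : 0 < `|l| / 2 by rewrite divr_gt0// normr_gt0.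
have [N N0 hN] := integrable_tail0 Ig lp.
pose M := Num.max x N.
have M0 : 0 <= M by rewrite le_max x0.
have big y : M <= y -> `|l| / 2 <= `|G y|.
  rewrite ge_max => /andP[xy Ny].
  have y0 := le_trans x0 xy.
  have Igy := Iy _ _ y0 Ig.
  have : `|\int[mu]_(t in `[y, +oo[) g t| <= `|l| / 2.
    rewrite (le_trans (le_normr_Rintegral _ Igy))//.
    rewrite (le_trans _ hN)// (Rintegral_itvy_split Ny).
      by rewrite lerDr Rintegral_ge0.
    by apply: (Iy (fun x => `|g x|)) => //; exact: integrable_norm.
  have := ler_normD (G y) (\int[mu]_(t in `[y, +oo[) g t).
  by rewrite -(lE _ xy); lra.
have IGM : mu.-integrable `[M, +oo[ (EFin \o G) by exact: Iy.
have /integrableP[_] := IGM; apply/negP; rewrite -leNgt.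
apply: (@le_trans _ _ (\int[mu]_(y in `[M, +oo[) (`|l| / 2)%:E)%E).
  rewrite integral_cst//= lebesgue_measure_itv/= ltry.
  by rewrite /= mulry gtr0_sg// mul1e.
have mc : measurable_fun (`[M, +oo[%classic : set RT) (fun _ : R => `|l| / 2).
  exact: measurable_cst.
have mG : measurable_fun (`[M, +oo[%classic : set RT) (fun y => `|(EFin \o G) y|%E).
  by apply: measurableT_comp => //; exact: (measurable_int mu IGM).
apply: (ge0_le_integral_EFin (measurable_itv _) mc mG) => y /=.
  by move=> _; exact: ltW.
by rewrite in_itv/= andbT => My; rewrite lee_fin big.
Qed.

Lemma integrable_ae_eq (D : set RT) (g g1 : R -> R) : measurable D ->
  measurable_fun D g -> mu.-integrable D (EFin \o g1) ->
  {ae mu, forall x, D x -> g x = g1 x} -> mu.-integrable D (EFin \o g).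
Proof.
move=> mD mg /integrableP[mg1 Ig1] e; apply/integrableP; split.
  exact/measurable_EFinP.
rewrite (@ge0_ae_eq_integral _ _ _ mu D _ (abse \o (EFin \o g1)))//.
- by do 2 apply: measurableT_comp => //.
- exact: measurableT_comp.
- by move=> x _; exact: abse_ge0.
- by apply: ae_imp e => x /= h Dx; rewrite h.
Qed.

(** [g1] is the derivative as the equation gives it: known almost everywhere, and only on the
    half-line. *)
Lemma cac_tail (G g g1 : R -> R[i]) : cac G g -> cintegrable `[0, +oo[ G ->
  cintegrable `[0, +oo[ g1 -> {ae mu, forall x, 0 <= x -> g x = g1 x} ->
  forall x, 0 <= x -> G x = - cintegral `[x, +oo[ g1.
Proof.
move=> [Gr Gi] [IGr IGi] [Ir Ii] e x x0.
have real_case (F k k1 : R -> R) : ac F k -> mu.-integrable `[0, +oo[ (EFin \o F) ->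
    mu.-integrable `[0, +oo[ (EFin \o k1) -> {ae mu, forall x, 0 <= x -> k x = k1 x} ->
    F x = - \int[mu]_(t in `[x, +oo[) k1 t.
  move=> Fk IF Ik1 ek; have [[mk _ _] _] := Fk.
  have ek' : {ae mu, forall y, `[0, +oo[%classic y -> k y = k1 y}.
    by apply: ae_imp ek => y h /=; rewrite in_itv/= andbT.
  have Ik := integrable_ae_eq (measurable_itv _) (measurable_funTS mk) Ik1 ek'.
  rewrite (ac_tail Fk IF Ik x0); congr (- _).
  have sub : `[x, +oo[%classic `<=` (`[0, +oo[%classic : set RT).
    by apply: subset_itvr; rewrite bnd_simp.
  apply: ae_eq_Rintegral => //.
  - exact: measurable_funTS.
  - exact: (measurable_funS (measurable_itv _) sub (measurable_integrable_EFin Ik1)).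
  - by apply: ae_imp ek' => y h /sub.
apply: complexP; rewrite ?cReN ?cImN /=.
  by apply: real_case Gr IGr Ir _; apply: ae_imp e => y h y0 /=; rewrite h.
by apply: real_case Gi IGi Ii _; apply: ae_imp e => y h y0 /=; rewrite h.
Qed.

Lemma norm_Re_normc (z : R[i]) : `|Re z| <= Normc.normc z.
Proof.
rewrite normc_sqnorm -sqrtr_sqr ler_wsqrtr// /sqnorm lerDl sqr_ge0//.
Qed.

Lemma norm_Im_normc (z : R[i]) : `|Im z| <= Normc.normc z.
Proof.
rewrite normc_sqnorm -sqrtr_sqr ler_wsqrtr// /sqnorm lerDr sqr_ge0//.
Qed.

Lemma normc_ge0 (z : R[i]) : 0 <= Normc.normc z.
Proof. by rewrite normc_sqnorm sqrtr_ge0. Qed.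

Lemma normc_le_ReIm (z : R[i]) : Normc.normc z <= `|Re z| + `|Im z|.
Proof.
rewrite -ler_sqr ?nnegrE ?normc_ge0 ?addr_ge0// sqr_normc_sqnorm /sqnorm.
rewrite sqrrD !real_normK ?num_real//.
have : 0 <= `|Re z| * `|Im z| by rewrite mulr_ge0.
by rewrite -addrA; lra.
Qed.

Lemma measurable_normc (D : set RT) (f : R -> R[i]) : measurable_fun D (Re \o f) ->
  measurable_fun D (Im \o f) -> measurable_fun D (fun x => Normc.normc (f x)).
Proof.
move=> mr mi; rewrite (_ : (fun x => _) = (fun x => Num.sqrt (Re (f x) ^+ 2 + Im (f x) ^+ 2))).
  apply: measurableT_comp; last by apply: measurable_funD; exact: measurable_funX.
  by apply: continuous_measurable_fun; exact: sqrt_continuous.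
by apply/funext => x; rewrite normc_sqnorm.
Qed.

(* The constant 2 is not optimal, but spares the rotation argument. *)
Lemma normc_cintegral (D : set RT) (f : R -> R[i]) : measurable D -> cintegrable D f ->
  ((Normc.normc (cintegral D f))%:E <= \int[mu]_(x in D) (2 * Normc.normc (f x))%:E)%E.
Proof.
move=> mD [rf im_f].
have mr := measurable_integrable_EFin rf; have mi := measurable_integrable_EFin im_f.
have mn := measurable_normc mr mi.
have part (k : R -> R) : mu.-integrable D (EFin \o k) ->
    (forall x, `|k x| <= Normc.normc (f x)) ->
    ((`|\int[mu]_(x in D) k x|)%:E <= \int[mu]_(x in D) (Normc.normc (f x))%:E)%E.
  move=> Ik kf; rewrite EFin_normr_Rintegral//.
  rewrite (le_trans (le_abse_integral mu mD (measurable_int mu Ik)))//.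
  apply: ge0_le_integral => //.
  - apply: measurableT_comp => //; exact: (measurable_int mu Ik).
  - exact/measurable_EFinP.
  - by move=> x _; rewrite lee_fin.
apply: (@le_trans _ _ ((`|Re (cintegral D f)| + `|Im (cintegral D f)|)%:E)).
  by rewrite lee_fin normc_le_ReIm.
rewrite -(ge0_integralZ_EFin mD mn (fun x _ => normc_ge0 _)) ?ler0n//.
rewrite (_ : 2%:E = 1%:E + 1%:E)%E; last by rewrite -EFinD.
rewrite ge0_muleDl ?lee_fin// mul1e EFinD leeD//.
  by apply: (part (Re \o f)) => // x; exact: norm_Re_normc.
by apply: (part (Im \o f)) => // x; exact: norm_Im_normc.
Qed.

Lemma cintegrable_normc (D : set RT) (f : R -> R[i]) (k : R -> R) : measurable D ->
  measurable_fun D (Re \o f) -> measurable_fun D (Im \o f) ->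
  mu.-integrable D (EFin \o k) -> (forall x, D x -> Normc.normc (f x) <= k x) ->
  cintegrable D f.
Proof.
move=> mD mr mi Ik fk; split; apply: le_integrable_EFin Ik => // x Dx.
  exact: le_trans (norm_Re_normc _) (fk x Dx).
exact: le_trans (norm_Im_normc _) (fk x Dx).
Qed.

End reflection.

(** * Energy on the half-line *)

Section half_line.
Context {R : realType} (U : R -> R).
Local Notation mu := (@lebesgue_measure R).
Local Notation RT := (measurableTypeR R).
Local Notation Re := (@complex.Re R).
Local Notation Im := (@complex.Im R).
Local Notation normc := (@Normc.normc R).
Local Notation U' := (derive1 U).
Local Notation half := (`[0%R, +oo[%classic : set RT).
Hypothesis dU : forall x, is_derive x (1 : R) U (U' x).
Hypothesis cU' : continuous U'.
Implicit Types (f g : R -> R[i]) (z w : R[i]).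

Let cU : continuous U.
Proof.
by move=> x; apply/differentiable_continuous/derivable1_diffP; have [] := dU x.
Qed.

Lemma sqnormM z w : sqnorm (z * w) = sqnorm z * sqnorm w.
Proof. by rewrite /sqnorm cReM cImM; ring. Qed.

Lemma sqnormD z w : sqnorm (z + w) <= 2 * sqnorm z + 2 * sqnorm w.
Proof.
rewrite /sqnorm cReD cImD -subr_ge0.
rewrite (_ : _ - _ = (Re z - Re w) ^+ 2 + (Im z - Im w) ^+ 2); last by ring.
by rewrite addr_ge0 ?sqr_ge0.
Qed.

Lemma cmeasurableD f g : cmeasurable f -> cmeasurable g ->
  cmeasurable (fun x => f x + g x).
Proof.
move=> [rf im_f] [rg im_g]; split.
  rewrite (_ : _ \o _ = (Re \o f) \+ (Re \o g)); first exact: measurable_funD.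
  by apply/funext => x /=; rewrite cReD.
rewrite (_ : _ \o _ = (Im \o f) \+ (Im \o g)); first exact: measurable_funD.
by apply/funext => x /=; rewrite cImD.
Qed.

Lemma cmeasurableM f g : cmeasurable f -> cmeasurable g ->
  cmeasurable (fun x => f x * g x).
Proof.
move=> [rf im_f] [rg im_g]; split.
  rewrite (_ : _ \o _ = ((Re \o f) \* (Re \o g)) \- ((Im \o f) \* (Im \o g))).
    by apply: measurable_funB; exact: measurable_funM.
  by apply/funext => x /=; rewrite cReM.
rewrite (_ : _ \o _ = ((Re \o f) \* (Im \o g)) \+ ((Im \o f) \* (Re \o g))).
  by apply: measurable_funD; exact: measurable_funM.
by apply/funext => x /=; rewrite cImM.
Qed.

Lemma cmeasurable_cst z : cmeasurable (fun=> z).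
Proof. by split; exact: measurable_cst. Qed.

Lemma cmeasurable_real (k : R -> R) : measurable_fun (setT : set RT) k ->
  cmeasurable (fun x => (k x)%:C).
Proof. by move=> mk; split => //; exact: measurable_cst. Qed.

Lemma cmeasurableN f : cmeasurable f -> cmeasurable (fun x => - f x).
Proof.
move=> mf; rewrite (_ : (fun x => _) = (fun x => (- 1) * f x)).
  by apply: cmeasurableM => //; exact: cmeasurable_cst.
by apply/funext => x; rewrite mulN1r.
Qed.

Lemma cmeasurable_reflect f : cmeasurable f -> cmeasurable (fun x => f (- x)).
Proof. by move=> [mr mi]; split; [exact: (measurable_reflect mr)|exact: (measurable_reflect mi)]. Qed.

Lemma cac_cmeasurable f g : cac f g -> cmeasurable f.
Proof.
by move=> [r i]; split; apply: continuous_measurable_fun;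
  [exact: ac_continuous r|exact: ac_continuous i].
Qed.

Lemma clocal_cmeasurable f : clocally_integrable f -> cmeasurable f.
Proof. by move=> [[r _ _] [i _ _]]; split. Qed.

(** The left half-line enters as the half-energy of the reflected function, which is possible
    because U is even; see [energy_split]. *)
Definition half_energy f : \bar R :=
  (\int[mu]_(x in `[0%R, +oo[) (sqnorm (f x) * expR (- U x))%:E)%E.

Local Notation H2 := half_energy.

Lemma half_energy_ge0 f : (0 <= H2 f)%E.
Proof. by apply: integral_ge0 => x _; rewrite lee_fin mulr_ge0 ?sqnorm_ge0 ?expR_ge0. Qed.

Lemma energy_split f : (forall x, U x = U (- x)) -> cmeasurable f ->
  energy U f = (H2 f + H2 (fun x => f (- x)%R))%E.
Proof.
move=> Uev mf; have me := measurable_energy cU mf.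
have e0 x : (0 <= (sqnorm (f x) * expR (- U x))%:E)%E.
  by rewrite lee_fin mulr_ge0 ?sqnorm_ge0 ?expR_ge0.
have E : [set: RT] = `]-oo, 0%R]%classic `|` `]0%R, +oo[%classic.
  apply/esym/seteqP; split => // x _.
  by have [x0|x0] := leP x 0; [left|right]; rewrite /= in_itv/= ?andbT.
rewrite /energy E ge0_integral_setU//=.
- rewrite addeC integral_itv_obnd_cbnd; last first.
    by apply/measurable_EFinP; exact: measurable_funTS.
  congr (_ + _)%E.
  pose phi (x : R) := (sqnorm (f (- x)) * expR (- U x))%:E.
  have mphi : measurable_fun (setT : set RT) phi.
    apply/measurable_EFinP; rewrite (_ : (fun x => _) =
      (fun x => (fun y => sqnorm (f y) * expR (- U y)) (- x))).
      exact: (measurable_reflect me).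
    by apply/funext => x /=; rewrite -Uev.
  have phi0 x : (0 <= phi x)%E by rewrite lee_fin mulr_ge0 ?sqnorm_ge0 ?expR_ge0.
  rewrite /half_energy (ge0_integration_by_substitution0 mphi phi0).
  by apply: eq_integral => x _; rewrite /phi opprK -Uev.
- by rewrite -E; exact/measurable_EFinP.
- rewrite disj_set2E; apply/eqP/seteqP; split => // x /=; rewrite !in_itv/= andbT => -[x0].
  by rewrite ltNge x0.
Qed.

(** The modulus after the isometry from L^2(nu) to L^2(dx); Schur's test is applied to this
    function. *)
Definition nrm f (x : R) : R := normc (f x) * expR (- (U x / 2)).

Lemma nrm_ge0 f x : 0 <= nrm f x.
Proof. by rewrite mulr_ge0 ?normc_ge0 ?expR_ge0. Qed.

Lemma sqr_nrm f x : nrm f x ^+ 2 = sqnorm (f x) * expR (- U x).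
Proof.
rewrite exprMn sqr_normc_sqnorm; congr (_ * _).
by rewrite expr2 -expRD; congr expR; field.
Qed.

Lemma measurable_nrm f : cmeasurable f -> measurable_fun (setT : set RT) (nrm f).
Proof.
move=> [mr mi]; apply: measurable_funM; first exact: measurable_normc.
apply: continuous_measurable_fun => x.
apply: continuous_comp; last exact: continuous_expR.
apply: cvgN; apply: cvgM; [exact: cU|exact: cvg_cst].
Qed.

Lemma half_energyE f : H2 f = (\int[mu]_(x in `[0%R, +oo[) (nrm f x ^+ 2)%:E)%E.
Proof. by apply: eq_integral => x _; rewrite sqr_nrm. Qed.

Let m_energy (D : set RT) f : cmeasurable f ->
  measurable_fun D (fun x => sqnorm (f x) * expR (- U x)).
Proof. by move=> mf; apply: measurable_funTS; exact: measurable_energy. Qed.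

Let e_ge0 f x : 0 <= sqnorm (f x) * expR (- U x).
Proof. by rewrite mulr_ge0 ?sqnorm_ge0 ?expR_ge0. Qed.

Lemma half_energyZ z f : cmeasurable f ->
  H2 (fun x => z * f x) = ((sqnorm z)%:E * H2 f)%E.
Proof.
move=> mf; rewrite /half_energy.
rewrite (ge0_integralZ_EFin (measurable_itv _) (m_energy mf) (fun x _ => e_ge0 _ _) (sqnorm_ge0 z)).
by apply: eq_integral => x _; rewrite sqnormM mulrA.
Qed.

Lemma half_energyD_le f g f1 : cmeasurable f -> cmeasurable g -> cmeasurable f1 ->
  (forall x, 0 <= x -> sqnorm (f1 x) <= 2 * sqnorm (f x) + 2 * sqnorm (g x)) ->
  (H2 f1 <= 2%:E * H2 f + 2%:E * H2 g)%E.
Proof.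
move=> mf mg mf1 h; rewrite /half_energy.
rewrite !(ge0_integralZ_EFin (measurable_itv _) (m_energy _) (fun x _ => e_ge0 _ _) (ler0n _ 2))//.
have M2 k : cmeasurable k -> measurable_fun half (fun x => (2 * (sqnorm (k x) * expR (- U x)))%:E).
  by move=> mk; apply/measurable_EFinP; apply: measurable_funM => //; exact: m_energy.
have P2 k x : (0 <= (2 * (sqnorm (k x) * expR (- U x)))%:E)%E by rewrite lee_fin mulr_ge0.
rewrite -(ge0_integralD mu (measurable_itv _) (fun x _ => P2 f x) (M2 _ mf)
  (fun x _ => P2 g x) (M2 _ mg)).
apply: (ge0_le_integral_EFin (measurable_itv _) (m_energy mf1) (emeasurable_funD (M2 _ mf) (M2 _ mg))).
  by move=> x _.
move=> x /=; rewrite in_itv/= andbT => x0; rewrite lee_fin !mulrA -mulrDl.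
by rewrite ler_wpM2r ?expR_ge0// h.
Qed.

Lemma half_energyD f g : cmeasurable f -> cmeasurable g ->
  (H2 (fun x => f x + g x)%R <= 2%:E * H2 f + 2%:E * H2 g)%E.
Proof.
move=> mf mg; apply: half_energyD_le => //; first exact: cmeasurableD.
by move=> x _; exact: sqnormD.
Qed.

Lemma eq_half_energy f g : (forall x, 0 <= x -> f x = g x) -> H2 f = H2 g.
Proof.
move=> fg; apply: eq_integral => x; rewrite inE/= in_itv/= andbT => x0.
by rewrite fg.
Qed.

Lemma half_energyD_lty f g : cmeasurable f -> cmeasurable g ->
  (H2 f < +oo)%E -> (H2 g < +oo)%E -> (H2 (fun x => f x + g x)%R < +oo)%E.
Proof.
move=> mf mg Hf Hg; apply: le_lt_trans (half_energyD mf mg) _.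
by rewrite lte_add_pinfty// lte_mul_pinfty.
Qed.

Lemma half_energyZ_lty z f : cmeasurable f -> (H2 f < +oo)%E ->
  (H2 (fun x => z * f x)%R < +oo)%E.
Proof.
by move=> mf Hf; rewrite half_energyZ// lte_mul_pinfty// lee_fin sqnorm_ge0.
Qed.

End half_line.

(** * Homogeneous solutions, integrating factors and their integrability *)

Section resolvent_pieces.
Context {R : realType} (U : R -> R) (gamma : R[i]).
Local Notation mu := (@lebesgue_measure R).
Local Notation RT := (measurableTypeR R).
Local Notation Re := (@complex.Re R).
Local Notation normc := (@Normc.normc R).
Local Notation U' := (derive1 U).
Local Notation half := (`[0%R, +oo[%classic : set RT).
Local Notation H2 := (half_energy U).
Local Notation b := (Re gamma).
Hypothesis dU : forall x, is_derive x (1 : R) U (U' x).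
Hypothesis cU' : continuous U'.
Hypothesis U'_ge0 : forall x : R, 0 <= x -> 0 <= U' x.
Hypothesis U'_pinfty : U' x @[x --> +oo] --> +oo.
Implicit Types (f g h k K : R -> R[i]) (z w c : R[i]).

Let cU : continuous U.
Proof.
by move=> x; apply/differentiable_continuous/derivable1_diffP; have [] := dU x.
Qed.

(** [Ep] solves the homogeneous equation on the left and [EpU] solves r' = (gamma + U') r on the
    right; [En] and [EnU] are their inverses, used as integrating factors. [E2U] is the exponential
    in the integrand of [Zfun]. *)
Definition Ep (x : R) := cexp (gamma * x%:C).
Definition En (x : R) := cexp (- gamma * x%:C).
Definition EpU (x : R) := cexp (gamma * x%:C + (U x)%:C).
Definition EnU (x : R) := cexp (- gamma * x%:C - (U x)%:C).
Definition E2U (x : R) := cexp (- 2 * gamma * x%:C - (U x)%:C).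

Lemma Ep_En x : Ep x * En x = 1.
Proof. by rewrite -cexpD mulNr subrr cexp0. Qed.

Lemma EpU_EnU x : EpU x * EnU x = 1.
Proof.
by rewrite -cexpD (_ : _ + _ = 0) ?cexp0//; ring.
Qed.

Lemma EnU_En x : EnU x * En x = E2U x.
Proof. by rewrite -cexpD; congr cexp; ring. Qed.

Lemma EpU_E2U x : EpU x * E2U x = En x.
Proof. by rewrite -cexpD; congr cexp; ring. Qed.

Lemma En0 : En 0 = 1.
Proof. by rewrite /En (_ : _ * _ = 0) ?cexp0//; apply: mulr0. Qed.

Lemma Ep0 : Ep 0 = 1.
Proof. by rewrite /Ep (_ : _ * _ = 0) ?cexp0//; apply: mulr0. Qed.

Lemma EnN x : En (- x) = Ep x.
Proof. by congr cexp; rewrite rmorphN mulrNN. Qed.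

Lemma EpN x : Ep (- x) = En x.
Proof. by congr cexp; rewrite rmorphN mulrN mulNr. Qed.

Let dU0 x : is_derive x (1 : R) (fun=> 0 : R) (0 : R).
Proof. exact: is_derive_cst. Qed.

Let dNU x : is_derive x (1 : R) (fun y => - U y) (- U' x).
Proof. exact: (is_deriveN (dU x)). Qed.

Let cNU' : continuous (fun x => - U' x).
Proof. by move=> x; apply: cvgN; exact: cU'. Qed.

Let c0 : continuous (fun _ : R => 0 : R). Proof. by move=> x; exact: cvg_cst. Qed.

Lemma cac_Ep : cac Ep (fun x => gamma * Ep x).
Proof.
by apply: cac_eq (cac_cexp gamma dU0 c0) _ _ => x; rewrite /Ep !addr0.
Qed.

Lemma cac_En : cac En (fun x => - gamma * En x).
Proof.
by apply: cac_eq (cac_cexp (- gamma) dU0 c0) _ _ => x; rewrite /En !addr0.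
Qed.

Lemma cac_EpU : cac EpU (fun x => (gamma + (U' x)%:C) * EpU x).
Proof. exact: cac_cexp. Qed.

Lemma cac_EnU : cac EnU (fun x => (- gamma - (U' x)%:C) * EnU x).
Proof.
by apply: cac_eq (cac_cexp (- gamma) dNU cNU') _ _ => x; rewrite /EnU !rmorphN.
Qed.

Lemma cac_E2U : cac E2U (fun x => (- 2 * gamma - (U' x)%:C) * E2U x).
Proof.
by apply: cac_eq (cac_cexp (- 2 * gamma) dNU cNU') _ _ => x; rewrite /E2U !rmorphN.
Qed.

Lemma normc_Ep x : normc (Ep x) = expR (b * x).
Proof. by rewrite normc_cexp cReMr. Qed.

Lemma normc_En x : normc (En x) = expR (- (b * x)).
Proof. by rewrite normc_cexp cReMr cReN mulNr. Qed.

Lemma normc_EpU x : normc (EpU x) = expR (b * x + U x).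
Proof. by rewrite normc_cexp cReD cReMr. Qed.

Lemma normc_EnU x : normc (EnU x) = expR (- (b * x) - U x).
Proof. by rewrite normc_cexp cReD cReN cReMr cReN mulNr. Qed.

Lemma normc_E2U x : normc (E2U x) = expR (- weight U 1 (2 * b) x).
Proof.
rewrite -EnU_En Normc.normcM normc_EnU normc_En -expRD /weight.
by congr expR; ring.
Qed.

Local Notation W := (weight U 2^-1 b).

Let cW : continuous W. Proof. exact: continuous_weight. Qed.

Let nrm_cancel K x : normc (K x) = expR (U x / 2) * nrm U K x.
Proof. by rewrite /nrm mulrCA -expRD subrr expR0 mulr1. Qed.

Lemma normc_EnUM K x : normc (EnU x * K x) = expR (- W x) * nrm U K x.
Proof.
rewrite Normc.normcM normc_EnU nrm_cancel mulrA -expRD; congr (expR _ * _).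
by rewrite /weight; field.
Qed.

Lemma normc_EpM K x : normc (Ep x * K x) = expR (W x) * nrm U K x.
Proof.
rewrite Normc.normcM normc_Ep nrm_cancel mulrA -expRD; congr (expR _ * _).
by rewrite /weight; field.
Qed.

Lemma nrm_EpUM z x : nrm U (fun x => EpU x * z) x = expR (W x) * normc z.
Proof.
rewrite /nrm Normc.normcM normc_EpU mulrAC -expRD; congr (expR _ * _).
by rewrite /weight; field.
Qed.

Lemma nrm_EnM z x : nrm U (fun x => En x * z) x = expR (- W x) * normc z.
Proof.
rewrite /nrm Normc.normcM normc_En mulrAC -expRD; congr (expR _ * _).
by rewrite /weight; field.
Qed.

Let k12 : 0 < (2^-1 : R). Proof. by rewrite invr_gt0. Qed.

Lemma integrable_expN2W : mu.-integrable half
  (EFin \o (fun x => expR (- weight U 1 (2 * b) x))).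
Proof.
have [C C0 hC] := integral_weight_right dU cU' U'_ge0 U'_pinfty (2 * b) (@ltr01 R).
have [h _] := hC _ (lexx 0).
apply/integrableP; split.
  apply/measurable_EFinP; apply: measurable_funTS; apply: continuous_measurable_fun.
  exact: continuous_expRN_weight.
apply: (@le_lt_trans _ _ (C * expR (- weight U 1 (2 * b) 0))%:E); last exact: ltry.
by apply: le_trans h; under eq_integral do rewrite gee0_abs ?lee_fin ?expR_ge0//.
Qed.

Lemma integrable_U'expN2W : mu.-integrable half
  (EFin \o (fun x => `|U' x| * expR (- weight U 1 (2 * b) x))).
Proof.
have [C C0 hC] := integral_weight_right dU cU' U'_ge0 U'_pinfty (2 * b) (@ltr01 R).
have [_ h] := hC _ (lexx 0).
apply/integrableP; split.
  apply/measurable_EFinP; apply: measurable_funTS; apply: continuous_measurable_fun => x.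
  apply: cvgM; last exact: continuous_expRN_weight.
  by apply: cvg_norm; exact: cU'.
apply: (@le_lt_trans _ _ (C * expR (- weight U 1 (2 * b) 0))%:E); last exact: ltry.
by apply: le_trans h; under eq_integral do rewrite gee0_abs ?lee_fin ?mulr_ge0 ?expR_ge0//.
Qed.

Lemma cmeasurable_EnU : cmeasurable EnU. Proof. exact: cac_cmeasurable cac_EnU. Qed.
Lemma cmeasurable_En : cmeasurable En. Proof. exact: cac_cmeasurable cac_En. Qed.
Lemma cmeasurable_E2U : cmeasurable E2U. Proof. exact: cac_cmeasurable cac_E2U. Qed.

Lemma cintegrable_E2U : cintegrable half E2U.
Proof.
have [mr mi] := cmeasurable_E2U.
apply: (cintegrable_normc (k := fun x => expR (- weight U 1 (2 * b) x))) => //.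
- exact: measurable_funTS.
- exact: measurable_funTS.
- exact: integrable_expN2W.
- by move=> x _; rewrite normc_E2U.
Qed.

Lemma cintegrable_U'E2U : cintegrable half (fun x => (U' x)%:C * E2U x).
Proof.
have mU' : cmeasurable (fun x => (U' x)%:C).
  by apply: cmeasurable_real; exact: continuous_measurable_fun.
have [mr mi] := cmeasurableM mU' cmeasurable_E2U.
apply: (cintegrable_normc (k := fun x => `|U' x| * expR (- weight U 1 (2 * b) x))) => //.
- exact: measurable_funTS.
- exact: measurable_funTS.
- exact: integrable_U'expN2W.
- move=> x _; rewrite Normc.normcM normc_E2U normc_sqnorm /sqnorm/= expr0n addr0.
  by rewrite sqrtr_sqr.
Qed.

(** |En|^2 e^{-U} is the modulus of [E2U]. Hence the reflected homogeneous solution of the left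
    half-line has finite energy for every gamma. *)
Lemma half_energy_En : (H2 En < +oo)%E.
Proof.
have /integrableP[_ h] := integrable_expN2W; apply: le_lt_trans h.
rewrite half_energyE; rewrite le_eqVlt; apply/orP; left; apply/eqP.
apply: eq_integral => x _; rewrite gee0_abs ?lee_fin ?expR_ge0//; congr EFin.
have -> : nrm U En x = nrm U (fun y => En y * 1) x by rewrite /nrm mulr1.
rewrite nrm_EnM Normc.normc1 mulr1 expr2 -expRD; congr expR.
by rewrite /weight; field.
Qed.

Lemma integrable_nrm_sqr K : cmeasurable K -> (H2 K < +oo)%E ->
  mu.-integrable half (EFin \o (fun x => nrm U K x ^+ 2)).
Proof.
move=> mK HK; apply/integrableP; split.
  apply/measurable_EFinP; apply: measurable_funTS; apply: measurable_funX.
  exact: measurable_nrm.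
apply: le_lt_trans HK; rewrite half_energyE.
by under eq_integral do rewrite gee0_abs ?lee_fin ?sqr_ge0//.
Qed.

(** A product of two square-integrable functions, bounded by the sum of their squares. *)
Lemma integrable_expNW_nrm K : cmeasurable K -> (H2 K < +oo)%E ->
  mu.-integrable half (EFin \o (fun x => expR (- W x) * nrm U K x)).
Proof.
move=> mK HK.
have I := integrable_EFinD (measurable_itv _) integrable_expN2W (integrable_nrm_sqr mK HK).
apply: le_integrable_EFin I => //.
  apply: measurable_funTS; apply: measurable_funM; last exact: measurable_nrm.
  by apply: continuous_measurable_fun; exact: continuous_expRN_weight.
move=> x _; rewrite ger0_norm; last first.
  by apply: mulr_ge0; [exact: expR_ge0|exact: nrm_ge0].
have -> : expR (- weight U 1 (2 * b) x) = expR (- W x) ^+ 2.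
  by rewrite expr2 -expRD; congr expR; rewrite /weight; field.
have := expR_ge0 (- W x); have := nrm_ge0 U K x.
set u := expR _; set v := nrm _ _ _ => v0 u0; nra.
Qed.

Lemma cintegrable_EnUM K : cmeasurable K -> (H2 K < +oo)%E ->
  cintegrable half (fun x => EnU x * K x).
Proof.
move=> mK HK; have [mr mi] := cmeasurableM cmeasurable_EnU mK.
apply: (cintegrable_normc (k := fun x => expR (- W x) * nrm U K x)) => //.
- exact: measurable_funTS.
- exact: measurable_funTS.
- exact: integrable_expNW_nrm.
- by move=> x _; rewrite normc_EnUM.
Qed.

Lemma cintegrable_half_itvy f x : 0 <= x -> cintegrable half f ->
  cintegrable `[x, +oo[ f.
Proof.
by move=> x0; apply: cintegrableS => //; apply: subset_itvr; rewrite bnd_simp.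
Qed.

Lemma cintegral_itvy_split f x y : x <= y -> cintegrable `[x, +oo[ f ->
  cintegral `[x, +oo[ f = cintegral `[x, y] f + cintegral `[y, +oo[ f.
Proof.
by move=> xy [r i]; apply: complexP; rewrite ?cReD ?cImD /=; exact: Rintegral_itvy_split.
Qed.

(** Cauchy-Schwarz for the finite measure e^{-2W} dx on the half-line: integration against [EnU] is
    a bounded functional on L^2(nu). The factor 4 is the square of the 2 in [normc_cintegral]. *)
Lemma sqnorm_cintegral_EnUM : exists2 C : R, 0 <= C & forall K, cmeasurable K ->
  (H2 K < +oo)%E ->
  ((sqnorm (cintegral half (fun x => EnU x * K x)%R))%:E <= C%:E * H2 K)%E.
Proof.
have [C C0 hC] := integral_weight_right dU cU' U'_ge0 U'_pinfty (2 * b) (@ltr01 R).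
have [h _] := hC _ (lexx 0).
set A := C * expR _ in h.
have A0 : 0 < A by rewrite mulr_gt0 ?expR_gt0.
exists (A * 4); first by rewrite mulr_ge0// ltW.
move=> K mK HK; rewrite -sqr_normc_sqnorm.
have mn : measurable_fun half (nrm U K) by apply: measurable_funTS; exact: measurable_nrm.
have mW (k0 d : R) : measurable_fun half (fun x => expR (- weight U k0 d x)).
  by apply: measurable_funTS; apply: continuous_measurable_fun; exact: continuous_expRN_weight.
have mWp : measurable_fun half (fun x => expR (W x)).
  by apply: measurable_funTS; apply: continuous_measurable_fun; exact: continuous_expR_weight.
have mq : measurable_fun half (fun x => expR (W x) * (2 * nrm U K x)).
  by do 2 apply: measurable_funM => //.
have wE x : expR (- weight U 1 (2 * b) x) = expR (- W x) * expR (- W x).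
  by rewrite -expRD; congr expR; rewrite /weight; field.
have := @cauchy_schwarz_weight _ half (fun x => expR (- weight U 1 (2 * b) x))
  (fun x => expR (W x) * (2 * nrm U K x)) A
  (normc (cintegral half (fun x => EnU x * K x))) (measurable_itv _) (mW _ _) mq.
move=> /(_ (fun x => expR_ge0 _)) H.
apply: le_trans (H _ A0 (normc_ge0 _) h _) _.
- by move=> x; rewrite mulr_ge0 ?expR_ge0// mulr_ge0// nrm_ge0.
- apply: le_trans (normc_cintegral (measurable_itv _) (cintegrable_EnUM mK HK)) _.
  rewrite le_eqVlt; apply/orP; left; apply/eqP; apply: eq_integral => x _; congr EFin.
  rewrite normc_EnUM wE.
  transitivity (expR (- W x) * expR (W x) * (expR (- W x) * (2 * nrm U K x))); last by ring.
  by rewrite -expRD addNr expR0; ring.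
rewrite [(A * 4)%:E]EFinM -muleA lee_wpmul2l ?lee_fin ?(ltW A0)// half_energyE.
rewrite (ge0_integralZ_EFin (measurable_itv _) _ (fun x _ => sqr_ge0 _)) ?ler0n//; last exact: measurable_funX.
rewrite le_eqVlt; apply/orP; left; apply/eqP; apply: eq_integral => x _; congr EFin.
rewrite wE.
transitivity ((expR (- W x) * expR (W x)) ^+ 2 * (4 * nrm U K x ^+ 2)); first by ring.
by rewrite -expRD addNr expR0 expr1n mul1r.
Qed.

End resolvent_pieces.

(** * Bounds for the two half-line operators *)

Section resolvent_bounds.
Context {R : realType} (U : R -> R) (gamma : R[i]) (a : R).
Local Notation mu := (@lebesgue_measure R).
Local Notation RT := (measurableTypeR R).
Local Notation Re := (@complex.Re R).
Local Notation normc := (@Normc.normc R).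
Local Notation U' := (derive1 U).
Local Notation half := (`[0%R, +oo[%classic : set RT).
Local Notation H2 := (half_energy U).
Local Notation b := (Re gamma).
Local Notation Ep := (Ep gamma).
Local Notation En := (En gamma).
Local Notation EpU := (EpU U gamma).
Local Notation EnU := (EnU U gamma).
Local Notation E2U := (E2U U gamma).
Local Notation W := (weight U 2^-1 b).
Hypothesis dU : forall x, is_derive x (1 : R) U (U' x).
Hypothesis cU' : continuous U'.
Hypothesis U'_ge0 : forall x : R, 0 <= x -> 0 <= U' x.
Hypothesis U'_pinfty : U' x @[x --> +oo] --> +oo.
Hypothesis U'_slope : forall x y, 0 <= x -> x <= y -> U' x <= U' y + `|a| * (y - x).
Implicit Types (f g h k K : R -> R[i]) (z w c : R[i]).

Let cU : continuous U.
Proof.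
by move=> x; apply/differentiable_continuous/derivable1_diffP; have [] := dU x.
Qed.

Let cW : continuous W. Proof. exact: continuous_weight. Qed.

Let k12 : 0 < (2^-1 : R). Proof. by rewrite invr_gt0. Qed.

Let cEW : continuous (fun x => expR (W x)).
Proof. exact: continuous_expR_weight. Qed.

Let cENW : continuous (fun x => expR (- W x)).
Proof. exact: continuous_expRN_weight. Qed.

Let mU' : cmeasurable (fun x => (U' x)%:C).
Proof. by apply: cmeasurable_real; exact: continuous_measurable_fun. Qed.

Let m2nrm K : cmeasurable K -> measurable_fun (setT : set RT) (fun x => 2 * nrm U K x).
Proof. by move=> mK; apply: measurable_funM => //; exact: measurable_nrm. Qed.

Let nrm2_ge0 K x : 0 <= 2 * nrm U K x.
Proof. by rewrite mulr_ge0// nrm_ge0. Qed.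

Let integral_2nrm K : cmeasurable K ->
  (\int[mu]_(x in half) ((2 * nrm U K x) ^+ 2)%:E = 4%:E * H2 K)%E.
Proof.
move=> mK; rewrite half_energyE.
rewrite (ge0_integralZ_EFin (measurable_itv _) _ (fun x _ => sqr_ge0 _)) ?ler0n//; last first.
  by apply: measurable_funTS; apply: measurable_funX; exact: measurable_nrm.
by apply: eq_integral => x _; congr EFin; ring.
Qed.

(** [r] is built on the whole line from a primitive of [EnU * K], since [cac] is a condition on all
    of R; its formula and bounds concern x >= 0. The bound on U' r later places the derivative of
    the solution in L^2(nu). *)
Lemma right_piece : exists2 C : R, 0 <= C & forall K, clocally_integrable K -> (H2 K < +oo)%E ->
  exists r : R -> R[i],
  [/\ cac r (fun x => (gamma + (U' x)%:C) * r x - K x),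
      forall x, 0 <= x -> r x = EpU x * cintegral `[x, +oo[ (fun t => EnU t * K t),
      (H2 r <= C%:E * H2 K)%E &
      (H2 (fun x => (U' x)%:C * r x)%R <= C%:E * H2 K)%E].
Proof.
have [C1 C10 h1] := integral_weight_left dU cU' U'_ge0 U'_pinfty b k12.
have [C2 C20 h2] := integral_weight_right dU cU' U'_ge0 U'_pinfty b k12.
have [C3 C30 h3] := integral_weight_tail dU cU' U'_ge0 U'_pinfty b k12 U'_slope.
pose C := C1 + C2 + C3.
have C0 : 0 < C by rewrite !addr_gt0.
have leC (d D : R) (x : \bar R) : d <= C -> 0 <= D -> (x <= (d * D)%:E)%E -> (x <= (C * D)%:E)%E.
  by move=> cC D0 /le_trans; apply; rewrite lee_fin ler_wpM2r.
have C1C : C1 <= C by rewrite /C; lra.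
have C2C : C2 <= C by rewrite /C; lra.
have C3C : C3 <= C by rewrite /C; lra.
exists (C ^+ 2 * 4); first by rewrite mulr_ge0 ?sqr_ge0.
move=> K lK HK; have mK := clocal_cmeasurable lK.
have IK := cintegrable_EnUM gamma dU cU' U'_ge0 U'_pinfty mK HK.
have [J cJ J0] := cac_prim (clocalM (cac_EnU gamma dU cU') lK).
pose m0 := cintegral half (fun x => EnU x * K x).
pose r x := EpU x * (m0 - J x).
have cr : cac r (fun x => (gamma + (U' x)%:C) * r x - K x).
  apply: cac_eq (cacM (cac_EpU gamma dU cU') (cacB (cac_cst m0) cJ)) _ _ => x //.
  rewrite /r; transitivity ((gamma + (U' x)%:C) * EpU x * (m0 - J x) - (EpU x * EnU x) * K x).
    by ring.
  by rewrite EpU_EnU; ring.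
have rE x : 0 <= x -> r x = EpU x * cintegral `[x, +oo[ (fun t => EnU t * K t).
  move=> x0; rewrite /r /m0 (cintegral_itvy_split x0 IK) -(cacE cJ x0) J0.
  by congr (_ * _); ring.
have mr := cac_cmeasurable cr.
(* One estimate for both uses of [hardy_right]: m = 1 for r and m = |U' x| for U' r. *)
have bound m x : 0 <= m -> 0 <= x ->
    ((m * nrm U r x)%:E <= \int[mu]_(t in `[x, +oo[) (m * expR (W x - W t) * (2 * nrm U K t))%:E)%E.
  move=> m_ge0 x0.
  rewrite {1}/nrm (rE _ x0) -/(nrm U (fun y => EpU y * cintegral `[x, +oo[ (fun t => EnU t * K t)) x).
  rewrite nrm_EpUM mulrA EFinM.
  have Ix := cintegrable_half_itvy x0 IK.
  have mW0 : 0 <= m * expR (W x) by rewrite mulr_ge0 ?expR_ge0.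
  apply: le_trans (lee_wpmul2l _ (normc_cintegral (measurable_itv _) Ix)) _; first by rewrite lee_fin.
  rewrite (ge0_integralZ_EFin (measurable_itv _) _ _ mW0).
  - rewrite le_eqVlt; apply/orP; left; apply/eqP; apply: eq_integral => t _; congr EFin.
    by rewrite normc_EnUM (expRD (W x) (- W t)); ring.
  - apply: measurable_funM => //; case: Ix => I1 I2.
    by apply: measurable_normc; [exact: measurable_integrable_EFin I1|
      exact: measurable_integrable_EFin I2].
  - by move=> t _; rewrite mulr_ge0// normc_ge0.
exists r; split => //.
- rewrite half_energyE EFinM -muleA -integral_2nrm//.
  apply: (@hardy_right _ W (fun=> 1) C) => //.
  + move=> y y0; under eq_integral do rewrite mul1r.
    by have [h _] := h1 _ y0; exact: leC h.
  + move=> y y0; under eq_integral do rewrite mul1r.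
    by have [h _] := h2 _ y0; exact: leC h.
  + exact: m2nrm.
  + exact: measurable_nrm.
  + by move=> x; exact: nrm_ge0.
  + by move=> x x0; have := bound 1 x ler01 x0; rewrite mul1r.
- rewrite half_energyE EFinM -muleA -integral_2nrm//.
  apply: (@hardy_right _ W (fun x => `|U' x|) C) => //.
  + by apply: measurableT_comp => //; exact: continuous_measurable_fun.
  + by move=> y y0; have [_ h] := h1 _ y0; exact: leC h.
  + by move=> y y0; exact: leC (h3 _ y0).
  + exact: m2nrm.
  + by apply: measurable_nrm => //; exact: cmeasurableM.
  + by move=> x; exact: nrm_ge0.
  + move=> x x0; have := bound `|U' x| x (normr_ge0 _) x0.
    rewrite (_ : nrm U (fun y => (U' y)%:C * r y) x = `|U' x| * nrm U r x)//.
    rewrite /nrm Normc.normcM mulrA; congr (_ * _ * _).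
    by rewrite normc_sqnorm /sqnorm/= expr0n addr0 sqrtr_sqr.
Qed.

Lemma cintegral_En_reflect h x : cmeasurable h ->
  cintegral `[- x, 0] (fun t => En t * h t) =
  cintegral `[0, x] (fun t => Ep t * h (- t)).
Proof.
move=> mh; rewrite -(cintegral_reflect (- x) 0 (f := fun t => En t * h t)).
  rewrite opprK oppr0; apply: eq_cintegral => t _.
  by rewrite EnN.
by apply: cmeasurableM => //; exact: cmeasurable_En.
Qed.

Let bound_left h x : clocally_integrable h -> 0 <= x ->
  ((normc (cintegral `[- x, 0] (fun t => En t * h t)))%:E <=
   \int[mu]_(t in `[0%R, x]) (expR (W t) * (2 * nrm U (fun x => h (- x)) t))%:E)%E.
Proof.
move=> lh x0; have mh := clocal_cmeasurable lh.
rewrite cintegral_En_reflect//.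
have I : cintegrable `[0, x] (fun t => Ep t * h (- t)).
  have [F cF _] := cac_prim (clocalM (cac_En gamma) lh).
  have := cac_itv 0 x (cac_reflect cF).
  move=> /(cintegrableZ (- 1) (measurable_itv _)).
  by apply: eq_cintegrable => // t _; rewrite EnN mulN1r opprK.
apply: le_trans (normc_cintegral (measurable_itv _) I) _.
rewrite le_eqVlt; apply/orP; left; apply/eqP; apply: eq_integral => t _; congr EFin.
by rewrite (normc_EpM U gamma (fun x => h (- x)) t); ring.
Qed.

(** After reflection the solution is c e^{-gamma x} plus an integral operator with kernel e^{-gamma
    (x - t)} for t <= x. The first term has finite energy by [half_energy_En]; the second falls
    under [hardy_left]. *)
Lemma left_piece : exists2 C : R, 0 <= C & forall h c, clocally_integrable h ->
  (H2 (fun x => h (- x)%R) < +oo)%E ->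
  exists P : R -> R[i],
  [/\ cac P (fun x => gamma * P x - h x),
      forall x, x <= 0 -> P x = Ep x * (c + cintegral `[x, 0] (fun t => En t * h t)),
      P 0 = c &
      (H2 (fun x => P (- x)%R) <= C%:E * ((sqnorm c)%:E + H2 (fun x => h (- x)%R)))%E].
Proof.
have [C1 C10 h1] := integral_weight_left dU cU' U'_ge0 U'_pinfty b k12.
have [C2 C20 h2] := integral_weight_right dU cU' U'_ge0 U'_pinfty b k12.
pose C := C1 + C2.
have C0 : 0 < C by rewrite !addr_gt0.
have leC (d D : R) (x : \bar R) : d <= C -> 0 <= D -> (x <= (d * D)%:E)%E -> (x <= (C * D)%:E)%E.
  by move=> cC D0 /le_trans; apply; rewrite lee_fin ler_wpM2r.
have C1C : C1 <= C by rewrite /C; lra.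
have C2C : C2 <= C by rewrite /C; lra.
have HEn := half_energy_En gamma dU cU' U'_ge0 U'_pinfty.
have HEn0 : 0 <= fine (H2 En) by rewrite fine_ge0// half_energy_ge0.
exists (2 * fine (H2 En) + 2 * (C ^+ 2 * 4)).
  by rewrite addr_ge0// mulr_ge0// mulr_ge0 ?sqr_ge0.
move=> h c lh Hh; have mh := clocal_cmeasurable lh.
have [I cI I0] := cac_prim (clocalM (cac_En gamma) lh).
pose P x := Ep x * (c - I x).
have cP : cac P (fun x => gamma * P x - h x).
  apply: cac_eq (cacM (cac_Ep gamma) (cacB (cac_cst c) cI)) _ _ => x //.
  rewrite /P; transitivity (gamma * Ep x * (c - I x) - (Ep x * En x) * h x); first by ring.
  by rewrite Ep_En; ring.
have PE x : x <= 0 -> P x = Ep x * (c + cintegral `[x, 0] (fun t => En t * h t)).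
  by move=> x0; rewrite -(cacE cI x0) I0 sub0r.
have mP := cac_cmeasurable cP.
exists P; split => //.
  by rewrite /P I0 Ep0 subr0 mul1r.
pose q x := En x * cintegral `[- x, 0] (fun t => En t * h t).
(* [q1] is measurable on the whole line by construction and agrees with the integral operator [q] on
   x >= 0. *)
pose q1 x := P (- x) - c * En x.
have mq1 : cmeasurable q1.
  apply: cmeasurableD; first exact: cmeasurable_reflect.
  apply: cmeasurableN; apply: cmeasurableM; first exact: cmeasurable_cst.
  exact: cmeasurable_En.
have q1E x : 0 <= x -> q1 x = q x.
  by move=> x0; rewrite /q1 PE ?oppr_le0// EpN /q; ring.
have Hq : (H2 q1 <= (C ^+ 2 * 4)%:E * H2 (fun x => h (- x)%R))%E.
  rewrite half_energyE EFinM -muleA -integral_2nrm; last exact: cmeasurable_reflect.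
  apply: (@hardy_left _ W C) => //.
  + by move=> y y0; have [k _] := h1 _ y0; exact: leC k.
  + by move=> y y0; have [k _] := h2 _ y0; exact: leC k.
  + by apply: m2nrm; exact: cmeasurable_reflect.
  + exact: measurable_nrm.
  + by move=> x; exact: nrm_ge0.
  move=> x x0; rewrite /nrm (q1E _ x0).
  rewrite -/(nrm U (fun y => En y * cintegral `[- x, 0] (fun t => En t * h t)) x) nrm_EnM EFinM.
  apply: le_trans (lee_wpmul2l _ (bound_left lh x0)) _; first by rewrite lee_fin expR_ge0.
  rewrite (ge0_integralZ_EFin (measurable_itv _) _ _ (expR_ge0 _)).
  - rewrite le_eqVlt; apply/orP; left; apply/eqP; apply: eq_integral => t _; congr EFin.
    by rewrite (expRD (W t) (- W x)) /nrm; ring.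
  - apply: measurable_funTS; apply: measurable_funM; first exact: continuous_measurable_fun.
    by apply: m2nrm; exact: cmeasurable_reflect.
  - by move=> t _; rewrite mulr_ge0 ?expR_ge0.
have mcEn : cmeasurable (fun x => c * En x).
  by apply: cmeasurableM; [exact: cmeasurable_cst|exact: cmeasurable_En].
have H0 := half_energy_ge0 U (fun x => h (- x)).
apply: (@le_trans _ _ (2%:E * H2 (fun x => c * En x)%R + 2%:E * H2 q1)%E).
  rewrite (_ : (fun x => P (- x)) = (fun x => c * En x + q1 x)); last first.
    by apply/funext => x; rewrite /q1; ring.
  exact: half_energyD.
rewrite half_energyZ//; last exact: cmeasurable_En.
have -> : H2 En = (fine (H2 En))%:E by rewrite fineK// ge0_fin_numE// half_energy_ge0.
move: Hq Hh H0; set X := half_energy U (fun x => h (- x)).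
case: X => [X| |]; [|by move=> _; rewrite ltxx|by move=> _ _; rewrite leeNy_eq].
move=> Hq _ X0.
apply: le_trans (leeD2l _ (lee_wpmul2l _ Hq)) _; first by rewrite lee_fin.
rewrite -!EFinM -!EFinD lee_fin.
have s0 := sqnorm_ge0 c; have X0' : 0 <= X by rewrite -lee_fin.
(* [e1] and [e2] are the cross terms by which the product of the two sums exceeds what has to be
   bounded. *)
have e1 : 0 <= fine (H2 En) * X by rewrite mulr_ge0.
have e2 : 0 <= C ^+ 2 * 4 * sqnorm c by rewrite mulr_ge0// mulr_ge0// sqr_ge0.
move: e1 e2; set F := fine _; set S := sqnorm c; set D := C ^+ 2 * 4.
move=> e1 e2; rewrite [fine _]/= -subr_ge0 (_ : _ - _ = 2 * (F * X) + 2 * (D * S)); last by ring.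
by apply: addr_ge0; apply: mulr_ge0.
Qed.

(** Uniqueness keeps the factor U' next to the left integral. Tonelli's theorem integrates |U'|
    e^{-2W} over the tail from t first; this gives at most C e^{-2W t} and leaves e^{-W} times a
    square-integrable function. *)
Lemma cintegrable_U'_left h : clocally_integrable h -> (H2 (fun x => h (- x)%R) < +oo)%E ->
  cintegrable half (fun x => EnU x * ((U' x)%:C * En x *
    cintegral `[- x, 0] (fun t => En t * h t))).
Proof.
move=> lh Hh; have mh := clocal_cmeasurable lh.
have [C C0 hC] := integral_weight_right dU cU' U'_ge0 U'_pinfty (2 * b) (@ltr01 R).
have [I cI I0] := cac_prim (clocalM (cac_En gamma) lh).
pose V := weight U 1 (2 * b).
pose k x := h (- x).
have mk : cmeasurable k by exact: cmeasurable_reflect.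
pose f t := expR (W t) * (2 * nrm U k t).
pose g x := `|U' x| * expR (- V x).
have mf : measurable_fun (setT : set RT) f.
  by apply: measurable_funM; [exact: continuous_measurable_fun|exact: m2nrm].
have f0 x : 0 <= f x by rewrite mulr_ge0 ?expR_ge0.
have mg : measurable_fun (setT : set RT) g.
  apply: continuous_measurable_fun => x; apply: cvgM; last exact: continuous_expRN_weight.
  by apply: cvg_norm; exact: cU'.
have g0 x : 0 <= g x by rewrite mulr_ge0 ?expR_ge0.
have fin : (\int[mu]_(x in half) ((g x)%:E * \int[mu]_(t in `[0%R, x]) (f t)%:E) < +oo)%E.
  rewrite -(tonelli_triangle mf mg f0 g0).
  have If : mu.-integrable half (EFin \o (fun x => 2 * C * (expR (- W x) * nrm U k x))).
    by apply: integrable_EFinZ => //; exact: integrable_expNW_nrm.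
  have /integrableP[_] := If; apply: le_lt_trans.
  apply: ge0_le_integral => //.
  - by move=> x _; rewrite mule_ge0 ?lee_fin// integral_ge0// => t _; rewrite lee_fin.
  - apply: emeasurable_funM; first by apply/measurable_EFinP; exact: measurable_funTS.
    by apply: measurable_funTS; exact: measurable_integral_ge.
  - by apply: measurableT_comp => //; exact: (measurable_int mu If).
  move=> t /=; rewrite in_itv/= andbT => t0; have [_ ht] := hC _ t0.
  apply: le_trans (lee_wpmul2l _ ht) _; first by rewrite lee_fin.
  rewrite -EFinM lee_fin ger0_norm; last first.
    apply: mulr_ge0; first by rewrite mulr_ge0// ltW.
    by apply: mulr_ge0; [exact: expR_ge0|exact: nrm_ge0].
  rewrite le_eqVlt; apply/orP; left; apply/eqP; rewrite /f.
  have -> : expR (- weight U 1 (2 * b) t) = expR (- W t) * expR (- W t).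
    by rewrite -expRD; congr expR; rewrite /weight; field.
  transitivity (2 * C * ((expR (W t) * expR (- W t)) * expR (- W t) * nrm U k t)); first by ring.
  by rewrite -expRD subrr expR0 mul1r.
pose q x := cintegral `[- x, 0] (fun t => En t * h t).
have [J cJ J0] := cac_prim (clocalM (cac_En gamma) lh).
have mJ := cmeasurable_reflect (cac_cmeasurable cJ).
(* The integral over [-x, 0] is replaced by a primitive of [En * h], which makes measurability on
   the whole line immediate. *)
pose G x := EnU x * ((U' x)%:C * En x * (- J (- x))).
have mG : cmeasurable G.
  apply: cmeasurableM; first exact: cmeasurable_EnU.
  apply: cmeasurableM; last exact: cmeasurableN.
  by apply: cmeasurableM => //; exact: cmeasurable_En.
suff : cintegrable half G.
  apply: eq_cintegrable => // x /=; rewrite in_itv/= andbT => x0; congr (_ * (_ * _)).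
  by rewrite -(cacE cJ) ?oppr_le0// J0 sub0r.
have [mGr mGi] := mG.
have nG : (\int[mu]_(x in half) (normc (G x))%:E < +oo)%E.
  apply: le_lt_trans fin.
  have mn : measurable_fun half (fun x => normc (G x)).
    by apply: measurable_normc; exact: measurable_funTS.
  have mR : measurable_fun half (fun x => (g x)%:E * \int[mu]_(t in `[0%R, x]) (f t)%:E)%E.
    apply: emeasurable_funM; first by apply/measurable_EFinP; exact: measurable_funTS.
    by apply: measurable_funTS; exact: measurable_integral_le.
  apply: (ge0_le_integral_EFin (measurable_itv _) mn mR); first by move=> x _; exact: normc_ge0.
  move=> x /=; rewrite in_itv/= andbT => x0.
  have -> : normc (G x) = g x * normc (cintegral `[- x, 0] (fun t => En t * h t)).
    rewrite /G -(cacE cJ) ?oppr_le0// J0 sub0r.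
    rewrite (_ : EnU x * _ = (U' x)%:C * E2U x * - J (- x)); last by rewrite -EnU_En; ring.
    rewrite Normc.normcM [normc ((U' x)%:C * _)]Normc.normcM normc_E2U; congr (_ * _ * _).
    by rewrite normc_sqnorm /sqnorm/= expr0n addr0 sqrtr_sqr.
  by rewrite EFinM lee_wpmul2l ?lee_fin// bound_left.
have IG : mu.-integrable half (EFin \o (fun x => normc (G x))).
  apply/integrableP; split.
    by apply/measurable_EFinP; apply: measurable_normc; exact: measurable_funTS.
  by under eq_integral do rewrite gee0_abs ?lee_fin ?normc_ge0//.
by apply: cintegrable_normc IG _ => //; exact: measurable_funTS.
Qed.

End resolvent_bounds.

(** * The zigzag generator *)

Section zigzag_generator.
Context {R : realType} (U lrefr : R -> R) (a : R) (s : bool)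
  (nu : {measure set (measurableTypeR R) -> \bar R}) (gamma : R[i]).
Local Notation mu := (@lebesgue_measure R).
Local Notation RT := (measurableTypeR R).
Local Notation U' := (derive1 U).
Local Notation half := (`[0%R, +oo[%classic : set RT).
Local Notation H2 := (half_energy U).
Local Notation Ep := (Ep gamma).
Local Notation En := (En gamma).
Local Notation EpU := (EpU U gamma).
Local Notation EnU := (EnU U gamma).
Local Notation E2U := (E2U U gamma).
Local Notation L := (Lop U lrefr s).
Hypothesis nuE : is_gibbs_measure U nu.
Hypothesis dU : forall x, is_derive x (1 : R) U (U' x).
Hypothesis cU' : continuous U'.
Hypothesis U'_le0 : forall x : R, x <= 0 -> U' x <= 0.
Hypothesis U'_ge0 : forall x : R, 0 <= x -> 0 <= U' x.
Hypothesis U'_pinfty : U' x @[x --> +oo] --> +oo.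
Hypothesis U'_slope : forall x y, 0 <= x -> x <= y -> U' x <= U' y + `|a| * (y - x).
Hypothesis U_even : forall x, U x = U (- x).
Hypothesis U0 : U 0 = 0.
Hypothesis lrefr0 : forall x, lrefr x = 0.
Implicit Types (f g h k K : R -> R[i]) (z w c : R[i]).

Let cU : continuous U.
Proof.
by move=> x; apply/differentiable_continuous/derivable1_diffP; have [] := dU x.
Qed.

Let sgn : R[i] := (-1) ^+ s.

Let mU' : cmeasurable (fun x => (U' x)%:C).
Proof. by apply: cmeasurable_real; exact: continuous_measurable_fun. Qed.

Lemma L2_half f : L2 nu f <-> [/\ cmeasurable f, (H2 f < +oo)%E &
  (H2 (fun x => f (- x)%R) < +oo)%E].
Proof.
rewrite (L2E nuE cU); split.
  move=> [mf]; rewrite (energy_split dU U_even mf) => Hf; split => //.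
    by apply: le_lt_trans Hf; rewrite leeDl// half_energy_ge0.
  by apply: le_lt_trans Hf; rewrite leeDr// half_energy_ge0.
move=> [mf H1 H2']; split => //.
by rewrite (energy_split dU U_even mf) lte_add_pinfty.
Qed.

Lemma L2B f g : L2 nu f -> L2 nu g -> L2 nu (fun x => f x - g x).
Proof.
move=> /L2_half[mf f1 f2] /L2_half[mg g1 g2]; apply/L2_half.
have N k : (fun x => - k x) = (fun x => (- 1) * k x) :> (R -> R[i]).
  by apply/funext => x; rewrite mulN1r.
split.
- by apply: cmeasurableD => //; exact: cmeasurableN.
- apply: half_energyD_lty => //; first exact: cmeasurableN.
  by rewrite N half_energyZ_lty.
- apply: half_energyD_lty => //.
  + exact: cmeasurable_reflect.
  + by apply: cmeasurableN; exact: cmeasurable_reflect.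
  + by rewrite N half_energyZ_lty//; exact: cmeasurable_reflect.
Qed.

Lemma eq_half_energy_gt0 f g : cmeasurable f -> cmeasurable g ->
  (forall x, 0 < x -> f x = g x) -> H2 f = H2 g.
Proof.
move=> mf mg fg; rewrite /half_energy -!integral_itv_obnd_cbnd.
- apply: eq_integral => x; rewrite inE/= in_itv/= andbT => x0.
  by rewrite fg.
- by apply/measurable_EFinP; apply: measurable_funTS; exact: measurable_energy.
- by apply/measurable_EFinP; apply: measurable_funTS; exact: measurable_energy.
Qed.

(** The derivative (-2 gamma - U') E2U of [E2U] is integrated up to infinity. This links the stated
    formulas, which contain U', to those of the construction, which do not. *)
Lemma cintegral_U'E2U x : 0 <= x ->
  cintegral `[x, +oo[ (fun t => (U' t)%:C * E2U t) =
  E2U x - 2 * gamma * cintegral `[x, +oo[ E2U.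
Proof.
move=> x0.
have I1 := cintegrable_E2U gamma dU cU' U'_ge0 U'_pinfty.
have I2 := cintegrable_U'E2U gamma dU cU' U'_ge0 U'_pinfty.
have cE := cac_E2U gamma dU cU'.
pose z := - 2 * gamma.
have I3 : cintegrable half (fun t => z * E2U t + (- 1) * ((U' t)%:C * E2U t)).
  by apply: cintegrableD => //; apply: cintegrableZ.
have e : {ae mu, forall y, 0 <= y -> (- 2 * gamma - (U' y)%:C) * E2U y =
    z * E2U y + (- 1) * ((U' y)%:C * E2U y)}.
  by apply: aeW => y _; rewrite /z; ring.
rewrite {1}(cac_tail cE I1 I3 e x0).
have J1 := cintegrable_half_itvy x0 I1; have J2 := cintegrable_half_itvy x0 I2.
rewrite cintegralD//; [|exact: cintegrableZ|exact: cintegrableZ].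
by rewrite !cintegralZ// /z; ring.
Qed.

Definition reflected_left h c (t : R) := En t * (c + cintegral `[- t, 0] (fun y => En y * h y)).

(* On x > 0, subtracting from f its reflected left part leaves r with
   r' = (gamma + U') r - source: unlike U' f(-x), the source stays in L^2. *)
Definition source h c (t : R) := h t + sgn * h (- t) - 2 * sgn * gamma * reflected_left h c t.


Let bndD f g (A B : R) : cmeasurable f -> cmeasurable g ->
  (H2 f <= A%:E)%E -> (H2 g <= B%:E)%E ->
  (H2 (fun x => f x + g x)%R <= (2 * A + 2 * B)%:E)%E.
Proof.
move=> mf mg fA gB; apply: le_trans (half_energyD dU mf mg) _.
by rewrite (EFinD (2 * A)) (EFinM 2 A) (EFinM 2 B) leeD// lee_wpmul2l.
Qed.

Let bndZ z f (A : R) : cmeasurable f -> (H2 f <= A%:E)%E ->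
  (H2 (fun x => z * f x)%R <= (sqnorm z * A)%:E)%E.
Proof.
by move=> mf fA; rewrite (half_energyZ dU)// EFinM lee_wpmul2l// lee_fin sqnorm_ge0.
Qed.

Let mZ z f : cmeasurable f -> cmeasurable (fun x => z * f x).
Proof. by move=> mf; apply: cmeasurableM => //; exact: cmeasurable_cst. Qed.

Lemma energy_fine h : L2 nu h -> energy U h = (fine (energy U h))%:E.
Proof. by move=> /(L2E nuE cU)[_ ?]; rewrite fineK// ge0_fin_numE// energy_ge0. Qed.

Lemma switching_rate_le0 x : x <= 0 -> switching_rate U lrefr x = 0.
Proof.
by move=> x0; rewrite /switching_rate lrefr0 addr0; apply/max_idPr; exact: U'_le0.
Qed.

Lemma switching_rate_ge0 x : 0 <= x -> switching_rate U lrefr x = U' x.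
Proof.
by move=> x0; rewrite /switching_rate lrefr0 addr0; apply/max_idPl; exact: U'_ge0.
Qed.

(** [K] extends [source] to the whole line, as [right_piece] requires, by using the global left
    solution P in place of its integral formula. [N] is the common scale of all the bounds. *)
Lemma left_resolvent : exists2 C : R, 0 <= C & forall h c, L2 nu h ->
  let N := sqnorm c + fine (energy U h) in
  exists P, [/\ cac P (fun x => gamma * P x - h x),
    forall x, x <= 0 -> P x = Ep x * (c + cintegral `[x, 0] (fun t => En t * h t)),
    P 0 = c, (H2 (fun x => P (- x)%R) <= (C * N)%:E)%E &
    let K x := h x + sgn * h (- x) + - (2 * sgn * gamma) * P (- x) in
    [/\ clocally_integrable K, forall x, 0 <= x -> K x = source h c x &
      (H2 K <= (C * N)%:E)%E]].
Proof.
have [Cl Cl0 hl] := left_piece gamma dU cU' U'_ge0 U'_pinfty.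
pose z := - (2 * sgn * gamma).
have sz : 0 <= sqnorm z := sqnorm_ge0 z.
pose CK := 2 * (2 + 2 * (sqnorm sgn * 1)) + 2 * (sqnorm z * Cl).
have ss : 0 <= sqnorm sgn := sqnorm_ge0 sgn.
have CK0 : 0 <= CK.
  rewrite /CK; move: (sqnorm z) (sqnorm sgn) sz ss => u v u0 v0.
  by rewrite !(addr_ge0, mulr_ge0).
exists (Cl + CK); first by rewrite addr_ge0.
move=> h c Lh N; have [mh H1 H3] := (L2_half h).1 Lh.
have eN : energy U h = (fine (energy U h))%:E := energy_fine Lh.
have sE : energy U h = (H2 h + H2 (fun x => h (- x)%R))%E := energy_split dU U_even mh.
have c0 := sqnorm_ge0 c.
have N0 : 0 <= N by rewrite addr_ge0// fine_ge0// energy_ge0.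
have hN : (H2 h <= N%:E)%E.
  rewrite /N (EFinD (sqnorm c) (fine _)) -eN sE.
  apply: (@le_trans _ _ (H2 h + H2 (fun x => h (- x)%R))%E).
    by rewrite leeDl// half_energy_ge0.
  by rewrite leeDr.
have hN' : ((sqnorm c)%:E + H2 (fun x => h (- x)%R) <= N%:E)%E.
  by rewrite /N (EFinD (sqnorm c) (fine _)) -eN sE leeD2l// leeDr// half_energy_ge0.
have hN2 : (H2 (fun x => h (- x)%R) <= N%:E)%E.
  by apply: le_trans hN'; rewrite leeDr.
have lh := L2_clocal nuE cU Lh.
have [P [cP PE P0 HP]] := hl h c lh H3.
pose p x := P (- x); pose k x := h (- x).
have mk : cmeasurable k by exact: cmeasurable_reflect.
have mp : cmeasurable p by apply: cmeasurable_reflect; exact: cac_cmeasurable cP.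
have Hp : (H2 p <= (Cl * N)%:E)%E.
  by apply: le_trans HP _; rewrite EFinM lee_wpmul2l.
have cp := cac_reflect cP.
(* The equation of the reflected P expresses h(-x) through P(-x) and its derivative, both locally
   integrable. *)
have lk : clocally_integrable k.
  have e1 := clocalD (clocalZ gamma (cac_clocal_l cp)) (cac_clocal cp).
  by have <- : (fun x => gamma * P (- x) + - (gamma * P (- x) - h (- x))) = k by
    apply/funext => x; rewrite /k; ring.
exists P; split => //.
  by apply: le_trans Hp _; rewrite lee_fin ler_wpM2r// lerDl.
split.
- apply: clocalD; first by apply: clocalD => //; exact: clocalZ.
  by apply: clocalZ; exact: cac_clocal_l cp.
- by move=> x x0; rewrite /source /reflected_left PE ?oppr_le0// EpN; ring.
- apply: (@le_trans _ _ (CK * N)%:E); last by rewrite lee_fin ler_wpM2r// lerDr.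
  rewrite (_ : CK * N = 2 * (2 * N + 2 * (sqnorm sgn * N)) + 2 * (sqnorm z * (Cl * N))); last first.
    by rewrite /CK; ring.
  apply: bndD; [|exact: mZ| |exact: bndZ].
    by apply: cmeasurableD => //; exact: mZ.
  by apply: bndD => //; [exact: mZ|exact: bndZ].
Qed.

Lemma EpU_0 : EpU 0 = 1.
Proof. by rewrite /EpU U0 (_ : gamma * 0%:C + 0%:C = 0) ?cexp0//; rewrite addr0; apply: mulr0. Qed.

(** The solution is P x on the left and [sgn * P (- x) + r x] on the right, so that the switching
    term on the right is just -U' r. The condition on [c] is continuity at 0, that is c = sgn c + r
    0. *)
Lemma solution_exists : exists2 C : R, 0 <= C & forall h c, L2 nu h ->
  (1 - sgn) * c = cintegral half (fun x => EnU x * source h c x) ->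
  exists f g, [/\ cac f g, L2 nu f, L2 nu g,
    forall x, gamma * f x - (g x + (switching_rate U lrefr x)%:C *
      (sgn * f (- x) - f x)) = h x &
    [/\ forall x, x <= 0 -> f x = Ep x * (c + cintegral `[x, 0] (fun t => En t * h t)),
      forall x, 0 <= x -> f x = sgn * reflected_left h c x +
        EpU x * cintegral `[x, +oo[ (fun t => EnU t * source h c t) &
      (energy U f <= (C * (sqnorm c + fine (energy U h)))%:E)%E]].
Proof.
have [Cl Cl0 hl] := left_resolvent.
have [Cr Cr0 hr] := right_piece gamma dU cU' U'_ge0 U'_pinfty U'_slope.
pose Cf := 2 * (sqnorm sgn * Cl) + 2 * (Cr * Cl).
have ss : 0 <= sqnorm sgn := sqnorm_ge0 sgn.
exists (Cf + Cl).
  rewrite /Cf; move: (sqnorm sgn) ss => v v0.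
  by rewrite !(addr_ge0, mulr_ge0).
move=> h c Lh compat; have [mh H1 H3] := (L2_half h).1 Lh.
have := hl h c Lh; cbv zeta; set N := sqnorm c + _.
move=> [P [cP PE P0 Hp [lK KE HK]]].
pose K x := h x + sgn * h (- x) + - (2 * sgn * gamma) * P (- x).
rewrite -/K in lK HK; have {}KE : forall x, 0 <= x -> K x = source h c x := KE.
pose p x := P (- x).
have mp : cmeasurable p by apply: cmeasurable_reflect; exact: cac_cmeasurable cP.
have pE x : 0 <= x -> p x = reflected_left h c x.
  by move=> x0; rewrite /p PE ?oppr_le0// EpN.
have HKoo : (H2 K < +oo)%E by apply: le_lt_trans HK (ltry _).
have [r [cr rE Hr HUr]] := hr K lK HKoo.
have mr := cac_cmeasurable cr.
have Hr' : (H2 r <= (Cr * (Cl * N))%:E)%E.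
  by apply: le_trans Hr _; rewrite EFinM lee_wpmul2l.
have eqI x : 0 <= x -> cintegral `[x, +oo[ (fun t => EnU t * K t) =
    cintegral `[x, +oo[ (fun t => EnU t * source h c t).
  move=> x0; apply: eq_cintegral => t /=; rewrite in_itv/= andbT => xt.
  by rewrite KE// (le_trans x0).
pose q x := sgn * p x + r x.
have mq : cmeasurable q by apply: cmeasurableD => //; exact: mZ.
have cq : cac q (fun x => sgn * (- (gamma * P (- x) - h (- x))) + ((gamma + (U' x)%:C) * r x - K x)).
  by apply: cacD => //; apply: cacZ; exact: (cac_reflect cP).
have glue : P 0 = q 0.
  rewrite /q /p oppr0 P0 (rE _ (lexx 0)) EpU_0 mul1r (eqI _ (lexx 0)) -compat; ring.
have cf := cac_glue cP cq glue.
set f := (fun x => if x <= 0 then P x else q x) in cf.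
set g := (fun x => if x <= 0 then _ else _) in cf.
have fl x : x <= 0 -> f x = P x by rewrite /f => ->.
have fr x : 0 <= x -> f x = q x.
  rewrite /f le_eqVlt => /predU1P[<-|x0]; first by rewrite lexx.
  by rewrite leNgt x0.
(* The terms in h(-x) cancel and U' multiplies only [r], so each summand has finite half-energy. *)
have gr x : 0 < x -> g x = ((sgn * gamma) * p x + gamma * r x) + ((U' x)%:C * r x + - h x).
  by move=> x0; rewrite /g leNgt x0/= /K /p; ring.
have mf := cac_cmeasurable cf.
have mg := clocal_cmeasurable (cac_clocal cf).
have Hf1 : (H2 f <= (Cf * N)%:E)%E.
  rewrite (eq_half_energy U fr).
  rewrite (_ : Cf * N = 2 * (sqnorm sgn * (Cl * N)) + 2 * (Cr * (Cl * N))); last first.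
    by rewrite /Cf; ring.
  by apply: bndD => //; [exact: mZ|exact: bndZ].
have Hf2 : (H2 (fun x => f (- x)%R) <= (Cl * N)%:E)%E.
  rewrite (@eq_half_energy _ U _ p)// => x x0; rewrite fl ?oppr_le0//.
have Hf : (energy U f <= ((Cf + Cl) * N)%:E)%E.
  by rewrite (energy_split dU U_even mf) mulrDl EFinD leeD.
exists f, g; split => //.
- by apply/(L2E nuE cU); split => //; apply: le_lt_trans Hf (ltry _).
- apply/L2_half; split => //.
  + pose g1 x := ((sgn * gamma) * p x + gamma * r x) + ((U' x)%:C * r x + - h x).
    have mUr : cmeasurable (fun x => (U' x)%:C * r x) by exact: cmeasurableM.
    have mNh : cmeasurable (fun x => - h x) by exact: cmeasurableN.
    have m1 : cmeasurable (fun x => (sgn * gamma) * p x + gamma * r x).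
      by apply: cmeasurableD; exact: mZ.
    have m2 : cmeasurable (fun x => (U' x)%:C * r x + - h x) by exact: cmeasurableD.
    (* At 0 the glued derivative takes its left value, so it is compared with [g1] only for x >
       0. *)
    rewrite (@eq_half_energy_gt0 _ g1)//; last exact: cmeasurableD.
    apply: half_energyD_lty => //.
      apply: half_energyD_lty => //; [exact: mZ|exact: mZ| |].
        by apply: half_energyZ_lty => //; apply: le_lt_trans Hp (ltry _).
      by apply: half_energyZ_lty => //; apply: le_lt_trans Hr' (ltry _).
    apply: half_energyD_lty => //.
      by apply: le_lt_trans HUr _; rewrite lte_mul_pinfty.
    rewrite (_ : (fun x => - h x) = (fun x => (- 1) * h x)).
      exact: half_energyZ_lty.
    by apply/funext => x; rewrite mulN1r.
  + rewrite (@eq_half_energy _ U _ (fun x => gamma * p x + (- 1) * h (- x))); last first.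
      by move=> x x0; rewrite /g oppr_le0 x0 /p mulN1r.
    have mk := cmeasurable_reflect mh.
    apply: half_energyD_lty => //; [exact: mZ|exact: mZ| |].
      by apply: half_energyZ_lty => //; apply: le_lt_trans Hp (ltry _).
    exact: half_energyZ_lty.
- move=> x; have [x0|x0] := leP x 0.
    by rewrite switching_rate_le0// fl// /g x0; ring.
  rewrite switching_rate_ge0 ?ltW// gr// (fr x) ?ltW// (fl (- x)) ?oppr_le0 ?ltW//.
  by rewrite /q /p; ring.
split => //.
- by move=> x x0; rewrite fl// PE.
- by move=> x x0; rewrite fr// /q pE// rE// eqI.
Qed.


(** The form in which Z arises from gluing: 1 - sgn comes from the values at 0, the rest from the
    part of [source] proportional to c. *)
Lemma ZfunE : Zfun U s gamma = 1 - sgn + 2 * sgn * gamma * cintegral half E2U.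
Proof.
have E0 : E2U 0 = 1.
  by rewrite /E2U U0 (_ : - 2 * gamma * 0%:C - 0%:C = 0) ?cexp0//; rewrite subr0; apply: mulr0.
rewrite /Zfun (_ : cintegral _ _ = E2U 0 - 2 * gamma * cintegral half E2U); last first.
  exact: (cintegral_U'E2U (lexx 0)).
by rewrite E0 /sgn; ring.
Qed.

(** The integral of [EnU * source h 0] takes the place of m_gamma(h) in the existence proof. Its
    bound controls c = f 0 by the energy of h. *)
Lemma mass_bound : exists2 C : R, 0 <= C & forall h, L2 nu h ->
  cintegrable half (fun x => EnU x * source h 0 x) /\
  sqnorm (cintegral half (fun x => EnU x * source h 0 x)) <= C * fine (energy U h).
Proof.
have [Cl Cl0 hl] := left_resolvent.
have [C C0 hC] := sqnorm_cintegral_EnUM gamma dU cU' U'_ge0 U'_pinfty.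
exists (C * Cl); first exact: mulr_ge0.
move=> h Lh; have := hl h 0 Lh; cbv zeta.
have -> : sqnorm (0 : R[i]) = 0 by rewrite /sqnorm/=; ring.
rewrite add0r => -[P [_ _ _ _ [lK KE HK]]].
pose K x := h x + sgn * h (- x) + - (2 * sgn * gamma) * P (- x).
rewrite -/K in lK HK; have {}KE : forall x, 0 <= x -> K x = source h 0 x := KE.
have mK := clocal_cmeasurable lK.
have HKoo : (H2 K < +oo)%E by apply: le_lt_trans HK (ltry _).
have e x : half x -> EnU x * K x = EnU x * source h 0 x.
  by rewrite /= in_itv/= andbT => x0; rewrite KE.
split.
  apply: eq_cintegrable e _ => //.
  exact: cintegrable_EnUM.
rewrite -(eq_cintegral e) -lee_fin.
apply: le_trans (hC _ mK HKoo) _.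
by rewrite -mulrA EFinM lee_wpmul2l.
Qed.

(** [source] is affine in c, and its linear part is a multiple of [En], whose integral against [EnU]
    is that of [E2U]. By [ZfunE], continuity at 0 becomes a scalar equation with coefficient Z. *)
Lemma jump_conditionE h c : L2 nu h ->
  (1 - sgn) * c - cintegral half (fun x => EnU x * source h c x) =
  Zfun U s gamma * c - cintegral half (fun x => EnU x * source h 0 x).
Proof.
move=> Lh; have [C _ /(_ h Lh)[I1 _]] := mass_bound.
have I2 := cintegrable_E2U gamma dU cU' U'_ge0 U'_pinfty.
have -> : (fun x => EnU x * source h c x) =
    (fun x => EnU x * source h 0 x + (- (2 * sgn * gamma) * c) * E2U x).
  by apply/funext => x; rewrite -EnU_En /source /reflected_left; ring.
rewrite cintegralD//; last exact: cintegrableZ.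
by rewrite cintegralZ// ZfunE; ring.
Qed.

Lemma ae_eq_energy f g : cmeasurable f -> cmeasurable g ->
  {ae mu, forall x, f x = g x} -> energy U f = energy U g.
Proof.
move=> mf mg fg; apply: ge0_ae_eq_integral => //.
- by apply/measurable_EFinP; exact: measurable_energy.
- by apply/measurable_EFinP; exact: measurable_energy.
- by move=> x _; rewrite lee_fin mulr_ge0 ?sqnorm_ge0 ?expR_ge0.
- by move=> x _; rewrite lee_fin mulr_ge0 ?sqnorm_ge0 ?expR_ge0.
- by apply: ae_imp fg => x e _; rewrite e.
Qed.

(** [resolvent_formula] with a free constant c = f 0 in place of m / Z, so that with h = 0 it also
    describes eigenfunctions. *)
Definition solution h c (x : R) : R[i] :=
  if x <= 0 then Ep x * (c + cintegral `[x, 0] (fun t => En t * h t))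
  else EpU x * cintegral `[x, +oo[ (fun t => EnU t *
    (h t + sgn * (U' t)%:C * En t * (c + cintegral `[- t, 0] (fun y => En y * h y)))).

(** For the continuous representative F, the derivatives of [En * F] on the left and then of
    [EnU * F] on the right are explicit. The former is integrated up to 0, the latter up to infinity
    by [cac_tail]; at x = 0 the latter gives the equation for c = F 0, whether or not Z vanishes. *)
Lemma shift_solution f h : W12 nu f -> L2 nu h ->
  {ae mu, forall x, spectral_shift (Lop U lrefr s) gamma f x = h x} ->
  exists c, c * Zfun U s gamma = mfun_gamma U s gamma h /\
    {ae mu, forall x, f x = solution h c x}.
Proof.
move=> Wf Lh eqn; have [F cF fF] := W12_cac Wf.
have [mh H1 H3] := (L2_half h).1 Lh.
have Lf := Wf.1; have [mf Ef] := (L2E nuE cU f).1 Lf.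
have mF := cac_cmeasurable cF.
have LF : L2 nu F by apply/(L2E nuE cU); rewrite -(ae_eq_energy mf mF fF).
have [_ HF HFN] := (L2_half F).1 LF.
have lh := L2_clocal nuE cU Lh.
have mg := clocal_cmeasurable (cac_clocal cF).
set g := weak_derivative f in cF mg.
have eqF : {ae mu, forall x, g x = gamma * F x - h x -
    (switching_rate U lrefr x)%:C * (sgn * F (- x) - F x)}.
  (* Reflection preserves null sets, so f(-x) may be replaced by F(-x) as well. *)
  have fF1 : {ae mu, forall x, f x = F x /\ f (- x) = F (- x)}.
    by apply: ae_imp2 fF (ae_reflect fF) => x.
  apply: ae_imp2 eqn fF1 => x; rewrite /spectral_shift /Lop -/g -/sgn.
  by move=> <- [<- <-]; ring.
pose c := F 0.
have FL x : x <= 0 -> F x = Ep x * (c + cintegral `[x, 0] (fun t => En t * h t)).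
  move=> x0; have cG := cacM (cac_En gamma) cF.
  have := cacE cG x0; rewrite En0 mul1r -/c.
  have mEh : cmeasurable (fun t => (-1) * (En t * h t)).
    apply: cmeasurableM; first exact: cmeasurable_cst.
    by apply: cmeasurableM => //; exact: cmeasurable_En.
  have [r1 i1] := clocal_cmeasurable (cac_clocal cG).
  have [r2 i2] := mEh.
  rewrite (@ae_eq_cintegral _ _ _ (fun t => (-1) * (En t * h t))) //; last 5 first.
  - exact: measurable_funTS.
  - exact: measurable_funTS.
  - exact: measurable_funTS.
  - exact: measurable_funTS.
  - apply: ae_imp eqF => t e /=; rewrite in_itv/= => /andP[_ t0].
    by rewrite e (switching_rate_le0)//; ring.
  rewrite cintegralZ//; last first.
    have [I0 cI0 _] := cac_prim (clocalM (cac_En gamma) lh).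
    exact: cac_itv cI0.
  move=> e; transitivity (Ep x * (En x * F x)); first by rewrite mulrA Ep_En mul1r.
  by congr (_ * _); rewrite -[LHS](subKr c) e mulN1r opprK.
pose q t := cintegral `[- t, 0] (fun y => En y * h y).
pose k t := h t + sgn * (U' t)%:C * En t * (c + q t).
have I1 := cintegrable_EnUM gamma dU cU' U'_ge0 U'_pinfty mh H1.
have I2 := cintegrable_U'E2U gamma dU cU' U'_ge0 U'_pinfty.
have I3 := cintegrable_U'_left gamma dU cU' U'_ge0 U'_pinfty lh H3.
have I4 : cintegrable half (fun t => EnU t * h t + sgn * (EnU t * ((U' t)%:C * En t * q t))).
  by apply: cintegrableD => //; exact: cintegrableZ.
(* The first two integrable pieces make up the integrand of [mfun_gamma]; the third is sgn c times
   the integrand of Z. *)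
have kE : (fun t => EnU t * k t) = (fun t =>
    (EnU t * h t + sgn * (EnU t * ((U' t)%:C * En t * q t))) + (sgn * c) * ((U' t)%:C * E2U t)).
  by apply/funext => t; rewrite -EnU_En /k; ring.
have Ik : cintegrable half (fun t => EnU t * k t).
  by rewrite kE; apply: cintegrableD => //; exact: cintegrableZ.
have FR x : 0 <= x -> EnU x * F x = cintegral `[x, +oo[ (fun t => EnU t * k t).
  move=> x0; have cG := cacM (cac_EnU gamma dU cU') cF.
  have IG := cintegrable_EnUM gamma dU cU' U'_ge0 U'_pinfty mF HF.
  have Ik' := cintegrableZ (-1) (measurable_itv _) Ik.
  rewrite (cac_tail cG IG Ik' _ x0).
    by rewrite cintegralZ ?mulN1r ?opprK//; exact: cintegrable_half_itvy x0 Ik.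
  apply: ae_imp eqF => t e t0; rewrite e (switching_rate_ge0)//.
  by rewrite (FL (- t)) ?oppr_le0// EpN /k /q; ring.
exists c; split.
  have := FR _ (lexx 0).
  have -> : EnU 0 = 1 by rewrite -[LHS]mul1r -(EpU_0) EpU_EnU (EpU_0).
  rewrite mul1r -/c kE cintegralD//; last exact: cintegrableZ.
  rewrite cintegralZ// => e.
  have -> : mfun_gamma U s gamma h = cintegral half (fun t =>
      EnU t * h t + sgn * (EnU t * ((U' t)%:C * En t * q t))).
    apply: eq_cintegral => t _; rewrite /q cintegral_En_reflect// -/sgn.
    by rewrite -/(EnU t) -/(En t); ring.
  rewrite -[in RHS](addrK (sgn * c * cintegral half (fun t => (U' t)%:C * E2U t)) (cintegral _ _)) -e.
  by rewrite /Zfun -/sgn -/(cintegral half (fun t => (U' t)%:C * E2U t)); ring.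
apply: ae_imp fF => x ->; rewrite /solution; case: leP => x0; first exact: FL.
by rewrite -FR ?ltW// mulrA EpU_EnU mul1r.
Qed.

Lemma ae_eq_gibbs f g : f = g %[ae nu] <-> {ae mu, forall x, f x = g x}.
Proof.
have e : (fun x => setT x -> f x = g x) = (fun x => f x = g x).
  by apply/funext => x; apply/propext; split => [|+ _]; exact.
rewrite -(ae_gibbsP nuE cU (fun x => f x = g x)); split => h.
  by change (almost_everywhere nu (fun x => f x = g x)); rewrite -e.
by change (almost_everywhere nu (fun x => setT x -> f x = g x)); rewrite e.
Qed.

(** The operator is linear only almost everywhere, because [weak_derivative] chooses a
    representative for each function separately. *)
Lemma W12_shiftB f g : W12 nu f -> W12 nu g ->
  W12 nu (fun x => f x - g x) /\
  {ae mu, forall x, spectral_shift L gamma (fun x => f x - g x) x =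
    spectral_shift L gamma f x - spectral_shift L gamma g x}.
Proof.
move=> [Lf [f' df Lf']] [Lg [g' dg Lg']].
have [F cF fF] := is_weak_derivative_cac df.
have [G cG gG] := is_weak_derivative_cac dg.
have lf := L2_clocal nuE cU Lf; have lg := L2_clocal nuE cU Lg.
have [_ wf] := cac_weak_derivative lf cF fF.
have [_ wg] := cac_weak_derivative lg cG gG.
have LfB := L2B Lf Lg.
have fG : {ae mu, forall x, f x - g x = F x - G x}.
  by apply: ae_imp2 fF gG => x -> ->.
have [dB wB] := cac_weak_derivative (L2_clocal nuE cU LfB) (cacB cF cG) fG.
split; first by split => //; exists (fun x => f' x - g' x) => //; exact: (L2B).
have wfg : {ae mu, forall x, weak_derivative f x = f' x /\ weak_derivative g x = g' x}.
  by apply: ae_imp2 wf wg => x.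
apply: ae_imp2 wB wfg => x e [e1 e2].
by rewrite /spectral_shift /Lop e e1 e2; ring.
Qed.

Lemma L2_0 : L2 nu (fun=> 0).
Proof.
apply/(L2E nuE cU); split; first exact: cmeasurable_cst.
rewrite /energy (_ : (fun x : R => _) = cst 0%E) ?integral0//.
by apply/funext => x; rewrite /sqnorm/= expr0n addr0 mul0r.
Qed.

Lemma solution0 c x : solution (fun=> 0) c x = c * solution (fun=> 0) 1 x.
Proof.
rewrite /solution; case: ifP => x0; first by rewrite !cintegralM0; ring.
rewrite -[RHS]mulrCA; congr (_ * _).
have e c1 t : EnU t * (0 + sgn * (U' t)%:C * En t *
    (c1 + cintegral `[(- t)%R, 0%R] (fun y => En y * 0))) =
    (sgn * c1) * ((U' t)%:C * E2U t).
  by rewrite -EnU_En cintegralM0; ring.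
have x0' : 0 <= x by move: x0; rewrite leNgt => /negbFE/ltW.
have I2 := cintegrable_half_itvy x0' (cintegrable_U'E2U gamma dU cU' U'_ge0 U'_pinfty).
under [in LHS]eq_cintegral => t _ do rewrite e.
under [in RHS]eq_cintegral => t _ do rewrite e.
by rewrite !cintegralZ//; ring.
Qed.

Lemma mfun_gamma0 : mfun_gamma U s gamma (fun=> 0) = 0.
Proof.
rewrite /mfun_gamma -[RHS](cintegralM0 half (fun=> 0)); apply: eq_cintegral => t _.
by rewrite cintegralM0 !mulr0 addr0 mulr0.
Qed.

(** [-1, 0] has positive measure. On that side an eigenfunction is e^{gamma x}, which never
    vanishes. *)
Lemma ae_exists (P : R -> Prop) : {ae mu, forall x, P x} -> exists2 x, x <= 0 & P x.
Proof.
move=> [A [mA A0 PA]]; apply: contrapT => nP.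
suff : (mu `[(-1)%R, 0%R]%classic <= 0)%E.
  by rewrite lebesgue_measure_itv/= lte_fin ltrN10 -EFinD lee_fin opprK add0r ler10.
rewrite -A0; apply: le_measure; rewrite ?inE//.
move=> x /=; rewrite in_itv/= => /andP[_ x0]; apply: PA => /= Px.
by apply: nP; exists x.
Qed.

Lemma eigenfunction_Z : Zfun U s gamma = 0 -> exists f,
  [/\ is_eigenfunction_formula U s gamma f, W12 nu f,
    {ae mu, forall x, L f x = gamma * f x} & ~ {ae mu, forall x, f x = 0}].
Proof.
move=> Z0.
have [C _ hC] := solution_exists.
have K0 c t : EnU t * source (fun=> 0) c t = (- (2 * sgn * gamma) * c) * E2U t.
  by rewrite -EnU_En /source /reflected_left cintegralM0 -/sgn; ring.
have I2 := cintegrable_E2U gamma dU cU' U'_ge0 U'_pinfty.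
have compat : (1 - sgn) * 1 = cintegral half (fun t => EnU t * source (fun=> 0) 1 t).
  apply/subr0_eq; rewrite (jump_conditionE)//; last exact: L2_0.
  rewrite Z0 mul0r sub0r; rewrite (_ : cintegral _ _ = 0) ?oppr0//.
  rewrite -[RHS](mul0r (cintegral half E2U)) -cintegralZ//.
  by apply: eq_cintegral => t _; rewrite K0 mulr0 !mul0r.
have [f [g [cf Lf Lg fg [fl fr _]]]] := hC _ _ L2_0 compat.
have [Wf wf] := cac_W12 nuE cU cf Lf Lg.
have fl1 x : x <= 0 -> f x = Ep x by move=> x0; rewrite fl// cintegralM0 addr0 mulr1.
exists f; split => //.
(* The construction yields sgn e^{-gamma x} minus 2 sgn gamma e^{gamma x + U} times a tail of [E2U];
   [cintegral_U'E2U] restores the stated form with U'. *)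
- split => // x x0; rewrite fr// -mulrA.
  have := cintegral_U'E2U x0.
  rewrite /E2U => ->.
  rewrite -/(E2U x) -/(EpU x) -/sgn /reflected_left cintegralM0 addr0 mulr1.
  have J2 := cintegrable_half_itvy x0 I2.
  under eq_cintegral => t _ do rewrite K0.
  rewrite cintegralZ// -(EpU_E2U U gamma x); ring.
- apply: ae_imp wf => x e; rewrite /Lop e.
  by have := fg x; rewrite -/sgn => /eqP; rewrite subr_eq add0r => /eqP ->.
- by move=> /ae_exists[x x0]; rewrite fl1//; apply/eqP; exact: cexp_neq0.
Qed.

(** * The resolvent at gamma with Z(gamma) nonzero *)

Section resolvent.
Hypothesis Z0 : Zfun U s gamma != 0.

Lemma resolvent_injective : shift_injective nu (W12 nu) L gamma.
Proof.
move=> f g Wf Wg /ae_eq_gibbs fg; apply/ae_eq_gibbs.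
have [We e] := W12_shiftB Wf Wg.
have e0 : {ae mu, forall x, spectral_shift L gamma (fun x => f x - g x) x = 0}.
  by apply: ae_imp2 e fg => x -> ->; rewrite subrr.
have [c []] := shift_solution We L2_0 e0.
rewrite mfun_gamma0 => /eqP; rewrite mulf_eq0 (negbTE Z0) orbF => /eqP ->.
by apply: ae_imp => x; rewrite solution0 mul0r => /subr0_eq.
Qed.

(** The choice c = m / Z solves the jump condition, and [M * sqnorm Z^-1] is the price of |c|^2 in
    terms of the energy of h. *)
Lemma resolvent_solution : exists2 C : R, 0 <= C & forall h, L2 nu h ->
  exists f, [/\ W12 nu f, spectral_shift L gamma f = h %[ae nu] &
    (energy U f <= C%:E * energy U h)%E].
Proof.
have [C C0 hC] := solution_exists.
have [M M0 hM] := mass_bound.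
pose Z := Zfun U s gamma.
exists (C * (M * sqnorm Z^-1 + 1)).
  by rewrite mulr_ge0// addr_ge0// mulr_ge0// sqnorm_ge0.
move=> h Lh; have [_ m1] := hM _ Lh.
set m := cintegral _ _ in m1.
have compat : (1 - sgn) * (m / Z) = cintegral half (fun t => EnU t * source h (m / Z) t).
  apply/subr0_eq; rewrite (jump_conditionE)//.
  by rewrite -/m -/Z mulrCA divff// mulr1 subrr.
have [f [g [cf Lf Lg fg [_ _ fE]]]] := hC _ _ Lh compat.
have [Wf wf] := cac_W12 nuE cU cf Lf Lg.
exists f; split => //.
  apply/ae_eq_gibbs; apply: ae_imp wf => x e.
  by rewrite /spectral_shift /Lop e -/sgn fg.
apply: le_trans fE _; rewrite [in leRHS](energy_fine Lh) -EFinM lee_fin -mulrA ler_wpM2l//.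
rewrite mulrDl mul1r lerD2r sqnormM mulrAC.
by rewrite ler_wpM2r ?sqnorm_ge0.
Qed.

Lemma resolvent_bounded : shift_inverse_bounded nu (W12 nu) L gamma.
Proof.
have [C C0 hC] := resolvent_solution.
exists (Num.sqrt C) => f h Wf Lh fh.
have [f1 [Wf1 f1h Ef1]] := hC _ Lh.
have ff1 : f = f1 %[ae nu].
  apply: resolvent_injective => //; apply/ae_eq_gibbs.
  apply: ae_imp2 ((ae_eq_gibbs _ _).1 fh) ((ae_eq_gibbs _ _).1 f1h) => x.
  by move=> -> ->.
have [mf _] := (L2E nuE cU f).1 Wf.1; have [mf1 _] := (L2E nuE cU f1).1 Wf1.1.
have [mh _] := (L2E nuE cU h).1 Lh.
apply: (L2norm_le nuE cU) => //.
by rewrite sqr_sqrtr// (ae_eq_energy mf mf1 ((ae_eq_gibbs _ _).1 ff1)).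
Qed.

Lemma resolvent_set_Z : resolvent_set nu (W12 nu) L gamma.
Proof.
split; [exact: resolvent_injective| |exact: resolvent_bounded].
by move=> h Lh; have [C _ /(_ h Lh)[f [Wf fh _]]] := resolvent_solution; exists f.
Qed.

End resolvent.

Lemma not_injective_Z : Zfun U s gamma = 0 -> ~ shift_injective nu (W12 nu) L gamma.
Proof.
move=> Z0 inj; have [f [_ Wf Lf f0]] := eigenfunction_Z Z0; apply: f0.
have [W0 e0] := W12_shiftB Wf Wf.
(* The comparison function is f - f rather than 0 because [W12_shiftB] supplies both its membership
   in the domain and its image. *)
suff : f = (fun x => f x - f x) %[ae nu].
  by move=> /ae_eq_gibbs; apply: ae_imp => x; rewrite subrr.
apply: inj => //; apply/ae_eq_gibbs.
by apply: ae_imp2 e0 Lf => x ->; rewrite subrr /spectral_shift => ->; rewrite subrr.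
Qed.

End zigzag_generator.

Theorem theorem5p3 (R : realType) (U lrefr : R -> R)
    (nu : {measure set (measurableTypeR R) -> \bar R})
    (delta a A : R)
    (nuE : is_gibbs_measure U nu)
    (lrefr_cont : continuous lrefr) (lrefr_ge0 : forall x, 0 <= lrefr x)
    (U_C2 : C2 U)
    (expU_int :
      lebesgue_measure.-integrable setT (fun x => (expR (- U x))%:E))
    (delta01 : 0 < delta < 1) (A_gt0 : 0 < A)
    (U''_bounds : forall x,
      a <= derive1 (derive1 U) x <= delta * `|derive1 U x| ^+ 2 + A)
    (U'_pinfty : derive1 U x @[x --> +oo] --> +oo)
    (U'_ninfty : derive1 U x @[x --> -oo] --> -oo)
    (U0 : U 0 = 0)
    (U'_le0 : forall x : R, x <= 0 -> derive1 U x <= 0)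
    (U'_ge0 : forall x : R, 0 <= x -> 0 <= derive1 U x)
    (U_even : forall x, U x = U (- x))
    (lrefr0 : forall x, lrefr x = 0) :
  forall s : bool,
    let L := Lop U lrefr s in
    let D := W12 nu in
    [/\ point_spectrum nu D L = spectrum nu D L
          /\ spectrum nu D L = Sigma U s,
        forall gamma, resolvent_set nu D L gamma ->
          forall h f, L2 nu h -> D f -> spectral_shift L gamma f = h %[ae nu] ->
            f = resolvent_formula U s gamma h %[ae nu]
      & forall gamma, spectrum nu D L gamma ->
          exists f_gamma : R -> R[i],
            [/\ is_eigenfunction_formula U s gamma f_gamma,
                D f_gamma,
                eigenfunctions nu D L gamma f_gamma,
                ~ (f_gamma = (fun=> 0) %[ae nu])
              & forall f, eigenfunctions nu D L gamma f ->
                  exists c : R[i], f = (fun x => c * f_gamma x) %[ae nu]]].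
Proof.
have [d1 d2 c2] := U_C2.
have dU x : is_derive x (1 : R) U (derive1 U x).
  by apply: DeriveDef; rewrite ?derive1E.
have dU' x : is_derive x (1 : R) (derive1 U) (derive1 (derive1 U) x).
  by apply: DeriveDef; rewrite ?(derive1E (derive1 U)).
have cU : continuous U.
  by move=> x; apply/differentiable_continuous/derivable1_diffP.
have cU' : continuous (derive1 U).
  by move=> x; apply/differentiable_continuous/derivable1_diffP.
(* By the mean value theorem and U'' >= a >= -|a|, U' loses at most |a| (y - x) between x and y. *)
have slope x y : 0 <= x -> x <= y -> derive1 U x <= derive1 U y + `|a| * (y - x).
  move=> _; rewrite le_eqVlt => /predU1P[->|xy]; first by rewrite subrr mulr0 addr0.
  have [z _ e] := MVT xy (fun z _ => dU' z) (continuous_subspaceT cU').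
  have /andP[az _] := U''_bounds z.
  rewrite -lerBlDl -opprB lerNl e -mulNr ler_wpM2r ?subr_ge0 ?(ltW xy)//.
  by apply: le_trans az; rewrite lerNl -normrN ler_norm.
move=> s L D.
have eqE f g := ae_eq_gibbs nuE dU f g.
have inZ gamma : Zfun U s gamma != 0 -> resolvent_set nu D L gamma.
  exact: (resolvent_set_Z nuE dU cU' U'_le0 U'_ge0 U'_pinfty slope U_even U0 lrefr0).
have notinj gamma : Zfun U s gamma = 0 -> ~ shift_injective nu D L gamma.
  exact: (not_injective_Z nuE dU cU' U'_le0 U'_ge0 U'_pinfty slope U_even U0 lrefr0).
have specZ gamma : spectrum nu D L gamma -> Zfun U s gamma = 0.
  by move=> sp; apply/eqP; apply: contrapT => /negP /inZ.
split.
- split; apply/seteqP; split => gamma.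
  + by move=> ninj [inj _ _].
  + by move=> /specZ; exact: notinj.
  + exact: specZ.
  + by move=> Z0 [inj _ _]; exact: notinj Z0 inj.
- move=> gamma [inj _ _] h f Lh Df /eqE fh; apply/eqE.
  have Z0 : Zfun U s gamma != 0 by apply/eqP => /notinj.
  have [c [cZ]] := shift_solution nuE dU cU' U'_le0 U'_ge0 U'_pinfty U_even U0 lrefr0 Df Lh fh.
  (* For this value of c, [solution] and [resolvent_formula] are convertible. *)
  have -> : c = mfun_gamma U s gamma h / Zfun U s gamma by rewrite -cZ mulfK.
  by apply: ae_imp.
- move=> gamma /specZ Z0.
  have [f0 [ff Wf Lf nf0]] := eigenfunction_Z nuE dU cU' U'_le0 U'_ge0 U'_pinfty slope
    U_even U0 lrefr0 Z0.
  have sol g : {ae lebesgue_measure, forall x, L g x = gamma * g x} -> D g ->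
      exists c, {ae lebesgue_measure, forall x, g x = solution U s gamma (fun=> 0) c x}.
    move=> Lg Dg.
    have g0 : {ae lebesgue_measure, forall x, spectral_shift L gamma g x = 0}.
      by apply: ae_imp Lg => x; rewrite /spectral_shift => ->; rewrite subrr.
    have [c [_ gE]] := shift_solution nuE dU cU' U'_le0 U'_ge0 U'_pinfty U_even
      U0 lrefr0 Dg (L2_0 nuE dU) g0.
    by exists c.
  have [c0 f0E] := sol _ Lf Wf.
  have c0N : c0 != 0.
    apply/eqP => z; apply: nf0; apply: ae_imp f0E => x ->.
    by rewrite (solution0 s gamma dU cU' U'_ge0 U'_pinfty) z mul0r.
  exists f0; split => //.
  + by split => //; apply/eqE.
  + by move=> /eqE.
  + move=> g [Dg /eqE Lg]; have [c gE] := sol _ Lg Dg.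
    (* By [solution0], both functions are multiples of the solution with constant 1, by the factors
       c and c0. *)
    exists (c / c0); apply/eqE; apply: ae_imp2 gE f0E => x -> ->.
    rewrite (solution0 s gamma dU cU' U'_ge0 U'_pinfty c).
    by rewrite (solution0 s gamma dU cU' U'_ge0 U'_pinfty c0) mulrA divfK.
Qed.
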